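(* Let $F$ be a graph root distribution on $\mathcal K$ satisfying assumptions (A1), (A2), (A3) (stated in the context), and for each $n$ let $\mathbf A_n$ be the $n\times n$ adjacency matrix generated from $F$. Let $\mathbf Z=(\mathbf X,\mathbf Y)$ be the hidden node data matrix whose $i$th row is $(X_i,Y_i)\in\mathcal K$, $1\le i\le n$. If $p_1=p_2=p=o\left(n^{\frac{1}{2\beta+\alpha}}\right)$, then the truncated weighted spectral embedding $\hat{\mathbf Z}_A$ (with suitable choice of the signs of the eigenvectors) satisfies $$n^{-1}\|\hat{\mathbf Z}_A-\mathbf Z^{(p,p)}\|_F^2=O_P\left(n^{-\frac{\alpha-1}{2\beta}}+p^{2\beta+1}n^{-1}\right),$$ where $\|\cdot\|_F$ is the Frobenius norm. As a consequence, letting $\hat F_A^{(p)}$ be the empirical distribution putting mass $1/n$ at each row of $\hat{\mathbf Z}_A$ and $\hat F^{(p)}$ the one putting mass $1/n$ at each row of $\mathbf Z^{(p,p)}$, $$d_{\rm w}(\hat F_A^{(p)},\hat F^{(p)})=O_P\left(n^{-\frac{\alpha-1}{4\beta}}+p^{\beta+1/2}n^{-1/2}\right).$$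
   Context: Krein space: $\mathcal H_+=\mathcal H_-=\{x\in\mathbb R^\infty:\sum_j x_j^2<\infty\}$ with the usual inner product, and $\mathcal K=\mathcal H_+\ominus\mathcal H_-$ is the set of pairs $(x,y)$, $x\in\mathcal H_+$, $y\in\mathcal H_-$, with indefinite inner product $\langle(x,y),(x',y')\rangle_{\mathcal K}=\langle x,x'\rangle_{\mathcal H_+}-\langle y,y'\rangle_{\mathcal H_-}$, norm $\|(x,y)\|=(\|x\|^2+\|y\|^2)^{1/2}$, and its Borel $\sigma$-field. A graph root distribution (GRD) is a Borel probability measure $F$ on $\mathcal K$ such that $\mathbb P(\langle Z_1,Z_2\rangle_{\mathcal K}\in[0,1])=1$ for independent $Z_1,Z_2\sim F$. Sampling: $Z_i=(X_i,Y_i)$, $i\ge1$, are iid from $F$; given these, $A_{ij}$, $i<j$, are independent Bernoulli with parameter $\langle Z_i,Z_j\rangle_{\mathcal K}$; $A_{ji}=A_{ij}$, $A_{ii}=0$; $\mathbf A_n=(A_{ij})_{1\le i,j\le n}$. Assumptions on $F$: (A1) For all $j,j'\ge1$: $\mathbb E_{(X,Y)\sim F}(X_jX_{j'})=\lambda_j\mathbf 1(j=j')$, $\mathbb E_{(X,Y)\sim F}(Y_jY_{j'})=\gamma_j\mathbf 1(j=j')$, $\mathbb E_{(X,Y)\sim F}(X_jY_{j'})=0$. (A2) There are positive numbers $c_1\le c_2$ and $1<\alpha\le\beta$ such that for all $j\ge1$: $c_1j^{-\alpha}\le\lambda_j\wedge\gamma_j\le\lambda_j\vee\gamma_j\le c_2j^{-\alpha}$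 and $(\lambda_j-\lambda_{j+1})\wedge(\gamma_j-\gamma_{j+1})\ge c_1j^{-\beta}$. (A3) $\mathbb E_{Z\sim F}\|Z\|^4<\infty$. Truncated weighted spectral embedding: write the eigendecomposition $\mathbf A_n=\sum_{j=1}^{n_1}\hat\lambda_{j,A}\hat a_j\hat a_j^T-\sum_{j=1}^{n-n_1}\hat\gamma_{j,A}\hat b_j\hat b_j^T$ with orthonormal eigenvectors, $\hat\lambda_{1,A}\ge\dots\ge\hat\lambda_{n_1,A}\ge0$ the nonnegative eigenvalues and $\hat\gamma_{1,A}\ge\dots\ge\hat\gamma_{n-n_1,A}>0$ the absolute values of the negative eigenvalues. For truncation levels $p_1,p_2$, $\hat{\mathbf Z}_A=[\hat{\mathbf X}_A^{(p_1)},\hat{\mathbf Y}_A^{(p_2)}]$ with $\hat{\mathbf X}_A^{(p_1)}=[\hat\lambda_{1,A}^{1/2}\hat a_1,\dots,\hat\lambda_{p_1,A}^{1/2}\hat a_{p_1}]$ and $\hat{\mathbf Y}_A^{(p_2)}=[\hat\gamma_{1,A}^{1/2}\hat b_1,\dots,\hat\gamma_{p_2,A}^{1/2}\hat b_{p_2}]$. Eigenvectors are determined only up to sign; the signs (one for each of the $p_1+p_2$ columns) are taken to match the coordinates of $F$. Notation: $\mathbf Z^{(p,p)}=(\mathbf X^{(p)},\mathbf Y^{(p)})$, where $\mathbf M^{(p)}$ denotes the first $p$ columns of $\mathbf M$. Rows of length $p+p$ are viewed as elements of $\mathcal K$ by padding each part with zeros. $p$ may depend on $n$ and limits are as $n\to\infty$.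 $d_{\rm w}(F_1,F_2)=\inf_\nu\mathbb E_{(Z_1,Z_2)\sim\nu}\|Z_1-Z_2\|$, the infimum being over couplings $\nu$ of $F_1$ and $F_2$. *)

(* Defs.v *)
From HB Require Import structures.
From mathcomp Require Import all_boot all_order all_algebra.
From mathcomp Require Import all_classical all_reals all_analysis finmap ring lra.

Set Implicit Arguments.
Unset Strict Implicit.
Unset Printing Implicit Defensive.

Import Order.TTheory GRing.Theory Num.Theory.
Import numFieldNormedType.Exports.

Local Open Scope classical_set_scope.
Local Open Scope ring_scope.

Section inner_norm.
Context {R : realType} {V : lmodType R} (f : V -> V -> R).
Hypotheses (fC : forall x y, f x y = f y x)
  (fD : forall x y z, f (x + y) z = f x z + f y z)
  (fZ : forall a x y, f (a *: x) y = a * f x y)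
  (f_ge0 : forall x, 0 <= f x x) (f_eq0 : forall x, f x x = 0 -> x = 0).

Definition inner_norm (x : V) : R := Num.sqrt (f x x).

Lemma inner_norm_sqr x : inner_norm x ^+ 2 = f x x.
Proof. exact: sqr_sqrtr. Qed.

Lemma inner_norm_ge0 x : 0 <= inner_norm x.
Proof. exact: sqrtr_ge0. Qed.

Lemma inner_norm_eq0 x : inner_norm x = 0 -> x = 0.
Proof. by move=> x0; apply: f_eq0; rewrite -inner_norm_sqr x0 expr0n. Qed.

Lemma inner_normZ a x : inner_norm (a *: x) = `|a| * inner_norm x.
Proof.
by rewrite /inner_norm fZ fC fZ mulrA -expr2 sqrtrM ?sqr_ge0// sqrtr_sqr.
Qed.

Lemma inner_cauchy_schwarz x y : f x y <= inner_norm x * inner_norm y.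
Proof.
have [/inner_norm_eq0 ->|x0] := eqVneq (inner_norm x) 0.
  by rewrite -(scale0r 0) fZ mul0r mulr_ge0 ?inner_norm_ge0.
have x2_gt0 : 0 < f x x.
  by rewrite -inner_norm_sqr exprn_gt0// lt_neqAle eq_sym x0 inner_norm_ge0.
have := f_ge0 (f x x *: y + (- f x y) *: x).
have -> : f (f x x *: y + (- f x y) *: x) (f x x *: y + (- f x y) *: x)
    = f x x * (f x x * f y y - f x y ^+ 2).
  rewrite fD !fZ !(fC _ (_ + _)) !fD !fZ (fC y x).
  ring.
rewrite pmulr_rge0// subr_ge0 -!inner_norm_sqr -exprMn => h.
apply: le_trans (ler_norm _) _.
by rewrite -(ler_pXn2r (ltn0Sn 1)) ?nnegrE ?mulr_ge0 ?inner_norm_ge0// real_normK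
  ?num_real.
Qed.

Lemma inner_norm_triangle x y :
  inner_norm (x + y) <= inner_norm x + inner_norm y.
Proof.
rewrite -(ler_pXn2r (ltn0Sn 1)) ?nnegrE ?addr_ge0 ?inner_norm_ge0//.
rewrite inner_norm_sqr fD !(fC _ (_ + _)) !fD (fC y x) sqrrD !inner_norm_sqr.
rewrite mulr2n !addrA lerD2r -!addrA lerD2l lerD//; exact: inner_cauchy_schwarz.
Qed.

End inner_norm.

Section square_summable.
Context {R : realType}.
Implicit Types x y : nat -> R.

Definition square_summable : {pred nat -> R} :=
  [pred x : nat -> R | `[< cvgn (series (fun j => x j ^+ 2)) >]].

Lemma square_summableP x :
  reflect (cvgn (series (fun j => x j ^+ 2))) (x \in square_summable).
Proof. by apply: (iffP idP) => [/asboolP|/asboolP]. Qed.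

Lemma square_summable_prod x y :
  x \in square_summable -> y \in square_summable ->
  cvgn (series (fun j => x j * y j)).
Proof.
move=> /square_summableP cx /square_summableP cy.
have cxy : cvgn (series (fun j => x j ^+ 2 + y j ^+ 2)).
  exact: is_cvg_seriesD cx cy.
have h n : 0 <= `|x n * y n| by [].
have h2 n : 0 <= x n ^+ 2 + y n ^+ 2 by rewrite addr_ge0 ?sqr_ge0.
have h3 n : `|x n * y n| <= x n ^+ 2 + y n ^+ 2.
  rewrite ler_norml; apply/andP; split; have := sqr_ge0 (x n + y n);
  have := sqr_ge0 (x n - y n); have := sqr_ge0 (x n); have := sqr_ge0 (y n); nra.
exact: normed_cvg (series_le_cvg h h2 h3 cxy).
Qed.

Lemma square_summable_submod : submod_closed square_summable.
Proof.
split=> [|a x y xs ys].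
  apply/square_summableP.
  rewrite (_ : series _ = cst 0); first exact: is_cvg_cst.
  apply/funext => n; rewrite /series/= big1// => i _.
  by rewrite -[LHS]/(0 ^+ 2) expr0n.
apply/square_summableP.
have -> : series (fun j => (a *: x + y) j ^+ 2) =
    a ^+ 2 *: series (fun j => x j * x j)
    + (a *+ 2) *: series (fun j => x j * y j) + series (fun j => y j * y j).
  apply/funext => n; rewrite !fctE /series/= !scaler_sumr -!big_split/=.
  by apply: eq_bigr => i _; rewrite /GRing.scale/=; ring.
by apply: is_cvgD; [apply: is_cvgD; apply: is_cvgZl_tmp|];
  exact: square_summable_prod.
Qed.

HB.instance Definition _ :=
  GRing.isSubmodClosed.Build R (nat -> R) square_summable square_summable_submod.

End square_summable.

Record ell2 (R : realType) := Ell2 {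
  ell2_val :> nat -> R;
  _ : ell2_val \in square_summable }.

HB.instance Definition _ (R : realType) := [isSub for @ell2_val R].
HB.instance Definition _ (R : realType) := [Choice of ell2 R by <:].
HB.instance Definition _ (R : realType) :=
  [SubChoice_isSubLmodule of ell2 R by <:].

Section ell2_inner.
Context {R : realType}.
Implicit Types (x y z : ell2 R) (a : R).

Definition ell2_inner x y : R := limn (series (fun j => x j * y j)).

Lemma ell2_inner_cvg x y : cvgn (series (fun j => x j * y j)).
Proof. by apply: square_summable_prod; exact: valP. Qed.

Lemma ell2_innerC x y : ell2_inner x y = ell2_inner y x.
Proof.
by rewrite /ell2_inner; under eq_fun do rewrite mulrC.
Qed.

Lemma ell2_innerD x y z :
  ell2_inner (x + y) z = ell2_inner x z + ell2_inner y z.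
Proof.
rewrite /ell2_inner -limD; [|exact: ell2_inner_cvg..].
congr (lim (_ @ \oo)); apply/funext => n; rewrite /series/= fctE -big_split/=.
by apply: eq_bigr => i _; rewrite mulrDl.
Qed.

Lemma ell2_innerZ a x y : ell2_inner (a *: x) y = a * ell2_inner x y.
Proof.
rewrite /ell2_inner -[RHS]limZl_tmp; last exact: ell2_inner_cvg.
congr (lim (_ @ \oo)); apply/funext => n; rewrite !fctE /series/= [RHS]mulr_sumr.
by apply: eq_bigr => i _; exact: esym (mulrA _ _ _).
Qed.

Lemma ell2_inner_ge_coord x j : x j ^+ 2 <= ell2_inner x x.
Proof.
apply: limr_ge; first exact: ell2_inner_cvg.
exists j.+1 => // n /= jn; rewrite /series/= (bigD1_seq j)/= ?iota_uniq//; last first.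
  by rewrite mem_index_iota.
by rewrite -expr2 lerDl sumr_ge0// => i _; rewrite -expr2 sqr_ge0.
Qed.

Lemma ell2_inner_ge0 x : 0 <= ell2_inner x x.
Proof. exact: le_trans (sqr_ge0 _) (ell2_inner_ge_coord x 0). Qed.

Lemma ell2_inner_eq0 x : ell2_inner x x = 0 -> x = 0.
Proof.
move=> x0; apply/val_inj/funext => j; apply/eqP; rewrite -sqrf_eq0.
by rewrite eq_le sqr_ge0 andbT -x0; exact: ell2_inner_ge_coord.
Qed.

End ell2_inner.

HB.instance Definition _ (R : realType) := Lmodule_isNormed.Build R (ell2 R)
  (inner_norm_triangle ell2_innerC ell2_innerD ell2_innerZ ell2_inner_ge0
     ell2_inner_eq0)
  (inner_normZ ell2_innerC ell2_innerZ)
  (inner_norm_eq0 ell2_inner_ge0 ell2_inner_eq0).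

(* The Krein space; its norm is the Hilbert norm (|x|^2 + |y|^2)^(1/2), not the
   max norm that the library puts on products. *)
Definition krein (R : realType) : Type := (ell2 R * ell2 R)%type.

HB.instance Definition _ (R : realType) :=
  GRing.Lmodule.copy (krein R) (ell2 R * ell2 R)%type.

Section krein_inner.
Context {R : realType}.
Implicit Types (z w : krein R) (a : R).

Definition krein_inner z w : R := ell2_inner z.1 w.1 - ell2_inner z.2 w.2.

Definition krein_hilbert_inner z w : R :=
  ell2_inner z.1 w.1 + ell2_inner z.2 w.2.

Lemma krein_hilbert_innerC z w :
  krein_hilbert_inner z w = krein_hilbert_inner w z.
Proof. by congr (_ + _); exact: ell2_innerC. Qed.

Lemma krein_hilbert_innerD z z' w : krein_hilbert_inner (z + z') w =
  krein_hilbert_inner z w + krein_hilbert_inner z' w.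
Proof. by rewrite /krein_hilbert_inner !ell2_innerD addrACA. Qed.

Lemma krein_hilbert_innerZ a z w :
  krein_hilbert_inner (a *: z) w = a * krein_hilbert_inner z w.
Proof. by rewrite /krein_hilbert_inner !ell2_innerZ mulrDr. Qed.

Lemma krein_hilbert_inner_ge0 z : 0 <= krein_hilbert_inner z z.
Proof. by rewrite addr_ge0 ?ell2_inner_ge0. Qed.

Lemma krein_hilbert_inner_eq0 z : krein_hilbert_inner z z = 0 -> z = 0.
Proof.
move/eqP; rewrite paddr_eq0 ?ell2_inner_ge0// => /andP[/eqP h1 /eqP h2].
by case: z h1 h2 => x y /= /ell2_inner_eq0 -> /ell2_inner_eq0 ->.
Qed.

End krein_inner.

HB.instance Definition _ (R : realType) := Lmodule_isNormed.Build R (krein R)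
  (inner_norm_triangle krein_hilbert_innerC krein_hilbert_innerD
     krein_hilbert_innerZ krein_hilbert_inner_ge0 krein_hilbert_inner_eq0)
  (inner_normZ krein_hilbert_innerC krein_hilbert_innerZ)
  (inner_norm_eq0 krein_hilbert_inner_ge0 krein_hilbert_inner_eq0).

Lemma krein_normE (R : realType) (z : krein R) :
  `|z| = Num.sqrt (`|z.1| ^+ 2 + `|z.2| ^+ 2).
Proof. by congr Num.sqrt; rewrite !sqr_sqrtr ?ell2_inner_ge0. Qed.

HB.instance Definition _ (R : realType) := Measurable.copy (krein R)
  (g_sigma_algebraType (@open (krein R))).

Section padding.
Context {R : realType}.

Definition pad_seq p (v : 'rV[R]_p) (j : nat) : R := oapp (v 0) 0 (insub j).

Lemma pad_seq_square_summable p (v : 'rV[R]_p) :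
  pad_seq v \in square_summable.
Proof.
apply/square_summableP.
have -> : (fun j => pad_seq v j ^+ 2) = (fun j => pad_seq v j * pad_seq v j).
  by apply/funext => j; rewrite expr2.
apply: (cvgP (series (fun j => pad_seq v j * pad_seq v j) p)).
apply: cvg_near_cst.
exists p => // n /= pn; rewrite /series/= (big_cat_nat (leq0n p) pn)/=.
rewrite [X in _ + X]big1_seq ?addr0// => j /andP[_].
rewrite mem_index_iota => /andP[pj _].
have jp : (j < p)%N = false by rewrite ltnNge pj.
by rewrite /pad_seq (@insubF _ (fun k => k < p)%N _ j jp) mul0r.
Qed.

Definition ell2_pad p (v : 'rV[R]_p) : ell2 R := Ell2 (pad_seq_square_summable v).

Definition krein_pad p1 p2 (v : 'rV[R]_(p1 + p2)) : krein R :=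
  (ell2_pad (lsubmx v), ell2_pad (rsubmx v)).

End padding.

(* Coordinates, lam and gam are indexed from 0, so index j stands for the
   mathematical index j + 1; hence j.+1%:R in polynomial_decay. *)
Section graph_root_distribution.
Context {R : realType} (F : probability (krein R) R).
Local Open Scope ereal_scope.

Definition graph_root_distribution : Prop :=
  (F \x F) [set z | (0 <= krein_inner z.1 z.2 <= 1)%R] = 1.

Definition uncorrelated_coordinates (lam gam : nat -> R) : Prop :=
  forall j j' : nat,
    [/\ 'E_F[(fun z => z.1 j * z.1 j')%R] = (lam j *+ (j == j'))%:E,
        'E_F[(fun z => z.2 j * z.2 j')%R] = (gam j *+ (j == j'))%:E &
        'E_F[(fun z => z.1 j * z.2 j')%R] = 0].

Definition finite_fourth_moment : Prop := 'E_F[(fun z => `|z| ^+ 4)%R] < +oo.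

End graph_root_distribution.

Definition polynomial_decay {R : realType} (alpha beta : R) (lam gam : nat -> R)
    : Prop :=
  1 < alpha /\ alpha <= beta /\
  exists c1 c2 : R, [/\ 0 < c1, c1 <= c2 & forall j,
    [/\ c1 * j.+1%:R `^ (- alpha) <= Num.min (lam j) (gam j),
        Num.max (lam j) (gam j) <= c2 * j.+1%:R `^ (- alpha) &
        c1 * j.+1%:R `^ (- beta) <=
          Num.min (lam j - lam j.+1) (gam j - gam j.+1)]].

Section sampling.
Context {R : realType} {d : measure_display} {Omega : measurableType d}
  (P : probability Omega R).

Definition mutually_independent {d'} {T : measurableType d'}
    (Z : nat -> {RV P >-> T}) : Prop :=
  forall (J : {fset nat}) (B : nat -> set T), (forall i, measurable (B i)) ->
    P (\bigcap_(i in [set` J]) (Z i @^-1` B i)) =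
    (\prod_(i <- J) P (Z i @^-1` B i))%E.

Definition iid_from {d'} {T : measurableType d'} (F : probability T R)
    (Z : nat -> {RV P >-> T}) : Prop :=
  mutually_independent Z /\
  forall i B, measurable B -> distribution P (Z i) B = F B.

Definition generated_events {d'} {T : measurableType d'}
    (Z : nat -> {RV P >-> T}) : set (set Omega) :=
  <<s \bigcup_i preimage_set_system setT (Z i) measurable >>.

(* Conditionally on the sigma-field of all the Z_i, the A_ij (i < j) are
   independent Bernoulli with parameters <Z_i, Z_j>: the finite-dimensional
   conditional laws are the products of Bernoulli mass functions, in the sense
   that both sides agree when integrated over every event E of that
   sigma-field. *)
Definition conditionally_bernoulli (Z : nat -> {RV P >-> krein R})
    (A : nat -> nat -> {RV P >-> bool}) : Prop :=
  forall (n : nat) (a : nat -> nat -> bool) (E : set Omega),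
    generated_events Z E ->
    P (E `&` [set w | forall i j, (i < j < n)%N -> A i j w = a i j]) =
    (\int[P]_(w in E) (\prod_(j < n) \prod_(i < j)
        bernoulli_pmf (krein_inner (Z i w) (Z j w)) (a i j))%:E)%E.

Definition random_graph (Z : nat -> {RV P >-> krein R})
    (A : nat -> nat -> {RV P >-> bool}) : Prop :=
  [/\ conditionally_bernoulli Z A,
      forall i j w, A j i w = A i j w &
      forall i w, A i i w = false].

Definition adjacency_matrix (A : nat -> nat -> {RV P >-> bool}) (n : nat)
    (w : Omega) : 'M[R]_n :=
  \matrix_(i < n, j < n) (A i j w)%:R.

(* X n = O_P(r n). The exceptional event is covered by a measurable event of
   small probability, so that X n need not be measurable; for a measurable X n
   this is the usual P(|X n| > M r n) <= eps. *)
Definition bigO_P (X : nat -> Omega -> \bar R) (r : nat -> R) : Prop :=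
  forall eps : R, 0 < eps -> exists M : R, \forall n \near \oo,
    exists N : set Omega, [/\ measurable N, (P N <= eps%:E)%E &
      [set w | ((M * r n)%:E < `|X n w|)%E] `<=` N].

End sampling.

(* A = \sum_j evpos_j a_j a_j^T - \sum_j evneg_j b_j b_j^T. Only the indices
   j < npos of evpos and vecpos, and j < n - npos of evneg and vecneg, are
   meaningful; the values beyond are arbitrary. *)
Record signed_eigendecomposition (R : realType) n (A : 'M[R]_n) := {
  npos : nat;
  evpos : nat -> R;
  vecpos : nat -> 'cV[R]_n;
  evneg : nat -> R;
  vecneg : nat -> 'cV[R]_n;
  npos_le : (npos <= n)%N;
  evpos_ge0 : forall j, (j < npos)%N -> 0 <= evpos j;
  evpos_noninc : forall i j, (i <= j < npos)%N -> evpos j <= evpos i;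
  evneg_gt0 : forall j, (j < n - npos)%N -> 0 < evneg j;
  evneg_noninc : forall i j, (i <= j < n - npos)%N -> evneg j <= evneg i;
  vecpos_orthonormal : forall i j, (i < npos)%N -> (j < npos)%N ->
    (vecpos i)^T *m vecpos j = (i == j)%:R%:M;
  vecneg_orthonormal : forall i j, (i < n - npos)%N -> (j < n - npos)%N ->
    (vecneg i)^T *m vecneg j = (i == j)%:R%:M;
  vecpos_vecneg_orthogonal : forall i j, (i < npos)%N -> (j < n - npos)%N ->
    (vecpos i)^T *m vecneg j = 0;
  signed_eigendecompositionE :
    A = \sum_(j < npos) evpos j *: (vecpos j *m (vecpos j)^T)
        - \sum_(j < n - npos) evneg j *: (vecneg j *m (vecneg j)^T) }.

Section embedding.
Context {R : realType} {n : nat}.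

(* s selects the sign of the eigenvector used for each column. *)
Definition spectral_embedding (A : 'M[R]_n) (D : signed_eigendecomposition A)
    (p1 p2 : nat) (s : 'I_(p1 + p2) -> bool)
    : 'M[R]_(n, p1 + p2) :=
  row_mx
    (\matrix_(i < n, j < p1)
       (Num.sqrt (evpos D j) * ((-1) ^+ s (lshift p2 j) * vecpos D j i 0)))
    (\matrix_(i < n, j < p2)
       (Num.sqrt (evneg D j) * ((-1) ^+ s (rshift p1 j) * vecneg D j i 0))).

End embedding.

Definition truncated_data {R : realType} (n p1 p2 : nat) (z : nat -> krein R)
    : 'M[R]_(n, p1 + p2) :=
  row_mx (\matrix_(i < n, j < p1) (z i).1 j) (\matrix_(i < n, j < p2) (z i).2 j).

Definition frobenius_norm {R : realType} m n (M : 'M[R]_(m, n)) : R :=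
  Num.sqrt (\sum_(i < m) \sum_(j < n) M i j ^+ 2).

Section empirical_measure.
Context {R : realType} {n p1 p2 : nat} (M : 'M[R]_(n, p1 + p2)).
Local Open Scope ereal_scope.

(* For n = 0 this is the zero measure. *)
Definition empirical_measure : set (krein R) -> \bar R :=
  fun B => (n%:R^-1)%R%:E * \sum_(i < n) \d_(krein_pad (row i M)) B.

Let empirical_measure_mscale : empirical_measure =
  mscale ((n%:R^-1 : R)%:nng)%R (msum (fun k =>
    dirac (oapp (fun i => krein_pad (row i M)) point (insub k))) n).
Proof.
apply/funext => B; rewrite /empirical_measure /mscale/= /msum; congr (_ * _).
by apply: eq_bigr => i _; rewrite valK.
Qed.

Let empirical_measure0 : empirical_measure set0 = 0.
Proof. by rewrite empirical_measure_mscale measure0. Qed.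

Let empirical_measure_ge0 B : 0 <= empirical_measure B.
Proof. by rewrite empirical_measure_mscale measure_ge0. Qed.

Let empirical_measure_sigma_additive : semi_sigma_additive empirical_measure.
Proof. rewrite empirical_measure_mscale; exact: measure_semi_sigma_additive. Qed.

HB.instance Definition _ := isMeasure.Build _ _ _ empirical_measure
  empirical_measure0 empirical_measure_ge0 empirical_measure_sigma_additive.

Lemma empirical_measure_setT : (0 < n)%N -> empirical_measure setT = 1.
Proof.
move=> n0; rewrite /empirical_measure.
under eq_bigr do rewrite diracT.
rewrite sumEFin big_const_ord iter_addr_0 -EFinM mulVf// pnatr_eq0.
by rewrite -lt0n.
Qed.

End empirical_measure.

Section wasserstein.
Context {R : realType}.
Local Open Scope ereal_scope.

Definition coupling (F1 F2 : {measure set (krein R) -> \bar R})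
    (nu : probability (krein R * krein R)%type R) : Prop :=
  forall B, measurable B ->
    nu (fst @^-1` B) = F1 B /\ nu (snd @^-1` B) = F2 B.

Definition wasserstein (F1 F2 : {measure set (krein R) -> \bar R}) : \bar R :=
  ereal_inf [set \int[nu]_z (`|z.1 - z.2|%R)%:E
            | nu in [set nu | coupling F1 F2 nu]].

End wasserstein.

(* Main.v *)
(* Let x_j and y_j be the columns of X and Y divided by sqrt n, so that
   A / n = sum_j x_j x_j^T - sum_j y_j y_j^T + E for a noise matrix E. The residual
   (A / n) x_j - lam_j x_j is E x_j plus a combination of the x_k and y_k whose
   coefficients are the deviations of the empirical second moments from (A1).
   The squared deviations sum to O_P(1/n) by the fourth moment, and E has
   operator norm O_P(n^(-1/2)), by exponential moments and a union bound over a
   grid of test vectors; hence the squared residuals sum to O_P(1/n). Each lam_j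
   with j < p is therefore close to some eigenvalue of A / n, while
   Courant-Fischer bounds the (j+1)-st eigenvalue by lam_(j+1) + O_P(n^(-1/2)).
   Since p^(2 beta + alpha) = o(n), both errors are small against the gaps, so
   the eigenvalue near lam_j is the j-th one, and dividing the residual by the
   gap compares x_j with the j-th column of the embedding. The total error is
   O_P(p^(2 beta) / n). The y_j are treated in the same way, with - A. *)

From HB Require Import structures.
Require Import Defs.
From mathcomp Require Import all_boot all_order all_algebra.
From mathcomp Require Import all_classical all_reals all_analysis.
From mathcomp Require Import finmap ring lra zify measurable_realfun.

Set Implicit Arguments.
Unset Strict Implicit.
Unset Printing Implicit Defensive.

Import Order.TTheory GRing.Theory Num.Theory.
Import numFieldNormedType.Exports.

Local Open Scope classical_set_scope.
Local Open Scope ring_scope.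

(** * Perturbation of eigenvectors from residuals *)

(** Summing the squared residuals over [j] before dividing by the gap avoids a factor [p]: the
    moment deviations are controlled in Hilbert-Schmidt norm, with an expectation of order
    [E |Z|^4 / n] in all dimensions at once, and [sum_j |x_j|^2] is a trace, bounded by the average
    of [|Z_i|^2]. The main obstacle is that an eigenvalue near [lam_j] carries no index. This is
    settled by induction on [j] from one-sided bounds: negative eigenvalues are excluded by sign,
    smaller indices because they already sit near other [lam_k], larger ones by the Courant-Fischer
    bound. The diagonal of [A] vanishes while that of the Gram matrix does not, so [E] also has a
    diagonal part; it is small because [max_i |Z_i|^4] is at most [sum_i |Z_i|^4]. Randomness enters
    through three events only (moment deviations, average fourth power, noise norm); outside them
    every estimate is deterministic. *)

Lemma sum_cauchy_schwarz (R : realType) (I : Type) (r : seq I) (Q : pred I)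
    (f g : I -> R) :
  (\sum_(i <- r | Q i) f i * g i) ^+ 2 <=
  (\sum_(i <- r | Q i) f i ^+ 2) * (\sum_(i <- r | Q i) g i ^+ 2).
Proof.
set a := \sum_(i <- r | Q i) f i ^+ 2; set b := \sum_(i <- r | Q i) g i ^+ 2.
set c := \sum_(i <- r | Q i) f i * g i.
have a0 : 0 <= a by apply: sumr_ge0 => i _; exact: sqr_ge0.
have b0 : 0 <= b by apply: sumr_ge0 => i _; exact: sqr_ge0.
have key t : 0 <= a * t ^+ 2 + 2 * c * t + b.
  have -> : a * t ^+ 2 + 2 * c * t + b = \sum_(i <- r | Q i) (f i * t + g i) ^+ 2.
    rewrite /a /b /c mulr_suml mulr_sumr mulr_suml -!big_split/=.
    by apply: eq_bigr => i _; ring.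
  by apply: sumr_ge0 => i _; exact: sqr_ge0.
have [a00|an0] := eqVneq a 0.
  have [->|c0] := eqVneq c 0; first by rewrite expr0n/= mulr_ge0.
  (* With [a = 0] the quadratic is affine in [t] and takes the value [-1] here. *)
  have := key (- (b + 1) / (2 * c)); rewrite a00 mul0r add0r.
  rewrite mulrCA divff ?mulf_neq0// mulr1; lra.
have a_gt0 : 0 < a by rewrite lt_neqAle eq_sym an0.
have := key (- c / a).
have -> : a * (- c / a) ^+ 2 + 2 * c * (- c / a) + b = (a * b - c ^+ 2) / a.
  by field.
by rewrite pmulr_lge0 ?invr_gt0// subr_ge0.
Qed.

Section dot_product.
Context {R : realType} {n : nat}.
Implicit Types u v w : 'cV[R]_n.

Definition dot u v : R := \sum_i u i 0 * v i 0.

Lemma dotC u v : dot u v = dot v u.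
Proof. by apply: eq_bigr => i _; rewrite mulrC. Qed.

Lemma dotDl u v w : dot (u + v) w = dot u w + dot v w.
Proof. by rewrite -big_split; apply: eq_bigr => i _; rewrite mxE mulrDl. Qed.

Lemma dotZl a u v : dot (a *: u) v = a * dot u v.
Proof. by rewrite mulr_sumr; apply: eq_bigr => i _; rewrite mxE mulrA. Qed.

Lemma dotDr u v w : dot w (u + v) = dot w u + dot w v.
Proof. by rewrite dotC dotDl !(dotC w). Qed.

Lemma dotZr a u v : dot v (a *: u) = a * dot v u.
Proof. by rewrite dotC dotZl dotC. Qed.

Lemma dotNl u v : dot (- u) v = - dot u v.
Proof. by rewrite -scaleN1r dotZl mulN1r. Qed.

Lemma dotNr u v : dot v (- u) = - dot v u.
Proof. by rewrite dotC dotNl dotC. Qed.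

Lemma dotBl u v w : dot (u - v) w = dot u w - dot v w.
Proof. by rewrite dotDl dotNl. Qed.

Lemma dotBr u v w : dot w (u - v) = dot w u - dot w v.
Proof. by rewrite dotDr dotNr. Qed.

Lemma dot0l u : dot 0 u = 0.
Proof. by rewrite -(scale0r 0) dotZl mul0r. Qed.

Lemma dot_suml (I : Type) (r : seq I) (Q : pred I) (f : I -> 'cV[R]_n) v :
  dot (\sum_(i <- r | Q i) f i) v = \sum_(i <- r | Q i) dot (f i) v.
Proof.
by apply: (big_morph (dot ^~ v)) => [x y|]; rewrite ?dotDl ?dot0l.
Qed.

Lemma dot_sumr (I : Type) (r : seq I) (Q : pred I) (f : I -> 'cV[R]_n) v :
  dot v (\sum_(i <- r | Q i) f i) = \sum_(i <- r | Q i) dot v (f i).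
Proof. by rewrite dotC dot_suml; apply: eq_bigr => i _; rewrite dotC. Qed.

Lemma dot_ge0 u : 0 <= dot u u.
Proof. by apply: sumr_ge0 => i _; rewrite -expr2 sqr_ge0. Qed.

Lemma dotE2 u : dot u u = \sum_i u i 0 ^+ 2.
Proof. by apply: eq_bigr => i _; rewrite expr2. Qed.

Lemma dot_cauchy_schwarz u v : dot u v ^+ 2 <= dot u u * dot v v.
Proof. by rewrite !dotE2; exact: sum_cauchy_schwarz. Qed.

Lemma dot_mulmx (T : 'M[R]_n) u v : dot (T *m u) v = dot u (T^T *m v).
Proof.
rewrite /dot; under eq_bigr do rewrite mxE mulr_suml.
rewrite exchange_big/=; apply: eq_bigr => i _; rewrite mxE mulr_sumr.
by apply: eq_bigr => j _; rewrite mxE; ring.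
Qed.

Lemma dotE u v : dot u v = (u^T *m v) 0 0.
Proof. by rewrite mxE; apply: eq_bigr => i _; rewrite mxE. Qed.

Lemma dot_sqrD_le u v : dot (u + v) (u + v) <= 2 * dot u u + 2 * dot v v.
Proof.
rewrite dotDl !dotDr (dotC v u).
have := dot_ge0 (u - v); rewrite dotBl !dotBr (dotC v u); lra.
Qed.

End dot_product.

(* An eigendecomposition whose eigenvalues are split into [mu k >= 0] and
   [- nu k <= 0]. Reversing the sign of the matrix swaps the two parts, so that
   both halves of the embedding are covered. *)
Record spectral_split {R : realType} {n} (T : 'M[R]_n) (m m' : nat)
    (mu : nat -> R) (a : nat -> 'cV[R]_n) (nu : nat -> R)
    (b : nat -> 'cV[R]_n) : Prop := SpectralSplit {
  split_sym : T^T = T;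
  split_pos : forall k, (k < m)%N -> T *m a k = mu k *: a k;
  split_neg : forall k, (k < m')%N -> T *m b k = - nu k *: b k;
  split_ge0 : forall k, (k < m)%N -> 0 <= mu k;
  split_noninc : forall i j, (i <= j < m)%N -> mu j <= mu i;
  split_nu_ge0 : forall k, (k < m')%N -> 0 <= nu k;
  split_orthonormal : forall i j, (i < m)%N -> (j < m)%N ->
    dot (a i) (a j) = (i == j)%:R;
  split_parseval : forall x, dot x x =
    \sum_(k < m) dot (a k) x ^+ 2 + \sum_(k < m') dot (b k) x ^+ 2 }.

Section spectral_split_theory.
Context {R : realType} {n : nat} {T : 'M[R]_n} {m m' : nat} {mu : nat -> R}
  {a : nat -> 'cV[R]_n} {nu : nat -> R} {b : nat -> 'cV[R]_n}.
Context (TS : spectral_split T m m' mu a nu b).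

(** Parseval applied to the residual: by symmetry of [T] its coefficient along [a k] is
    [(mu k - l) * dot (a k) x], and along [b k] it is [- (nu k + l) * dot (b k) x]. *)
Lemma split_residual (x : 'cV[R]_n) (l : R) :
  dot (T *m x - l *: x) (T *m x - l *: x) =
  \sum_(k < m) (mu k - l) ^+ 2 * dot (a k) x ^+ 2 +
  \sum_(k < m') (nu k + l) ^+ 2 * dot (b k) x ^+ 2.
Proof.
rewrite (split_parseval TS); congr (_ + _); apply: eq_bigr => k _.
  rewrite dotBr dotZr -{1}(split_sym TS) -dot_mulmx (split_pos TS)// dotZl.
  ring.
rewrite dotBr dotZr -{1}(split_sym TS) -dot_mulmx (split_neg TS)// dotZl.
ring.
Qed.

(** The span of [a 0, ..., a j.+1] has dimension [j + 2], so the [j + 1] orthogonality constraints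
    leave a nonzero [v] in it, and there the quadratic form is at least [mu j.+1 * dot v v]. *)
Lemma courant_fischer_upper (x : nat -> 'cV[R]_n) (j : nat) (t : R) :
  (j.+1 < m)%N ->
  (forall v, (forall i, (i <= j)%N -> dot (x i) v = 0) ->
     dot v (T *m v) <= t * dot v v) ->
  mu j.+1 <= t.
Proof.
move=> jm xt.
pose M := \matrix_(k < j.+2, l < j.+1) dot (a k) (x l).
have : kermx M != 0.
  by rewrite -mxrank_eq0 mxrank_ker -lt0n subn_gt0 ltnS rank_leq_col.
case/rowV0Pn => c /sub_kermxP cM c0.
pose v := \sum_(k < j.+2) c 0 k *: a k.
have km (k : 'I_j.+2) : (k < m)%N by exact: leq_ltn_trans (leq_ord k) jm.
have av (k : 'I_j.+2) : dot (a k) v = c 0 k.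
  rewrite dot_sumr (bigD1 k)//= dotZr (split_orthonormal TS)// eqxx mulr1.
  rewrite big1 ?addr0// => l lk; rewrite dotZr (split_orthonormal TS)//.
  by rewrite eq_sym (inj_eq val_inj) (negbTE lk) mulr0.
have vv : dot v v = \sum_k c 0 k ^+ 2.
  rewrite {1}/v dot_suml; apply: eq_bigr => k _.
  by rewrite dotZl av expr2.
have vv0 : 0 < dot v v.
  rewrite lt_neqAle dot_ge0 andbT eq_sym; apply: contra_neq c0.
  rewrite vv => /psumr_eq0P c20; apply/rowP => k; rewrite mxE; apply/eqP.
  by rewrite -sqrf_eq0 c20// => i _; exact: sqr_ge0.
have vx i : (i <= j)%N -> dot (x i) v = 0.
  move=> ij; have := congr1 (fun A : 'rV_j.+1 => A 0 (inord i)) cM.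
  rewrite !mxE => <-; rewrite dot_sumr; apply: eq_bigr => k _.
  by rewrite dotZr mxE inordK// dotC.
have := xt v vx.
have -> : dot v (T *m v) = \sum_(k < j.+2) mu k * c 0 k ^+ 2.
  rewrite -{1}(split_sym TS) -dot_mulmx {1}/v mulmx_sumr dot_suml.
  apply: eq_bigr => k _.
  by rewrite -scalemxAr (split_pos TS)// !dotZl av; ring.
move=> tv; rewrite -(ler_pM2r vv0); apply: le_trans tv.
rewrite vv mulr_sumr; apply: ler_sum => k _.
by rewrite ler_wpM2r ?sqr_ge0// (split_noninc TS)// -ltnS ltn_ord jm.
Qed.

(** Otherwise every [(mu k - l)^2] exceeds the ratio [q] of the residual to [dot x x], and so does
    every [(nu k + l)^2], because [q < l^2] and the other eigenvalues lie beyond zero;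
    [split_residual] then makes the residual exceed itself. *)
Lemma near_eigenvalue (x : 'cV[R]_n) (l : R) :
  0 < l -> dot (T *m x - l *: x) (T *m x - l *: x) < l ^+ 2 * dot x x ->
  exists2 k, (k < m)%N &
    (mu k - l) ^+ 2 * dot x x <= dot (T *m x - l *: x) (T *m x - l *: x).
Proof.
move=> l0; set r := dot _ _ => rl.
have [/existsP[k kr]|/existsPn H] := boolP
    [exists k : 'I_m, (mu k - l) ^+ 2 * dot x x <= r].
  by exists k.
have x0 : 0 < dot x x.
  rewrite lt_neqAle dot_ge0 andbT eq_sym; apply/eqP => x0.
  by move: rl; rewrite x0 mulr0 ltNge dot_ge0.
pose q := r / dot x x.
have q1 (k : 'I_m) : q < (mu k - l) ^+ 2.
  by rewrite /q ltr_pdivrMr// ltNge; exact: H.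
have q2 (k : 'I_m') : q < (nu k + l) ^+ 2.
  have : q < l ^+ 2 by rewrite ltr_pdivrMr.
  have := split_nu_ge0 TS (ltn_ord k); nra.
suff : r = q * dot x x /\ q * dot x x < r by case=> ->; rewrite ltxx.
split; first by rewrite /q divfK// gt_eqF.
have rE : r = _ := split_residual x l.
have xE := split_parseval TS x.
rewrite rE {1}xE mulrDr !mulr_sumr.
(* Strictness needs one nonzero coefficient; as [x] is nonzero, one of the two sums supplies it. *)
have [/eqP z1|nz1] := eqVneq (\sum_(k < m) dot (a k) x ^+ 2) 0.
  have nz2 : \sum_(k < m') dot (b k) x ^+ 2 != 0.
    by apply/eqP => z2; move: x0; rewrite xE (eqP z1) z2 addr0 ltxx.
  apply: ler_ltD.
    by apply: ler_sum => k _; rewrite ler_wpM2r ?sqr_ge0// ltW.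
  have [k _ /= k0] : exists2 k : 'I_m', true & dot (b k) x ^+ 2 != 0.
    apply/exists_inP; apply: contraNT nz2 => /exists_inPn kk.
    by rewrite big1// => k _; apply/eqP; move: (kk k isT); rewrite negbK.
  rewrite (bigD1 k)//= [ltRHS](bigD1 k)//=; apply: ltr_leD.
    by rewrite ltr_pM2r// lt_neqAle sqr_ge0 eq_sym k0.
  by apply: ler_sum => i _; rewrite ler_wpM2r ?sqr_ge0// ltW.
apply: ltr_leD; last first.
  by apply: ler_sum => k _; rewrite ler_wpM2r ?sqr_ge0// ltW.
have [k _ /= k0] : exists2 k : 'I_m, true & dot (a k) x ^+ 2 != 0.
  apply/exists_inP; apply: contraNT nz1 => /exists_inPn kk.
  by rewrite big1// => k _; apply/eqP; move: (kk k isT); rewrite negbK.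
rewrite (bigD1 k)//= [ltRHS](bigD1 k)//=; apply: ltr_leD.
  by rewrite ltr_pM2r// lt_neqAle sqr_ge0 eq_sym k0.
by apply: ler_sum => i _; rewrite ler_wpM2r ?sqr_ge0// ltW.
Qed.

End spectral_split_theory.

(** Factor [x - y^2] and use [Num.sqrt x + y >= Num.sqrt x]; only the first argument has to stay
    away from zero. *)
Lemma sqrt_dist_sqr_le (R : realType) (x y : R) : 0 < x -> 0 <= y ->
  (Num.sqrt x - y) ^+ 2 <= (x - y ^+ 2) ^+ 2 / x.
Proof.
move=> x0 y0; rewrite ler_pdivlMr//.
have s0 := sqrtr_ge0 x; have sx : Num.sqrt x ^+ 2 = x by rewrite sqr_sqrtr// ltW.
rewrite -{2 3}sx; set s := Num.sqrt x in s0 sx *.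
have -> : (s ^+ 2 - y ^+ 2) ^+ 2 = (s - y) ^+ 2 * (s + y) ^+ 2 by ring.
by rewrite ler_wpM2l ?sqr_ge0// ler_sqr ?nnegrE ?addr_ge0// lerDl.
Qed.

Section embedding_columns.
Context {R : realType} {n : nat} {T : 'M[R]_n} {m m' : nat} {mu : nat -> R}
  {a : nat -> 'cV[R]_n} {nu : nat -> R} {b : nat -> 'cV[R]_n}.
Context (TS : spectral_split T m m' mu a nu b).
Context {p : nat} {lam : nat -> R} {x : nat -> 'cV[R]_n} {g l rho : R}.
Let res j := dot (T *m x j - lam j *: x j) (T *m x j - lam j *: x j).
Context (g0 : 0 < g) (l0 : 0 < l) (lam0 : forall j, 0 <= lam j)
  (lam_gap : forall j, (j < p)%N -> g <= lam j - lam j.+1)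
  (lam_ge : forall j, (j < p)%N -> l <= lam j)
  (x_norm : forall j, (j < p)%N -> `|dot (x j) (x j) - lam j| <= lam j / 2)
  (res_le : forall j, (j < p)%N -> res j <= g ^+ 2 * l / 32)
  (rho_le : rho <= g / 4)
  (upper : forall j, (j < p)%N ->
     forall v, (forall i, (i <= j)%N -> dot (x i) v = 0) ->
     dot v (T *m v) <= (lam j.+1 + rho) * dot v v).

Let lam_noninc i j : (i <= j <= p)%N -> lam j <= lam i.
Proof.
have g_gt0 := g0; have l_gt0 := l0; have rhog := rho_le.
case/andP => ij; elim: j ij => [|j IH]; first by rewrite leqn0 => /eqP ->.
rewrite leq_eqVlt => /predU1P[->//|]; rewrite ltnS => ij jp.
have h1 := lam_gap jp; have h2 := IH ij (ltnW jp). lra.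
Qed.

Let lam_sep i j : (i < j < p)%N -> g <= lam i - lam j.
Proof.
have g_gt0 := g0; have l_gt0 := l0; have rhog := rho_le.
case/andP => ij jp; have ip := ltn_trans ij jp.
by have := lam_gap ip; have := @lam_noninc i.+1 j; rewrite ij ltnW// => /(_ isT); lra.
Qed.

Let x_ge j : (j < p)%N -> lam j / 2 <= dot (x j) (x j) <= 3 / 2 * lam j.
Proof.
have g_gt0 := g0; have l_gt0 := l0; have rhog := rho_le.
move=> jp; have := x_norm jp; have := lam_ge jp; rewrite ler_norml.
by move=> ? /andP[? ?]; apply/andP; split; lra.
Qed.

(** Since [dot (x j) (x j) >= l / 2], the threshold [g^2 * l / 32] on the residual yields
    [t^2 <= (g / 4)^2]; a quarter of the gap is the accuracy that the separation arguments below
    rely on. *)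
Let sqr_near (t : R) j : (j < p)%N -> t ^+ 2 * dot (x j) (x j) <= res j ->
  - (g / 4) <= t <= g / 4.
Proof.
have g_gt0 := g0; have l_gt0 := l0; have rhog := rho_le.
move=> jp tr; rewrite -ler_norml -(ler_pXn2r (ltn0Sn 1)) ?nnegrE//; last first.
  by rewrite divr_ge0// ltW.
rewrite real_normK ?num_real//.
have /andP[x1 x2] := x_ge jp; have := lam_ge jp; have := res_le jp.
move=> h1 h2; have xl : l / 2 <= dot (x j) (x j) by lra.
have : t ^+ 2 * (l / 2) <= g ^+ 2 * l / 32.
  by apply: le_trans h1; apply: le_trans tr; rewrite ler_wpM2l ?sqr_ge0.
move=> h; have : (t ^+ 2) * l <= (g / 4) ^+ 2 * l by lra.
by rewrite ler_pM2r.
Qed.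

(** Strong induction on [j]. Let [mu k] be the eigenvalue found near [lam j]. If [k < j], then
    [mu k] is within [g / 4] of [lam k], which is at least [g] away from [lam j]. If [k > j], then
    [mu k <= mu j.+1 <= lam j.+1 + g / 4], which is too small. That the nonnegative part has more
    than [j] eigenvalues comes out of the same argument. *)
Lemma eigenvalue_localization j : (j < p)%N ->
  (j < m)%N /\ (mu j - lam j) ^+ 2 * dot (x j) (x j) <= res j.
Proof.
have g_gt0 := g0; have l_gt0 := l0; have rhog := rho_le.
elim/ltn_ind: j => j IH jp.
have /andP[x1 x2] := x_ge jp; have lj := lam_ge jp.
have [| |k km kr] := near_eigenvalue TS (x := x j) (l := lam j).
- by lra.
- apply: le_lt_trans (res_le jp) _.
  have gl : g <= lam j by have := lam_gap jp; have := lam0 j.+1; lra.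
  have : g ^+ 2 <= lam j ^+ 2 by rewrite ler_sqr ?nnegrE//; lra.
  have : l / 2 <= dot (x j) (x j) by lra.
  have g2 : 0 < g ^+ 2 by rewrite exprn_gt0.
  move=> xl gl2; have lt1 : g ^+ 2 * l / 32 < g ^+ 2 * (l / 2) by nra.
  by apply: (lt_le_trans lt1); rewrite ler_pM//; lra.
have /andP[k1 k2] := sqr_near jp kr.
have [kj|jk|kj] := ltngtP k j; last by move: km kr; rewrite kj.
- have [_ kr'] := IH k kj (ltn_trans kj jp).
  have /andP[k1' k2'] := sqr_near (ltn_trans kj jp) kr'.
  by have := @lam_sep k j; rewrite kj jp => /(_ isT); lra.
- have j1m : (j.+1 < m)%N by exact: leq_ltn_trans jk km.
  have := courant_fischer_upper TS j1m (upper jp).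
  have := @split_noninc _ _ _ _ _ _ _ _ _ TS j.+1 k; rewrite jk km => /(_ isT).
  by have := lam_gap jp; lra.
Qed.

(** The bounded quantity is the squared norm of the component of [x j] orthogonal to [a j]. All
    eigenvalues other than [mu j] are at least [g / 2] away from [lam j], so this component,
    multiplied by [(g / 2)^2], is dominated by the residual. *)
Lemma perp_le j : (j < p)%N ->
  0 <= dot (x j) (x j) - dot (a j) (x j) ^+ 2 <= 4 * res j / g ^+ 2.
Proof.
have g_gt0 := g0; have l_gt0 := l0; have rhog := rho_le.
move=> jp; have [jm jr] := eigenvalue_localization jp.
have xE := split_parseval TS (x j).
have rE : res j = _ := split_residual TS (x j) (lam j).
pose J := Ordinal jm.
rewrite (bigD1 J)//= in xE; rewrite (bigD1 J)//= in rE.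
set s1 := \sum_(k < m | k != J) _ in xE; set s2 := \sum_(k < m') _ in xE.
have s10 : 0 <= s1 by apply: sumr_ge0 => i _; exact: sqr_ge0.
have s20 : 0 <= s2 by apply: sumr_ge0 => i _; exact: sqr_ge0.
have -> : dot (x j) (x j) - dot (a j) (x j) ^+ 2 = s1 + s2 by rewrite xE; ring.
rewrite addr_ge0//= ler_pdivlMr ?exprn_gt0//.
suff : (g / 2) ^+ 2 * (s1 + s2) <= res j by lra.
have gl : g <= lam j by have := lam_gap jp; have := lam0 j.+1; lra.
rewrite rE mulrDr -addrA; apply: ler_wpDl.
  by rewrite mulr_ge0 ?sqr_ge0.
rewrite !mulr_sumr; apply: lerD; apply: ler_sum => k kj.
  rewrite ler_wpM2r ?sqr_ge0//.
  have [kj'|jk|kj'] := ltngtP k j.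
  - have [_ kr'] := eigenvalue_localization (ltn_trans kj' jp).
    have /andP[k1' k2'] := sqr_near (ltn_trans kj' jp) kr'.
    by have := @lam_sep k j; rewrite kj' jp => /(_ isT); nra.
  - have j1m : (j.+1 < m)%N by exact: leq_ltn_trans jk (ltn_ord k).
    have := courant_fischer_upper TS j1m (upper jp).
    have := @split_noninc _ _ _ _ _ _ _ _ _ TS j.+1 k; rewrite jk ltn_ord => /(_ isT).
    by have := lam_gap jp; nra.
  - by exfalso; move/eqP : kj; apply; exact: val_inj.
rewrite ler_wpM2r ?sqr_ge0//.
by have := split_nu_ge0 TS (ltn_ord k); nra.
Qed.

(** With [c = dot (a j) (x j)] and the sign chosen to make the inner product [|c|], the error is
    [(Num.sqrt (mu j) - |c|)^2] plus the orthogonal part [q]. The first term passes through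
    [Num.sqrt (lam j)], which doubles both halves and brings in [3 * q]; hence [7 * q] in total, and
    [q <= 4 * res j / g^2] gives the constant 28. *)
Lemma embedding_column_error j : (j < p)%N ->
  let e := Num.sqrt (mu j) *: ((-1) ^+ (dot (a j) (x j) < 0)%R *: a j) - x j in
  dot e e <= 28 * res j / g ^+ 2 + 4 * res j / l ^+ 2 +
             4 * (dot (x j) (x j) - lam j) ^+ 2 / l.
Proof.
have g_gt0 := g0; have l_gt0 := l0; have rhog := rho_le.
move=> jp; have [jm jr] := eigenvalue_localization jp.
have /andP[q0 q1] := perp_le jp.
have lj := lam_ge jp; have /andP[x1 x2] := x_ge jp.
have mu0 := split_ge0 TS jm.
set c := dot (a j) (x j) in q0 q1 *; set X := dot (x j) (x j) in q0 q1 x1 x2 jr *.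
set q := X - c ^+ 2 in q0 q1.
have lamj0 : 0 < lam j by lra.
cbv zeta; set e := Num.sqrt _ *: _ - x j.
have -> : dot e e = (Num.sqrt (mu j) - `|c|) ^+ 2 + q.
  rewrite /e dotBl !dotBr !dotZl !dotZr (dotC (x j) (a j)) -/c -/X.
  rewrite (split_orthonormal TS)// eqxx mulr1.
  have sc : (-1) ^+ (c < 0)%R * c = `|c|.
    have [cn|cp] := ltrP c 0; first by rewrite expr1 mulN1r ler0_norm// ltW.
    by rewrite expr0 mul1r ger0_norm.
  have ss : (-1) ^+ (c < 0)%R * ((-1) ^+ (c < 0)%R) = 1 :> R.
    by rewrite -expr2 sqrr_sign.
  move: ss sc; set sg := (-1) ^+ (c < 0)%R; set r := Num.sqrt (mu j) => ss sc.
  transitivity (r ^+ 2 * (sg * sg) - 2 * r * (sg * c) + X); first by ring.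
  by rewrite ss sc sqrrB real_normK ?num_real// /q; ring.
have H1 : (Num.sqrt (lam j) - Num.sqrt (mu j)) ^+ 2 <= 2 * res j / l ^+ 2.
  apply: le_trans (sqrt_dist_sqr_le lamj0 (sqrtr_ge0 _)) _.
  rewrite sqr_sqrtr// ler_pdivlMr ?exprn_gt0// mulrAC ler_pdivrMr//.
  rewrite -(sqrrN (_ - _)) opprB.
  apply: (@le_trans _ _ ((mu j - lam j) ^+ 2 * (X * 2 * lam j))).
    rewrite ler_wpM2l ?sqr_ge0//; nra.
  suff : (mu j - lam j) ^+ 2 * X * (2 * lam j) <= res j * (2 * lam j) by lra.
  by rewrite ler_wpM2r//; lra.
have H2 : (Num.sqrt (lam j) - `|c|) ^+ 2 <= 2 * (X - lam j) ^+ 2 / l + 3 * q.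
  apply: le_trans (sqrt_dist_sqr_le lamj0 (normr_ge0 _)) _.
  rewrite real_normK ?num_real//.
  have -> : lam j - c ^+ 2 = lam j - X + q by rewrite /q; ring.
  apply: (@le_trans _ _ ((2 * (X - lam j) ^+ 2 + 2 * q ^+ 2) / lam j)).
    rewrite ler_wpM2r ?invr_ge0 ?(ltW lamj0)//.
    by have := sqr_ge0 (lam j - X - q); nra.
  rewrite mulrDl; apply: lerD.
    apply: ler_wpM2l; last by rewrite lef_pV2 ?posrE.
    by rewrite mulr_ge0// sqr_ge0.
  rewrite ler_pdivrMr//.
  (* Bounding one factor of [q^2] by [3 / 2 * lam j] turns the quadratic term into a linear one. *)
  have : q <= 3 / 2 * lam j by have := sqr_ge0 c; rewrite /q; lra.
  by nra.
have H3 : (Num.sqrt (mu j) - `|c|) ^+ 2 <=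
    2 * (Num.sqrt (lam j) - Num.sqrt (mu j)) ^+ 2 +
    2 * (Num.sqrt (lam j) - `|c|) ^+ 2.
  by have := sqr_ge0 (2 * Num.sqrt (lam j) - Num.sqrt (mu j) - `|c|); nra.
have -> : 28 * res j / g ^+ 2 = 7 * (4 * res j / g ^+ 2) by ring.
have -> : 4 * res j / l ^+ 2 = 2 * (2 * res j / l ^+ 2) by ring.
have -> : 4 * (X - lam j) ^+ 2 / l = 2 * (2 * (X - lam j) ^+ 2 / l) by ring.
lra.
Qed.

End embedding_columns.

(** The record provides orthonormality but not completeness. Completeness follows by counting: the
    [n] eigenvectors are the columns of a square [V] with [V^T *m V = 1], so also [V *m V^T = 1],
    which is Parseval. Symmetry of [A] is read off its expansion into rank-one terms. *)
Lemma eigendecomposition_split (R : realType) n (A : 'M[R]_n)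
    (D : signed_eigendecomposition A) (c : R) : 0 <= c ->
  spectral_split (c *: A) (npos D) (n - npos D) (fun k => c * evpos D k)
    (vecpos D) (fun k => c * evneg D k) (vecneg D) /\
  spectral_split (- (c *: A)) (n - npos D) (npos D) (fun k => c * evneg D k)
    (vecneg D) (fun k => c * evpos D k) (vecpos D).
Proof.
move=> c0; have npn := npos_le D.
have dotPP i j : (i < npos D)%N -> (j < npos D)%N ->
    dot (vecpos D i) (vecpos D j) = (i == j)%:R.
  by move=> im jm; rewrite dotE vecpos_orthonormal// mxE eqxx.
have dotNN i j : (i < n - npos D)%N -> (j < n - npos D)%N ->
    dot (vecneg D i) (vecneg D j) = (i == j)%:R.
  by move=> im jm; rewrite dotE vecneg_orthonormal// mxE eqxx.
have dotPN i j : (i < npos D)%N -> (j < n - npos D)%N ->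
    dot (vecpos D i) (vecneg D j) = 0.
  by move=> im jm; rewrite dotE vecpos_vecneg_orthogonal// mxE.
have outer (u v : 'cV[R]_n) : u *m u^T *m v = dot u v *: u.
  by rewrite -mulmxA (mx11_scalar (u^T *m v)) -dotE mul_mx_scalar.
have AE := signed_eigendecompositionE D.
have Asym : A^T = A.
  rewrite AE linearB/= !linear_sum/=; congr (_ + _); apply: eq_bigr => k _;
  by rewrite linearZ/= trmx_mul trmxK.
have APE k : (k < npos D)%N -> A *m vecpos D k = evpos D k *: vecpos D k.
  move=> km; rewrite {1}AE mulmxBl !mulmx_suml [X in _ - X]big1 ?subr0.
    rewrite (bigD1 (Ordinal km))//= -scalemxAl outer dotPP// eqxx scale1r.
    rewrite big1 ?addr0// => i ik; rewrite -scalemxAl outer dotPP//.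
    suff -> : (i : nat) == k = false by rewrite scale0r scaler0.
    by apply: contra_neqF ik => /eqP ik; exact: val_inj.
  by move=> i _; rewrite -scalemxAl outer dotC dotPN// scale0r scaler0.
have ANE k : (k < n - npos D)%N ->
    A *m vecneg D k = - evneg D k *: vecneg D k.
  move=> km; rewrite {1}AE mulmxBl !mulmx_suml [X in X - _]big1 ?sub0r.
    rewrite (bigD1 (Ordinal km))//= -scalemxAl outer dotNN// eqxx scale1r.
    rewrite big1 ?addr0 ?scaleNr// => i ik; rewrite -scalemxAl outer dotNN//.
    suff -> : (i : nat) == k = false by rewrite scale0r scaler0.
    by apply: contra_neqF ik => /eqP ik; exact: val_inj.
  by move=> i _; rewrite -scalemxAl outer dotPN// scale0r scaler0.
pose w k := if (k < npos D)%N then vecpos D k else vecneg D (k - npos D).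
pose V := \matrix_(i < n, k < n) w k i 0.
have VV : V^T *m V = 1%:M.
  apply/matrixP => i j; rewrite !mxE.
  transitivity (dot (w i) (w j)); first by apply: eq_bigr => k _; rewrite !mxE.
  rewrite /w; have [ip|pi] := ltnP i (npos D); have [jp|pj] := ltnP j (npos D).
  - by rewrite dotPP.
  - rewrite dotPN ?ltn_sub2r// ?(leq_ltn_trans pj)//.
    suff -> : (i == j) = false by [].
    by apply/eqP => ij; move: pj; rewrite -ij leqNgt ip.
  - rewrite dotC dotPN ?ltn_sub2r// ?(leq_ltn_trans pi)//.
    suff -> : (i == j) = false by [].
    by apply/eqP => ij; move: pi; rewrite ij leqNgt jp.
  - rewrite dotNN ?ltn_sub2r ?(leq_ltn_trans pi) ?(leq_ltn_trans pj)//.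
    by rewrite -(eqn_add2r (npos D)) !subnK.
have VVt : V *m V^T = 1%:M by exact: mulmx1C.
have parseval (x : 'cV[R]_n) : dot x x =
    \sum_(k < npos D) dot (vecpos D k) x ^+ 2 +
    \sum_(k < n - npos D) dot (vecneg D k) x ^+ 2.
  have -> : dot x x = dot (V^T *m x) (V^T *m x).
    by rewrite dot_mulmx trmxK mulmxA VVt mul1mx.
  have Vx (k : 'I_n) : (V^T *m x) k 0 = dot (w k) x.
    by rewrite mxE; apply: eq_bigr => i _; rewrite !mxE.
  rewrite dotE2; under eq_bigr do rewrite Vx.
  rewrite -(big_mkord xpredT (fun k => dot (w k) x ^+ 2)).
  rewrite (big_cat_nat (leq0n _) npn)/=; congr (_ + _).
    rewrite big_mkord; apply: eq_bigr => k _.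
    by rewrite /w ltn_ord.
  rewrite -{1}(add0n (npos D)) big_addn big_mkord; apply: eq_bigr => k _.
  by rewrite /w ltnNge leq_addl/= addnK.
split; split => //.
- by rewrite linearZ/= Asym.
- by move=> k km; rewrite -scalemxAl APE// scalerA.
- by move=> k km; rewrite -scalemxAl ANE// scalerA mulrN.
- by move=> k km; rewrite mulr_ge0// evpos_ge0.
- by move=> i j ij; rewrite ler_wpM2l// evpos_noninc.
- by move=> k km; rewrite mulr_ge0// ltW// evneg_gt0.
- by rewrite linearN/= linearZ/= Asym.
- by move=> k km; rewrite mulNmx -scalemxAl ANE// scalerA mulrN scaleNr opprK.
- by move=> k km; rewrite mulNmx -scalemxAl APE// scalerA scaleNr.
- by move=> k km; rewrite mulr_ge0// ltW// evneg_gt0.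
- by move=> i j ij; rewrite ler_wpM2l// evneg_noninc.
- by move=> k km; rewrite mulr_ge0// evpos_ge0.
- by move=> x; rewrite parseval addrC.
Qed.

(** * Gram matrices *)

Lemma cvgn_sum (R : realType) (I : Type) (r : seq I) (f : I -> nat -> R)
    (l : I -> R) : (forall i, f i N @[N --> \oo] --> l i) ->
  \sum_(i <- r) f i N @[N --> \oo] --> \sum_(i <- r) l i.
Proof. by move=> fl; apply: cvg_big => //; exact: add_continuous. Qed.

Lemma cvgn_le (R : realType) (u : nat -> R) (l c : R) (N0 : nat) :
  u N @[N --> \oo] --> l -> (forall N, (N0 <= N)%N -> u N <= c) -> l <= c.
Proof.
move=> ul uc; rewrite -(cvg_lim (@Rhausdorff R) ul); apply: limr_le.
  exact: cvgP ul.
by exists N0 => // N /= /uc.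
Qed.

(** Cauchy-Schwarz in every coordinate. The right factor is the trace of the Gram matrix of the
    [u k], so no orthogonality between them is required. *)
Lemma dot_lincomb_le (R : realType) n N (c : nat -> R) (u : nat -> 'cV[R]_n) :
  dot (\sum_(k < N) c k *: u k) (\sum_(k < N) c k *: u k) <=
  (\sum_(k < N) c k ^+ 2) * (\sum_(k < N) dot (u k) (u k)).
Proof.
rewrite dotE2.
have -> : \sum_(k < N) dot (u k) (u k) = \sum_i \sum_(k < N) u k i 0 ^+ 2.
  by rewrite [RHS]exchange_big/=; apply: eq_bigr => k _; rewrite dotE2.
rewrite mulr_sumr; apply: ler_sum => i _.
rewrite summxE; under eq_bigr do rewrite mxE.
exact: sum_cauchy_schwarz.
Qed.

Section gram_matrix.
Context {R : realType} {n : nat} {G E : 'M[R]_n} {x y : nat -> 'cV[R]_n}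
  {lam : nat -> R} {S t e : R}.
Context (GE : forall i l,
    \sum_(k < N) (x k i 0 * x k l 0 - y k i 0 * y k l 0) @[N --> \oo] --> G i l)
  (Sxx : forall N, \sum_(k < N) \sum_(l < N)
     (dot (x k) (x l) - lam k *+ (k == l :> nat)) ^+ 2 <= S)
  (Syx : forall N, \sum_(k < N) \sum_(l < N) dot (y k) (x l) ^+ 2 <= S)
  (tx : forall N, \sum_(k < N) dot (x k) (x k) <= t)
  (ty : forall N, \sum_(k < N) dot (y k) (y k) <= t)
  (e0 : 0 <= e)
  (Eop : forall v, dot (E *m v) (E *m v) <= e ^+ 2 * dot v v).

Let GN N : 'M[R]_n := \matrix_(i, l)
  \sum_(k < N) (x k i 0 * x k l 0 - y k i 0 * y k l 0).

Let GN_mul N (v : 'cV[R]_n) : GN N *m v =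
  \sum_(k < N) dot (x k) v *: x k - \sum_(k < N) dot (y k) v *: y k.
Proof.
apply/colP => i; rewrite !mxE !summxE -sumrB.
under eq_bigr do rewrite mxE mulr_suml.
rewrite exchange_big/=; apply: eq_bigr => k _; rewrite !mxE /dot !mulr_suml.
by rewrite -sumrB; apply: eq_bigr => l _; ring.
Qed.

Let GN_cvg (v : 'cV[R]_n) i : (GN N *m v) i 0 @[N --> \oo] --> (G *m v) i 0.
Proof.
rewrite mxE; under eq_fun do rewrite mxE.
apply: (@cvgn_sum _ _ _ (fun l N => GN N i l * v l 0)) => l.
apply: cvgM; last exact: cvg_cst.
by under eq_fun do rewrite mxE; exact: GE.
Qed.

Let S0 : 0 <= S.
Proof. by apply: le_trans (Sxx 0); rewrite big_ord0. Qed.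

(** In [G *m x j - lam j *: x j] the coefficient of [x k] is the deviation of [dot (x k) (x j)] from
    its limit, and that of [y k] is [- dot (y k) (x j)]. By [dot_lincomb_le] each family contributes
    at most [t * S] after summing over [j]; splitting the two families and then splitting off [E]
    costs a factor 2 each time. *)
Lemma gram_residual_sum p : \sum_(j < p)
    dot ((G + E) *m x j - lam j *: x j) ((G + E) *m x j - lam j *: x j) <=
  8 * (t * S) + 2 * (e ^+ 2 * t).
Proof.
have t0 : 0 <= t by apply: le_trans (tx 0); rewrite big_ord0.
apply: (@le_trans _ _ (\sum_(j < p)
    (2 * dot (G *m x j - lam j *: x j) (G *m x j - lam j *: x j)
     + 2 * dot (E *m x j) (E *m x j)))).
  apply: ler_sum => j _; rewrite mulmxDl addrAC; exact: dot_sqrD_le.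
rewrite big_split/= -!mulr_sumr; apply: lerD; last first.
  rewrite ler_pM2l//; apply: (@le_trans _ _ (\sum_(j < p) e ^+ 2 * dot (x j) (x j))).
    by apply: ler_sum => j _; exact: Eop.
  by rewrite -mulr_sumr ler_wpM2l ?sqr_ge0.
suff : \sum_(j < p) dot (G *m x j - lam j *: x j) (G *m x j - lam j *: x j)
  <= 4 * (t * S) by lra.
(* Truncation at [N >= p] keeps index [j] among the summands, so that [lam j *: x j] can be absorbed
   into the coefficient of [x j]. *)
apply: (@cvgn_le _ (fun N => \sum_(j < p)
    dot (GN N *m x j - lam j *: x j) (GN N *m x j - lam j *: x j)) _ _ p).
  have cvgE (j : 'I_p) i : (GN N *m x j - lam j *: x j) i 0 @[N --> \oo] -->
      (G *m x j - lam j *: x j) i 0.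
    rewrite [X in _ --> X]mxE; under eq_fun do rewrite mxE.
    by apply: cvgD; [exact: GN_cvg|exact: cvg_cst].
  apply: (@cvgn_sum _ _ _ (fun (j : 'I_p) N =>
    dot (GN N *m x j - lam j *: x j) (GN N *m x j - lam j *: x j))) => j.
  apply: (@cvgn_sum _ _ _ (fun i N => (GN N *m x j - lam j *: x j) i 0 *
    (GN N *m x j - lam j *: x j) i 0)) => i.
  by apply: cvgM; exact: cvgE.
move=> N pN.
have key (j : 'I_p) : dot (GN N *m x j - lam j *: x j)
      (GN N *m x j - lam j *: x j) <=
    2 * (t * \sum_(k < N) (dot (x k) (x j) - lam k *+ (k == j :> nat)) ^+ 2)
    + 2 * (t * \sum_(k < N) dot (y k) (x j) ^+ 2).
  have jN : (j < N)%N by exact: leq_trans pN.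
  have -> : GN N *m x j - lam j *: x j =
      \sum_(k < N) (dot (x k) (x j) - lam k *+ (k == j :> nat)) *: x k
      + \sum_(k < N) (- dot (y k) (x j)) *: y k.
    rewrite GN_mul addrAC; congr (_ + _).
      under [RHS]eq_bigr do rewrite scalerBl.
      rewrite sumrB; congr (_ - _); rewrite (bigD1 (Ordinal jN))//= eqxx mulr1n.
      rewrite big1 ?addr0// => k kj.
      suff -> : (k : nat) == j = false by rewrite mulr0n scale0r.
      by apply: contra_neqF kj => /eqP kj; exact: val_inj.
    by rewrite -sumrN; apply: eq_bigr => k _; rewrite scaleNr.
  apply: (le_trans (dot_sqrD_le _ _)); apply: lerD; rewrite ler_pM2l//.
    apply: le_trans (dot_lincomb_le N
      (fun k => dot (x k) (x j) - lam k *+ (k == j :> nat)) x) _.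
    by rewrite mulrC ler_wpM2r ?tx// sumr_ge0// => k _; exact: sqr_ge0.
  apply: le_trans (dot_lincomb_le N (fun k => - dot (y k) (x j)) y) _.
  under eq_bigr do rewrite sqrrN.
  by rewrite mulrC ler_wpM2r ?ty// sumr_ge0// => k _; exact: sqr_ge0.
apply: le_trans (ler_sum _ (fun j _ => key j)) _.
rewrite big_split/= -!mulr_sumr.
have ext (f : nat -> nat -> R) : (forall k l, 0 <= f k l) ->
    \sum_(k < N) \sum_(l < N) f k l <= S ->
    \sum_(j < p) \sum_(k < N) f k j <= S.
  move=> f0; apply: le_trans; rewrite exchange_big/=; apply: ler_sum => k _.
  rewrite (big_ord_widen _ (f k) pN) [leRHS](bigID (fun i : 'I_N => i < p)%N)/=.
  by rewrite lerDl sumr_ge0.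
have h1 := ext (fun k l => (dot (x k) (x l) - lam k *+ (k == l :> nat)) ^+ 2)
  (fun k l => sqr_ge0 _) (Sxx N).
have h2 := ext (fun k l => dot (y k) (x l) ^+ 2) (fun k l => sqr_ge0 _) (Syx N).
have -> : 4 * (t * S) = 2 * (t * S) + 2 * (t * S) by ring.
by apply: lerD; rewrite ler_pM2l//; apply: ler_wpM2l.
Qed.

(** Duality between [X X^T] and [X^T X]: with [w] the combination of the remaining [x k] with
    coefficients [c k = dot (x k) v], the positive part of the form is [s = dot v w], while
    [dot w w] is the form of the Gram matrix at [c], at most [(lam j.+1 + Num.sqrt S) * s].
    Cauchy-Schwarz for [dot v w] and division by [s] give the bound. *)
Lemma gram_upper (lam0 : forall j, 0 <= lam j)
    (lam_noninc : forall i j, (i <= j)%N -> lam j <= lam i) j v :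
  (forall i, (i <= j)%N -> dot (x i) v = 0) ->
  dot v ((G + E) *m v) <= (lam j.+1 + (Num.sqrt S + e)) * dot v v.
Proof.
move=> vx; rewrite mulmxDl dotDr addrA mulrDl; apply: lerD; last first.
  apply: le_trans (ler_norm _) _.
  rewrite -(ler_pXn2r (ltn0Sn 1)) ?nnegrE ?mulr_ge0 ?dot_ge0//.
  rewrite real_normK ?num_real//; apply: le_trans (dot_cauchy_schwarz _ _) _.
  by rewrite exprMn (expr2 (dot v v)) mulrA mulrC ler_wpM2r ?dot_ge0.
apply: (@cvgn_le _ (fun N => dot v (GN N *m v)) _ _ 0).
  apply: (@cvgn_sum _ _ _ (fun i N => v i 0 * (GN N *m v) i 0)) => i.
  by apply: cvgM; [exact: cvg_cst|exact: GN_cvg].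
move=> N _; rewrite GN_mul dotBr !dot_sumr.
pose c (k : nat) := if (k <= j)%N then 0 else dot (x k) v.
pose w := \sum_(k < N) c k *: x k.
have cE (k : nat) : dot (x k) v = c k.
  by rewrite /c; case: ifPn => // /vx.
pose s := \sum_(k < N) c k ^+ 2.
have s0 : 0 <= s by apply: sumr_ge0 => k _; exact: sqr_ge0.
have ww : dot w w <= (lam j.+1 + Num.sqrt S) * s.
  have -> : dot w w = \sum_(k < N) \sum_(l < N) c k * c l * dot (x k) (x l).
    rewrite /w dot_suml; apply: eq_bigr => k _; rewrite dotZl dot_sumr mulr_sumr.
    by apply: eq_bigr => l _; rewrite dotZr mulrA.
  have -> : \sum_(k < N) \sum_(l < N) c k * c l * dot (x k) (x l) =
      \sum_(k < N) lam k * c k ^+ 2 + \sum_(k < N) \sum_(l < N) c k * c l *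
        (dot (x k) (x l) - lam k *+ (k == l :> nat)).
    rewrite -big_split/=; apply: eq_bigr => k _.
    have -> : lam k * c k ^+ 2 =
        \sum_(l < N) c k * c l * (lam k *+ (k == l :> nat)).
      rewrite (bigD1 k)//= eqxx mulr1n big1 ?addr0; first by ring.
      move=> l lk; suff -> : (k : nat) == l = false by rewrite mulr0n mulr0.
      by apply: contra_neqF lk => /eqP lk; exact: val_inj.
    by rewrite -big_split/=; apply: eq_bigr => l _; ring.
  rewrite mulrDl; apply: lerD.
    rewrite mulr_sumr; apply: ler_sum => k _; rewrite /c; case: ifPn => kj.
      by rewrite expr0n/= !mulr0.
    by rewrite ler_wpM2r ?sqr_ge0// lam_noninc// ltnNge.
  (* The quadratic form of the deviations is at most their Hilbert-Schmidt norm [Num.sqrt S] times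
     [s]. *)
  apply: le_trans (ler_norm _) _.
  have -> : s = Num.sqrt (s ^+ 2) by rewrite sqrtr_sqr ger0_norm.
  rewrite -sqrtr_sqr -sqrtrM// ler_wsqrtr//.
  rewrite pair_big/=; apply: le_trans (sum_cauchy_schwarz _ _ _ _) _.
  rewrite mulrC; apply: ler_pM.
  - by apply: sumr_ge0 => k _; exact: sqr_ge0.
  - by apply: sumr_ge0 => k _; exact: sqr_ge0.
  - by rewrite -(pair_big xpredT xpredT (fun k l : 'I_N => 
      (dot (x k) (x l) - lam k *+ (k == l :> nat)) ^+ 2))/=; exact: Sxx.
  - rewrite -(pair_big xpredT xpredT (fun k l : 'I_N => (c k * c l) ^+ 2))/=.
    rewrite expr2 /s mulr_suml; apply: ler_sum => k _.
    by rewrite mulr_sumr; apply: ler_sum => l _; rewrite exprMn.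
have sv : s ^+ 2 <= dot v v * dot w w.
  have -> : s = dot v w.
    rewrite /w dot_sumr; apply: eq_bigr => k _.
    by rewrite dotZr (dotC v) expr2; congr (_ * _); rewrite cE.
  exact: dot_cauchy_schwarz.
have -> : \sum_(k < N) dot v (dot (x k) v *: x k) = s.
  by apply: eq_bigr => k _; rewrite cE dotZr (dotC v) cE expr2.
have yy0 : 0 <= \sum_(k < N) dot v (dot (y k) v *: y k).
  by apply: sumr_ge0 => k _; rewrite dotZr (dotC v) -expr2 sqr_ge0.
have vv0 := dot_ge0 v; have ww0 := dot_ge0 w.
suff : s <= (lam j.+1 + Num.sqrt S) * dot v v by lra.
have [->|sn0] := eqVneq s 0.
  by rewrite mulr_ge0// addr_ge0// sqrtr_ge0.
have s_gt0 : 0 < s by rewrite lt_neqAle eq_sym sn0.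
rewrite -(ler_pM2r s_gt0) -expr2; apply: (le_trans sv).
by rewrite mulrC -mulrA (mulrC (dot v v)) mulrA ler_wpM2r.
Qed.

End gram_matrix.

(** * Operator norm from a grid of test vectors *)

Section grid.
Context {R : realType} {n : nat}.
Implicit Types (m : {ffun 'I_n -> bool * 'I_(4 * n).+1}) (u v w : 'cV[R]_n).

(** An integer stored as a sign and an absolute value, which makes the grid a finite product over
    coordinates. The range up to [4 * n] is enough, because a coordinate of a unit vector times
    [4 * Num.sqrt n] is at most [4 * n]. *)
Definition grid_coord m i : R := (-1) ^+ (m i).1 * (m i).2%:R.

Definition grid_vec m : 'cV[R]_n := \col_i grid_coord m i.

Lemma grid_coord_sqr m i : grid_coord m i ^+ 2 = ((m i).2 ^ 2)%:R.
Proof. by rewrite exprMn sqrr_sign mul1r natrX. Qed.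

(** Each coordinate of [4 * Num.sqrt n *: u] is rounded towards zero. This does not increase
    absolute values, so both norm bounds survive, and it moves a coordinate of [u] by at most
    [1 / (4 * Num.sqrt n)], so that the [n] squared errors sum to at most [1 / 16]. *)
Lemma grid_round u : (0 < n)%N -> dot u u <= 1 ->
  exists m, [/\ (\sum_i (m i).2 ^ 2 <= 16 * n)%N,
    dot ((4 * Num.sqrt n%:R)^-1 *: grid_vec m)
        ((4 * Num.sqrt n%:R)^-1 *: grid_vec m) <= 1 &
    dot (u - (4 * Num.sqrt n%:R)^-1 *: grid_vec m)
        (u - (4 * Num.sqrt n%:R)^-1 *: grid_vec m) <= 1 / 16].
Proof.
move=> n0 u1.
have sn0 : 0 < Num.sqrt (n%:R : R) by rewrite sqrtr_gt0 ltr0n.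
pose s := 4 * Num.sqrt (n%:R : R); have s0 : 0 < s by rewrite mulr_gt0.
have s2 : s ^+ 2 = 16 * n%:R by rewrite exprMn sqr_sqrtr//; ring.
pose k i := Num.truncn `|s * u i 0|.
have kP i : (k i)%:R <= `|s * u i 0| < (k i).+1%:R by exact: truncn_itv.
have u2 i : `|s * u i 0| ^+ 2 <= 16 * n%:R.
  rewrite real_normK ?num_real// exprMn s2 ler_piMr ?mulr_ge0//.
  apply: le_trans u1; rewrite dotE2 (bigD1 i)//= lerDl.
  by apply: sumr_ge0 => j _; exact: sqr_ge0.
have ks i : (k i < (4 * n).+1)%N.
  rewrite ltnS -(@ler_nat R) natrM.
  have /andP[k1 _] := kP i; apply: (le_trans k1).
  rewrite -(ler_pXn2r (ltn0Sn 1)) ?nnegrE ?mulr_ge0//.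
  apply: (le_trans (u2 i)); rewrite exprMn.
  have : 1 <= n%:R :> R by rewrite ler1n.
  nra.
pose m : {ffun 'I_n -> bool * 'I_(4 * n).+1} :=
  [ffun i => (s * u i 0 < 0, Ordinal (ks i))].
exists m.
have mE i : (m i).2 = k i :> nat by rewrite ffunE.
have cE i : (grid_vec m) i 0 = (-1) ^+ (s * u i 0 < 0)%R * (k i)%:R.
  by rewrite mxE /grid_coord ffunE.
have k2 : \sum_i (k i)%:R ^+ 2 <= 16 * n%:R :> R.
  apply: (@le_trans _ _ (\sum_i (s * u i 0) ^+ 2)).
    apply: ler_sum => i _; have /andP[k1 _] := kP i.
    by rewrite -[leRHS]real_normK ?num_real// ler_sqr ?nnegrE.
  under eq_bigr do rewrite exprMn.
  by rewrite -mulr_sumr -dotE2 s2 ler_piMr// mulr_ge0.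
split.
- rewrite -(@ler_nat R) natrM natr_sum; under eq_bigr do rewrite mE natrX.
  by [].
- rewrite dotZl dotZr mulrA -expr2 -/s exprVn s2 ler_pdivrMl ?mulr_gt0 ?ltr0n//.
  rewrite mulr1 dotE2; apply: le_trans k2.
  by apply: ler_sum => i _; rewrite cE exprMn sqrr_sign mul1r.
- rewrite dotE2 -/s.
  have : \sum_i (u - s^-1 *: grid_vec m) i 0 ^+ 2 <=
      \sum_(i < n) (16 * n%:R)^-1 :> R.
    apply: ler_sum => i _; rewrite !mxE.
    have -> : grid_coord m i = (-1) ^+ (s * u i 0 < 0)%R * (k i)%:R.
      by rewrite -cE mxE.
    have -> : u i 0 - s^-1 * ((-1) ^+ (s * u i 0 < 0)%R * (k i)%:R) =
        s^-1 * (-1) ^+ (s * u i 0 < 0)%R * (`|s * u i 0| - (k i)%:R).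
      have {1}-> : u i 0 = s^-1 * (s * u i 0) by rewrite mulKf// gt_eqF.
      rewrite -mulrBr -mulrA; congr (_ * _).
      rewrite mulrBr; congr (_ - _).
      by rewrite {1}[s * u i 0]realEsign ?num_real.
    rewrite !exprMn sqrr_sign mulr1 exprVn s2 -[leRHS]mulr1; apply: ler_wpM2l.
      by rewrite invr_ge0 mulr_ge0.
    have /andP[k1 k3] := kP i.
    rewrite -natr1 in k3; rewrite -(expr1n _ 2) ler_sqr ?nnegrE; lra.
  move=> h; apply: (le_trans h); rewrite sumr_const card_ord -[leLHS]mulr_natr.
  by rewrite invfM -mulrA mulVf ?mulr1 ?div1r// pnatr_eq0 -lt0n.
Qed.

(** Let [q] be the supremum of the bilinear form over pairs of vectors of the unit ball. Replacing
    both arguments by grid vectors leaves two remainders of norm at most [1 / 4], each costing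
    [q / 4]; hence [q <= B + q / 2], and the passage from the grid to the ball loses only a factor
    2. *)
Lemma grid_operator_norm (E : 'M[R]_n) (B : R) : (0 < n)%N ->
  (forall m m', (\sum_i (m i).2 ^ 2 <= 16 * n)%N ->
     (\sum_i (m' i).2 ^ 2 <= 16 * n)%N ->
     dot (grid_vec m) (E *m grid_vec m') <= B * (16 * n%:R)) ->
  forall v, dot (E *m v) (E *m v) <= (2 * B) ^+ 2 * dot v v.
Proof.
move=> n0 EB.
pose A := [set t : R | exists u v, [/\ dot u u <= 1, dot v v <= 1 &
  t = dot u (E *m v)]].
have A0 : A !=set0.
  by exists 0; exists 0, 0; rewrite !dot0l ler01.
(* The Frobenius norm is used only to know that the supremum is finite, without which
   [q <= B + q / 2] would say nothing. *)
pose H := \sum_i \sum_l E i l ^+ 2.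
have EH v : dot (E *m v) (E *m v) <= H * dot v v.
  rewrite dotE2 mulr_suml; apply: ler_sum => i _; rewrite mxE dotE2.
  exact: sum_cauchy_schwarz.
have H0 : 0 <= H.
  by apply: sumr_ge0 => i _; apply: sumr_ge0 => l _; exact: sqr_ge0.
have Aub : has_ubound A.
  exists (1 + H) => _ [u [v [u1 v1 ->]]].
  have h1 : dot u (E *m v) ^+ 2 <= H.
    apply: le_trans (dot_cauchy_schwarz _ _) _.
    apply: (@le_trans _ _ (1 * (H * 1))); last by rewrite mul1r mulr1.
    apply: ler_pM => //; rewrite ?dot_ge0//; apply: le_trans (EH v) _.
    by rewrite ler_wpM2l.
  by have := sqr_ge0 (dot u (E *m v) - 1); nra.
pose q := sup A.
have qP u v : dot u u <= 1 -> dot v v <= 1 -> dot u (E *m v) <= q.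
  by move=> u1 v1; apply: sup_upper_bound => //; exists u, v.
have q0 : 0 <= q.
  by have := @qP 0 0; rewrite !dot0l => /(_ ler01 ler01).
have q4l u v : dot u u <= 1 / 16 -> dot v v <= 1 -> dot u (E *m v) <= q / 4.
  move=> u1 v1; have := qP (4 *: u) v; rewrite !dotZl dotZr.
  by move=> /(_ _ v1) h; have := h _; lra.
have q4r u v : dot u u <= 1 -> dot v v <= 1 / 16 -> dot u (E *m v) <= q / 4.
  move=> u1 v1; have := qP u (4 *: v); rewrite -scalemxAr dotZr !dotZl !dotZr.
  by move=> /(_ u1) h; have := h _; lra.
have qB : q <= 2 * B.
  suff : q <= B + q / 2 by lra.
  apply: ge_sup => // _ [u [v [u1 v1 ->]]].
  have [m [m16 w1 r1]] := grid_round n0 u1.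
  have [m' [m16' w1' r1']] := grid_round n0 v1.
  set s := (4 * _)^-1 in w1 r1 w1' r1'.
  have -> : dot u (E *m v) = dot (s *: grid_vec m) (E *m (s *: grid_vec m')) +
      dot (u - s *: grid_vec m) (E *m v) +
      dot (s *: grid_vec m) (E *m (v - s *: grid_vec m')).
    by rewrite mulmxBr dotBl dotBr; ring.
  have h1 := q4l _ _ r1 v1; have h2 := q4r _ _ w1 r1'.
  suff : dot (s *: grid_vec m) (E *m (s *: grid_vec m')) <= B by lra.
  rewrite -scalemxAr dotZl dotZr mulrA.
  have -> : s * s = (16 * n%:R)^-1.
    rewrite -expr2 exprVn exprMn sqr_sqrtr//; congr (_ * _)^-1; ring.
  by rewrite ler_pdivrMl ?mulr_gt0 ?ltr0n// mulrC; exact: EB.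
move=> v.
have [v0|v0] := eqVneq (dot v v) 0.
  by rewrite v0 mulr0; apply: (le_trans (EH v)); rewrite v0 mulr0.
have [b0|b0] := eqVneq (dot (E *m v) (E *m v)) 0.
  by rewrite b0 mulr_ge0 ?sqr_ge0 ?dot_ge0.
have v_gt0 : 0 < dot v v by rewrite lt_neqAle eq_sym v0 dot_ge0.
have b_gt0 : 0 < dot (E *m v) (E *m v) by rewrite lt_neqAle eq_sym b0 dot_ge0.
pose a := Num.sqrt (dot v v); pose b := Num.sqrt (dot (E *m v) (E *m v)).
have a0 : 0 < a by rewrite sqrtr_gt0.
have b1 : 0 < b by rewrite sqrtr_gt0.
have aE : a ^+ 2 = dot v v by rewrite sqr_sqrtr ?dot_ge0.
have bE : b ^+ 2 = dot (E *m v) (E *m v) by rewrite sqr_sqrtr ?dot_ge0.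
(* On the normalized vectors [E v] and [v] the form takes the value [b / a], the ratio of their
   norms. *)
have := qP (b^-1 *: (E *m v)) (a^-1 *: v).
rewrite -scalemxAr !dotZl !dotZr -aE -bE.
have -> : b^-1 * (b^-1 * b ^+ 2) = 1 by field; rewrite gt_eqF.
have -> : a^-1 * (a^-1 * a ^+ 2) = 1 by field; rewrite gt_eqF.
have -> : b^-1 * (a^-1 * b ^+ 2) = b / a by field; rewrite !gt_eqF.
move=> /(_ (lexx _) (lexx _)); rewrite ler_pdivrMr// => ba.
have B0 : 0 <= 2 * B by lra.
have aB0 : 0 <= 2 * B * a by apply: mulr_ge0 B0 (ltW a0).
rewrite -exprMn ler_sqr ?nnegrE ?(ltW b1)//.
by apply: (le_trans ba); rewrite ler_pM2r.
Qed.

End grid.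

(** * Measurability on the Krein space *)

Section krein_measurability.
Context {R : realType}.
Implicit Types z w : krein R.

Lemma krein_norm_sqr z : `|z| ^+ 2 = ell2_inner z.1 z.1 + ell2_inner z.2 z.2.
Proof. exact: (inner_norm_sqr (@krein_hilbert_inner_ge0 R)). Qed.

Lemma ell2_sum_cvg (x y : ell2 R) :
  \sum_(k < N) x k * y k @[N --> \oo] --> ell2_inner x y.
Proof.
have := @ell2_inner_cvg _ x y; rewrite /ell2_inner.
suff -> : series (fun j => x j * y j) = fun N => \sum_(k < N) x k * y k by [].
by apply/funext => N; rewrite /series/= big_mkord.
Qed.

Lemma krein_inner_cvg z w :
  \sum_(k < N) (z.1 k * w.1 k - z.2 k * w.2 k) @[N --> \oo] --> krein_inner z w.
Proof.
under eq_fun do rewrite sumrB.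
by apply: cvgB; exact: ell2_sum_cvg.
Qed.

Lemma krein_norm_sqr_cvg z :
  \sum_(k < N) (z.1 k ^+ 2 + z.2 k ^+ 2) @[N --> \oo] --> `|z| ^+ 2.
Proof.
rewrite krein_norm_sqr; under eq_fun do rewrite big_split/=.
by apply: cvgD; under eq_fun do under eq_bigr do rewrite expr2;
  exact: ell2_sum_cvg.
Qed.

Lemma krein_norm_sqr_ge z N :
  \sum_(k < N) z.1 k ^+ 2 + \sum_(k < N) z.2 k ^+ 2 <= `|z| ^+ 2.
Proof.
rewrite -big_split/= -lerN2.
have := @krein_norm_sqr_cvg z; move/cvgN => h.
apply: (@cvgn_le _ _ _ _ N h) => M NM; rewrite lerN2.
rewrite (big_ord_widen _ (fun k => z.1 k ^+ 2 + z.2 k ^+ 2) NM).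
rewrite [leRHS](bigID (fun i : 'I_M => i < N)%N)/= lerDl sumr_ge0// => i _.
by rewrite addr_ge0 ?sqr_ge0.
Qed.

Lemma krein_coord_le z j : `|z.1 j| <= `|z| /\ `|z.2 j| <= `|z|.
Proof.
have h := krein_norm_sqr_ge z j.+1.
have s1 : 0 <= \sum_(k < j.+1) z.1 k ^+ 2.
  by apply: sumr_ge0 => k _; exact: sqr_ge0.
have s2 : 0 <= \sum_(k < j.+1) z.2 k ^+ 2.
  by apply: sumr_ge0 => k _; exact: sqr_ge0.
have h1 : z.1 j ^+ 2 <= \sum_(k < j.+1) z.1 k ^+ 2.
  by rewrite big_ord_recr/= lerDr sumr_ge0// => k _; exact: sqr_ge0.
have h2 : z.2 j ^+ 2 <= \sum_(k < j.+1) z.2 k ^+ 2.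
  by rewrite big_ord_recr/= lerDr sumr_ge0// => k _; exact: sqr_ge0.
split; rewrite -(ler_pXn2r (ltn0Sn 1)) ?nnegrE// real_normK ?num_real//; lra.
Qed.

Lemma krein_inner_diag_le z : `|krein_inner z z| <= `|z| ^+ 2.
Proof.
rewrite krein_norm_sqr /krein_inner ler_norml.
have := ell2_inner_ge0 z.1; have := ell2_inner_ge0 z.2.
by move=> ? ?; apply/andP; split; lra.
Qed.

Lemma continuous_measurable_krein (f : krein R -> R) :
  continuous f -> measurable_fun setT f.
Proof.
move=> /continuousP cf.
apply: (measurability _ (RGenOpens.measurableE R)).
move=> _ [_ [a [b ->] <-]]; rewrite setTI; apply: sub_sigma_algebra.
exact/cf/interval_open.
Qed.

Lemma short_map_continuous_krein (f : krein R -> R) :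
  (forall z w, `|f z - f w| <= `|z - w|) -> continuous f.
Proof.
move=> fl z; apply/(@cvgrPdist_lt _ _ _ (nbhs z)) => e e0.
have : nbhs z (ball z e) by exact: nbhsx_ballx.
apply: filterS => w; rewrite -ball_normE/=; exact: le_lt_trans.
Qed.

Lemma krein_coord_measurable j :
  measurable_fun setT (fun z : krein R => z.1 j) /\
  measurable_fun setT (fun z : krein R => z.2 j).
Proof.
split; apply: continuous_measurable_krein; apply: short_map_continuous_krein;
  move=> z w.
- by have [] := krein_coord_le (z - w) j.
- by have [] := krein_coord_le (z - w) j.
Qed.

Lemma krein_norm_measurable : measurable_fun setT (fun z : krein R => `|z|).
Proof.
apply: continuous_measurable_krein; apply: short_map_continuous_krein => z w.
exact: ler_dist_dist.
Qed.

(** Joint continuity would give measurability for the Borel sets of a product, not for the product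
    sigma-field. The inner product is therefore taken as a pointwise limit of polynomials in the
    coordinates, each of which is measurable. *)
Lemma krein_inner_measurable d (T : measurableType d) (f g : T -> krein R) :
  measurable_fun setT f -> measurable_fun setT g ->
  measurable_fun setT (fun t => krein_inner (f t) (g t)).
Proof.
move=> mf mg.
apply: (@measurable_fun_cvg _ _ _ _ (fun N t => \sum_(k < N)
  ((f t).1 k * (g t).1 k - (f t).2 k * (g t).2 k))); last first.
  by move=> t _; exact: krein_inner_cvg.
move=> N; apply: measurable_sum => k.
have [h1 h2] := krein_coord_measurable k.
by apply: measurable_funB; apply: measurable_funM;
  [exact: (measurableT_comp h1 mf)|exact: (measurableT_comp h1 mg)
  |exact: (measurableT_comp h2 mf)|exact: (measurableT_comp h2 mg)].
Qed.

Lemma krein_dist_measurable :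
  measurable_fun setT (fun t : krein R * krein R => `|t.1 - t.2|).
Proof.
have h : measurable_fun setT (fun t : krein R * krein R => `|t.1 - t.2| ^+ 2).
  apply: (@measurable_fun_cvg _ _ _ _
    (fun N (t : krein R * krein R) => \sum_(k < N)
    ((t.1 - t.2).1 k ^+ 2 + (t.1 - t.2).2 k ^+ 2))); last first.
    by move=> t _; exact: krein_norm_sqr_cvg.
  move=> N; apply: measurable_sum => k.
  have [h1 h2] := krein_coord_measurable k.
  have m1 : measurable_fun setT (@fst (krein R) (krein R)) by [].
  have m2 : measurable_fun setT (@snd (krein R) (krein R)) by [].
  apply: measurable_funD; apply: measurable_funX; apply: measurable_funB.
  - exact: (measurableT_comp h1 m1).
  - exact: (measurableT_comp h1 m2).
  - exact: (measurableT_comp h2 m1).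
  - exact: (measurableT_comp h2 m2).
have -> : (fun t : krein R * krein R => `|t.1 - t.2|) =
    Num.sqrt \o (fun t : krein R * krein R => `|t.1 - t.2| ^+ 2).
  by apply/funext => t /=; rewrite sqrtr_sqr normr_id.
by apply: measurableT_comp h; apply: continuous_measurable_fun; exact: sqrt_continuous.
Qed.

End krein_measurability.

(** * Second moments of iid samples *)

Section iid_pairs.
Context {R : realType} {F : probability (krein R) R} {d : measure_display}
  {Omega : measurableType d} {P : probability Omega R}
  {Z : nat -> {RV P >-> krein R}}.
Context (ZF : iid_from F Z).
Local Open Scope ereal_scope.

Lemma iid_preimage i B : measurable B -> P (Z i @^-1` B) = F B.
Proof. by case: ZF => _ h; exact: h. Qed.

Lemma iid_ge0_integral i (f : krein R -> \bar R) :
  measurable_fun setT f -> (forall z, 0 <= f z) ->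
  \int[P]_w f (Z i w) = \int[F]_z f z.
Proof.
move=> mf f0; rewrite -(ge0_integral_distribution (P := P) (Z i))//.
by apply: eq_measure_integral => B mB _; exact: iid_preimage.
Qed.

Section pair.
Context {i j : nat} (ij : i != j).

Let pair_measurable : measurable_fun setT (fun w => (Z i w, Z j w)).
Proof. by apply/measurable_fun_pairP; split. Qed.

Let ZZ : {mfun Omega >-> (krein R * krein R)%type} :=
  HB.pack (fun w => (Z i w, Z j w))
    (isMeasurableFun.Build _ _ _ _ _ pair_measurable).

(** Mutual independence for the index set of [i] and [j] gives the measure of rectangles, and
    rectangles determine the product measure. *)
Lemma iid_pair_law X : measurable X ->
  P [set w | X (Z i w, Z j w)] = (F \x F) X.
Proof.
move=> mX; rewrite -[LHS]/(distribution P ZZ X); apply/esym.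
apply: product_measure_unique => // A B mA mB.
pose C k := if k == i then A else B.
have mC k : measurable (C k) by rewrite /C; case: ifP.
have := (ZF.1 [fset i; j]%fset C mC).
have -> : \bigcap_(k in [set` [fset i; j]%fset]) (Z k @^-1` C k) =
    ZZ @^-1` (A `*` B).
  apply/seteqP; split => w /=.
    move=> h; split => /=.
      by have := h i; rewrite /= !inE eqxx /C eqxx => /(_ isT).
    have := h j; rewrite /= !inE eqxx orbT /C eq_sym (negbTE ij).
    by move=> /(_ isT).
  move=> [/= h1 h2] k; rewrite /= !inE => /orP[|] /eqP ->.
    by rewrite /C eqxx.
  by rewrite /C eq_sym (negbTE ij).
rewrite big_fsetU1/= ?inE// big_seq_fset1 /C eqxx eq_sym (negbTE ij).
by rewrite !iid_preimage.
Qed.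

Let ZZE X : measurable X -> distribution P ZZ X = (F \x F) X.
Proof. exact: iid_pair_law. Qed.

Lemma iid_pair_ge0_integral (f : krein R * krein R -> \bar R) :
  measurable_fun setT f -> (forall z, 0 <= f z) ->
  \int[P]_w f (Z i w, Z j w) = \int[F \x F]_z f z.
Proof.
move=> mf f0; rewrite -(ge0_integral_distribution (P := P) ZZ)//.
by apply: eq_measure_integral => B mB _; exact: ZZE.
Qed.

Lemma iid_pair_integral (f : krein R * krein R -> \bar R) :
  (F \x F).-integrable setT f ->
  P.-integrable setT (fun w => f (Z i w, Z j w)) /\
  \int[P]_w f (Z i w, Z j w) = \int[F \x F]_z f z.
Proof.
move=> intf; have /integrableP[mf foo] := intf.
have intP : P.-integrable setT (fun w => f (Z i w, Z j w)).
  apply/integrableP; split.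
    exact: (measurableT_comp mf pair_measurable).
  rewrite (iid_pair_ge0_integral (f := fun z => `|f z|))//.
  exact: measurableT_comp.
split => //; rewrite -(integral_distribution (P := P) (X := ZZ))//.
by apply: eq_measure_integral => B mB _; exact: ZZE.
Qed.

End pair.

End iid_pairs.

Lemma norm_le_sqrD1 (R : realType) (t : R) : `|t| <= 1 + t ^+ 2.
Proof.
rewrite ler_norml; have := sqr_ge0 (t + 1); have := sqr_ge0 (t - 1).
by have := sqr_ge0 t => ? ? ?; apply/andP; split; lra.
Qed.

(** Expand the square of the centered mean: the cross terms vanish by independence, and each of the
    [n] diagonal terms is a variance, at most the second moment, with weight [n^(-2)]. *)
Lemma iid_mean_square {R : realType} {F : probability (krein R) R}
    {d : measure_display} {Omega : measurableType d} {P : probability Omega R}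
    {Z : nat -> {RV P >-> krein R}} (ZF : iid_from F Z) (g : krein R -> R)
    (m : R) n : (0 < n)%N -> measurable_fun setT g ->
  (\int[F]_z (g z ^+ 2)%:E < +oo)%E -> (\int[F]_z (g z)%:E = m%:E)%E ->
  (\int[P]_w ((n%:R^-1 * \sum_(i < n) g (Z i w) - m) ^+ 2)%:E <=
   (n%:R^-1)%:E * \int[F]_z (g z ^+ 2)%:E)%E.
Proof.
move=> n0 mg g2 gm.
have mg2 : measurable_fun setT (fun z => g z ^+ 2) by exact: measurable_funX.
have ig2 : F.-integrable setT (fun z => (g z ^+ 2)%:E).
  apply/integrableP; split; first exact/measurable_EFinP.
  by under eq_integral do rewrite gee0_abs ?lee_fin ?sqr_ge0//.
have icst c : F.-integrable setT (fun=> c%:E).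
  exact: finite_measure_integrable_cst.
have ig : F.-integrable setT (fun z => (g z)%:E).
  apply: (le_integrable measurableT _ _ (integrableD measurableT (icst 1) ig2)).
    exact/measurable_EFinP.
  move=> z _; rewrite -!EFinD !abse_EFin lee_fin.
  rewrite (ger0_norm (_ : 0 <= 1 + g z ^+ 2)); last first.
    by rewrite addr_ge0// sqr_ge0.
  exact: norm_le_sqrD1.
pose h z := g z - m.
have mh : measurable_fun setT h by exact: measurable_funB.
have ih : F.-integrable setT (fun z => (h z)%:E).
  exact: (integrableB measurableT ig (icst m)).
have h0 : (\int[F]_z (h z)%:E = 0)%E.
  transitivity (\int[F]_z ((g z)%:E - m%:E))%E; first by [].
  rewrite integralB// gm integral_cst//= (@probability_setT _ _ _ F) mule1.
  by rewrite -EFinB subrr.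
have h2E : (\int[F]_z (h z ^+ 2)%:E <= \int[F]_z (g z ^+ 2)%:E)%E.
  have e1 : (\int[F]_z (h z ^+ 2)%:E =
      \int[F]_z (g z ^+ 2)%:E - (m ^+ 2)%:E)%E.
    transitivity (\int[F]_z ((g z ^+ 2)%:E + ((- (2 * m))%:E * (g z)%:E
        + (m ^+ 2)%:E)))%E.
      apply: eq_integral => z _; rewrite -EFinM -!EFinD; congr _%:E.
      by rewrite /h; ring.
    have i2 : F.-integrable setT (fun z => (- (2 * m))%:E * (g z)%:E)%E.
      exact: integrableZl.
    rewrite integralD//; last exact: integrableD.
    rewrite integralD// integralZl// gm integral_cst//=.
    rewrite (@probability_setT _ _ _ F) mule1 -EFinM -EFinD; congr (_ + _)%E.
    by congr _%:E; ring.
  by rewrite e1 leeBlDr// leeDl// lee_fin sqr_ge0.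
have h2oo : (\int[F]_z (h z ^+ 2)%:E < +oo)%E by exact: le_lt_trans g2.
pose f (t : krein R * krein R) := (h t.1 * h t.2)%:E.
have mf : measurable_fun setT f.
  by apply/measurable_EFinP; apply: measurable_funM;
    exact: measurableT_comp.
(* Fubini is applied to a product of signs unknown, so its absolute value is first shown to
   integrate to a product of two finite first moments. *)
have intf : (F \x F)%E.-integrable setT f.
  apply/(integrable12ltyP _ _ mf).
  have /integrableP[_ hoo] := ih.
  have hfin : (\int[F]_z `|(h z)%:E| \is a fin_num)%E.
    by rewrite ge0_fin_numE// integral_ge0.
  have mah : measurable_fun setT (fun z => `|(h z)%:E|)%E.
    by apply: measurableT_comp => //; exact/measurable_EFinP.
  have inner x : (\int[F]_y `|f (x, y)| =
      `|(h x)%:E| * \int[F]_z `|(h z)%:E|)%E.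
    transitivity (\int[F]_y (`|(h x)%:E| * `|(h y)%:E|))%E.
      by apply: eq_integral => y _; rewrite /f/= normrM.
    by rewrite ge0_integralZl.
  under eq_integral do rewrite inner.
  rewrite ge0_integralZr// ?integral_ge0//.
  by rewrite -(fineK hfin) -EFinM ltry.
have If : (\int[F \x F]_t f t = 0)%E.
  rewrite -integral12_prod_meas1//.
  have inner x : (\int[F]_y f (x, y) = 0)%E.
    transitivity (\int[F]_y ((h x)%:E * (h y)%:E))%E.
      by apply: eq_integral => y _; rewrite /f/= EFinM.
    by rewrite integralZl// h0 mule0.
  transitivity (\int[F]_x cst 0%E x)%E; last by rewrite integral0.
  by apply: eq_integral => x _; exact: inner.
have iij (i j : 'I_n) :
    P.-integrable setT (fun w => (h (Z i w) * h (Z j w))%:E) /\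
    (\int[P]_w (h (Z i w) * h (Z j w))%:E =
     (\int[F]_z (h z ^+ 2)%:E) *+ (i == j))%E.
  have [->|ij] := eqVneq i j.
    have e2 : (\int[P]_w (h (Z j w) * h (Z j w))%:E =
        \int[F]_z (h z ^+ 2)%:E)%E.
      under eq_integral do rewrite -expr2.
      rewrite (iid_ge0_integral ZF j (f := fun z => (h z ^+ 2)%:E))//.
        by apply/measurable_EFinP; exact: measurable_funX.
      by move=> z; rewrite lee_fin sqr_ge0.
    split => //; apply/integrableP; split.
      apply/measurable_EFinP; apply: measurable_funM;
        exact: (measurableT_comp mh).
    under eq_integral do rewrite -expr2 gee0_abs ?lee_fin ?sqr_ge0// expr2.
    by rewrite e2.
  have [i1 i2] := iid_pair_integral ZF (ij : (i : nat) != j) intf.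
  by split => //; rewrite [LHS]i2.
pose c : R := n%:R^-1.
have nR : n%:R != 0 :> R by rewrite pnatr_eq0 -lt0n.
have e3 w : (c * (\sum_(i < n) g (Z i w)) - m) ^+ 2 =
    \sum_(i < n) \sum_(j < n) c ^+ 2 * (h (Z i w) * h (Z j w)).
  have -> : c * (\sum_(i < n) g (Z i w)) - m = c * \sum_(i < n) h (Z i w).
    rewrite /h sumrB sumr_const card_ord -mulr_natl mulrBr /c mulrA mulVf//.
    by rewrite mul1r.
  rewrite exprMn expr2 (expr2 (\sum_(i < n) _)) mulr_suml mulr_sumr.
  by apply: eq_bigr => i _; rewrite !mulr_sumr.
have ic (i j : 'I_n) : P.-integrable setT
    (fun w => (c ^+ 2)%:E * (h (Z i w) * h (Z j w))%:E)%E.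
  by apply: integrableZl => //; exact: (iij i j).1.
have -> : (\int[P]_w ((c * \sum_(i < n) g (Z i w) - m) ^+ 2)%:E =
    \int[P]_w (\sum_(i < n) \sum_(j < n)
    (c ^+ 2)%:E * (h (Z i w) * h (Z j w))%:E))%E.
  apply: eq_integral => w _; rewrite e3 -sumEFin; apply: eq_bigr => i _.
  by rewrite -sumEFin; apply: eq_bigr => j _; rewrite EFinM.
rewrite integral_sum//; last first.
  by move=> i; exact: integrable_sum.
have -> : (\sum_(i < n) \int[P]_w (\sum_(j < n)
    (c ^+ 2)%:E * (h (Z i w) * h (Z j w))%:E) =
    \sum_(i < n) (c ^+ 2)%:E * \int[F]_z (h z ^+ 2)%:E)%E.
  apply: eq_bigr => i _; rewrite integral_sum// (bigD1 i)//= big1 ?adde0.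
    by rewrite integralZl//; [rewrite (iij i i).2 eqxx|exact: (iij i i).1].
  move=> j ji; rewrite integralZl//; last exact: (iij i j).1.
  by rewrite (iij i j).2 eq_sym (negbTE ji) mule0.
have h2fin : (\int[F]_z (h z ^+ 2)%:E \is a fin_num)%E.
  by rewrite ge0_fin_numE// integral_ge0// => z _; rewrite lee_fin sqr_ge0.
have cc : n%:R * c ^+ 2 = c by rewrite /c; field.
rewrite -(fineK h2fin) -EFinM sumEFin sumr_const card_ord.
rewrite -(mulr_natl (c ^+ 2 * _)) mulrA cc.
by rewrite EFinM fineK// lee_wpmul2l// lee_fin invr_ge0.
Qed.

Lemma markov_tail {R : realType} {d : measure_display} {T : measurableType d}
    (mu : {measure set T -> \bar R}) (f : T -> R) (c eps : R) :
  0 < c -> 0 < eps -> measurable_fun setT f -> (forall w, 0 <= f w) ->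
  (\int[mu]_w (f w)%:E <= c%:E)%E ->
  (mu [set w | (c / eps < f w)%R] <= eps%:E)%E.
Proof.
move=> c0 eps0 mf f0 fc.
have a0 : 0 < c / eps by rewrite divr_gt0.
have := @le_integral_comp_abse _ _ _ mu setT measurableT (EFin \o f) (c / eps)
  id (@measurable_id _ _ _).
rewrite setTI => /(_ _ _ _ a0) h.
have mS : measurable [set w | c / eps < f w].
  rewrite -[X in measurable X]setTI.
  exact: (measurable_fun_ltr (measurable_cst _) mf).
have mS' : measurable [set w | ((c / eps)%:E <= `|(EFin \o f) w|)%E].
  rewrite -[X in measurable X]setTI; apply: emeasurable_fun_c_infty => //.
  by apply: measurableT_comp => //; exact/measurable_EFinP.
have sub : [set w | c / eps < f w] `<=`
    [set w | ((c / eps)%:E <= `|(EFin \o f) w|)%E].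
  by move=> w /= h1; rewrite lee_fin ger0_norm// ltW.
apply: le_trans (le_measure _ (mem_set mS) (mem_set mS') sub) _.
have {}h : ((c / eps)%:E * mu [set w | ((c / eps)%:E <= `|(EFin \o f) w|)%E]
    <= c%:E)%E.
  apply: (le_trans _ fc); apply: (le_trans (h _ _ _)) => //.
  - exact/measurable_EFinP.
  - by under eq_integral do rewrite /= ger0_norm//.
rewrite -(@lee_pmul2l _ (c / eps)%:E) ?lte_fin//.
apply: (le_trans h); rewrite -EFinM lee_fin.
by rewrite divfK// gt_eqF.
Qed.

Section moment_tails.
Context {R : realType} {F : probability (krein R) R} {lam gam : nat -> R}
  {d : measure_display} {Omega : measurableType d} {P : probability Omega R}
  {Z : nat -> {RV P >-> krein R}}.
Context (unc : uncorrelated_coordinates F lam gam)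
  (m4 : finite_fourth_moment F) (ZF : iid_from F Z).

Definition cross_moment_xx n w k l : R :=
  n%:R^-1 * \sum_(i < n) (Z i w).1 k * (Z i w).1 l - lam k *+ (k == l).
Definition cross_moment_yy n w k l : R :=
  n%:R^-1 * \sum_(i < n) (Z i w).2 k * (Z i w).2 l - gam k *+ (k == l).
Definition cross_moment_xy n w k l : R :=
  n%:R^-1 * \sum_(i < n) (Z i w).1 k * (Z i w).2 l.

(** The squared Hilbert-Schmidt norm of the deviation of the empirical second moments in the first
    [N] coordinates of each part, with the mixed block counted once. Putting the three blocks into
    one quantity lets a single event control them for both halves of the embedding. *)
Definition gram_deviation n N w : R := \sum_(k < N) \sum_(l < N)
  (cross_moment_xx n w k l ^+ 2 + cross_moment_yy n w k l ^+ 2 +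
   cross_moment_xy n w k l ^+ 2).

(** The added 1 makes the constant positive, as Markov's inequality with a threshold proportional to
    it requires. *)
Definition fourth_moment : R := fine (\int[F]_z (`|z| ^+ 4)%:E) + 1.

Lemma fourth_moment_ge : (\int[F]_z (`|z| ^+ 4)%:E <= fourth_moment%:E)%E.
Proof.
have := m4; rewrite /finite_fourth_moment unlock => h.
have i0 : (0 <= \int[F]_z (`|z| ^+ 4)%:E)%E.
  by apply: integral_ge0 => z _; rewrite lee_fin exprn_ge0.
by rewrite -[leLHS]fineK ?ge0_fin_numE// lee_fin /fourth_moment lerDl ler01.
Qed.

Lemma fourth_moment_gt0 : 0 < fourth_moment.
Proof.
by rewrite ltr_wpDl// fine_ge0// integral_ge0// => z _; rewrite lee_fin exprn_ge0.
Qed.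

Let mnorm4 : measurable_fun setT (fun z : krein R => `|z| ^+ 4).
Proof. by apply: measurable_funX; exact: krein_norm_measurable. Qed.

Let mprod (f g : krein R -> R) n : measurable_fun setT f ->
  measurable_fun setT g -> measurable_fun setT
    (fun w => n%:R^-1 * \sum_(i < n) f (Z i w) * g (Z i w)).
Proof.
move=> mf mg; apply: measurable_funM; first exact: measurable_cst.
by apply: measurable_sum => i; apply: measurable_funM;
  [exact: (measurableT_comp mf)|exact: (measurableT_comp mg)].
Qed.

Lemma gram_deviation_measurable n N :
  measurable_fun setT (gram_deviation n N).
Proof.
apply: measurable_sum => k; apply: measurable_sum => l.
have [x1 y1] := @krein_coord_measurable R k.
have [x2 y2] := @krein_coord_measurable R l.
apply: measurable_funD; first apply: measurable_funD; apply: measurable_funX.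
- by apply: measurable_funB; [exact: (mprod n x1 x2)|exact: measurable_cst].
- by apply: measurable_funB; [exact: (mprod n y1 y2)|exact: measurable_cst].
- exact: (mprod n x1 y2).
Qed.

Lemma gram_deviation_term_ge0 n w k l : 0 <= cross_moment_xx n w k l ^+ 2 +
  cross_moment_yy n w k l ^+ 2 + cross_moment_xy n w k l ^+ 2.
Proof. by rewrite !addr_ge0 ?sqr_ge0. Qed.

Lemma gram_deviation_ge0 n N w : 0 <= gram_deviation n N w.
Proof.
by apply: sumr_ge0 => k _; apply: sumr_ge0 => l _; exact: gram_deviation_term_ge0.
Qed.

Lemma gram_deviation_nondecreasing n w N M : (N <= M)%N ->
  gram_deviation n N w <= gram_deviation n M w.
Proof.
move=> NM; rewrite /gram_deviation.
pose t k l := cross_moment_xx n w k l ^+ 2 +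
  cross_moment_yy n w k l ^+ 2 + cross_moment_xy n w k l ^+ 2.
rewrite (big_ord_widen _ (fun k => \sum_(l < N) t k l) NM).
rewrite [leRHS](bigID (fun i : 'I_M => i < N)%N)/= ler_wpDr//.
  by apply: sumr_ge0 => k _; apply: sumr_ge0 => l _; exact: gram_deviation_term_ge0.
apply: ler_sum => k _; rewrite (big_ord_widen _ (fun l => t k l) NM).
rewrite [leRHS](bigID (fun i : 'I_M => i < N)%N)/= ler_wpDr//.
by apply: sumr_ge0 => l _; exact: gram_deviation_term_ge0.
Qed.

Let coord4 (k l : nat) (z : krein R) :
  [/\ (z.1 k * z.1 l) ^+ 2 <= `|z| ^+ 4, (z.2 k * z.2 l) ^+ 2 <= `|z| ^+ 4 &
      (z.1 k * z.2 l) ^+ 2 <= `|z| ^+ 4].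
Proof.
have [x1 y1] := krein_coord_le z k; have [x2 y2] := krein_coord_le z l.
have h (a b : R) : `|a| <= `|z| -> `|b| <= `|z| -> (a * b) ^+ 2 <= `|z| ^+ 4.
  move=> h1 h2; rewrite -[leLHS]real_normK ?num_real// normrM.
  have -> : `|z| ^+ 4 = (`|z| * `|z|) ^+ 2 by ring.
  by rewrite ler_sqr ?nnegrE ?mulr_ge0// ler_pM.
by split; apply: h.
Qed.

(** The bound does not depend on [N]: the variances are bounded by second moments of products of
    coordinates, and these sum, inside the integral, to [a^2 + b^2 + a * b] with [a] and [b] the
    partial squared norms of the two parts. This is at most [(a + b)^2], hence at most the fourth
    power of the norm. *)
Lemma gram_deviation_expectation n N : (0 < n)%N ->
  (\int[P]_w (gram_deviation n N w)%:E <= (fourth_moment / n%:R)%:E)%E.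
Proof.
move=> n0.
have step (g : krein R -> R) (m : R) : measurable_fun setT g ->
    (forall z, g z ^+ 2 <= `|z| ^+ 4) -> ('E_F[g] = m%:E)%E ->
    (\int[P]_w ((n%:R^-1 * \sum_(i < n) g (Z i w) - m) ^+ 2)%:E <=
     (n%:R^-1)%:E * \int[F]_z (g z ^+ 2)%:E)%E.
  move=> mg g4 gm; apply: iid_mean_square => //; last by rewrite -gm unlock.
  apply: (@le_lt_trans _ _ fourth_moment%:E); last exact: ltry.
  apply: le_trans fourth_moment_ge; apply: ge0_le_integral => //.
  - by move=> z _; rewrite lee_fin sqr_ge0.
  - by apply/measurable_EFinP; exact: measurable_funX.
  - exact/measurable_EFinP.
  - by move=> z _; rewrite lee_fin.
pose s k l (z : krein R) :=
  (z.1 k * z.1 l) ^+ 2 + (z.2 k * z.2 l) ^+ 2 + (z.1 k * z.2 l) ^+ 2.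
have mx k := (@krein_coord_measurable R k).1.
have my k := (@krein_coord_measurable R k).2.
have mxx k l : measurable_fun setT (fun z : krein R => z.1 k * z.1 l).
  exact: measurable_funM.
have myy k l : measurable_fun setT (fun z : krein R => z.2 k * z.2 l).
  exact: measurable_funM.
have mxy k l : measurable_fun setT (fun z : krein R => z.1 k * z.2 l).
  exact: measurable_funM.
have mdev k l : [/\ measurable_fun setT (fun w => cross_moment_xx n w k l),
    measurable_fun setT (fun w => cross_moment_yy n w k l) &
    measurable_fun setT (fun w => cross_moment_xy n w k l)].
  split; last exact: (mprod n (mx k) (my l)).
    by apply: measurable_funB; [exact: (mprod n (mx k) (mx l))|exact: measurable_cst].
  by apply: measurable_funB; [exact: (mprod n (my k) (my l))|exact: measurable_cst].
have termE k l : (\int[P]_w (cross_moment_xx n w k l ^+ 2 +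
    cross_moment_yy n w k l ^+ 2 + cross_moment_xy n w k l ^+ 2)%:E <=
    (n%:R^-1)%:E * \int[F]_z (s k l z)%:E)%E.
  have [e1 e2 e3] := unc k l; have [d1 d2 d3] := mdev k l.
  have -> : (\int[F]_z (s k l z)%:E = \int[F]_z ((z.1 k * z.1 l) ^+ 2)%:E +
      \int[F]_z ((z.2 k * z.2 l) ^+ 2)%:E + \int[F]_z ((z.1 k * z.2 l) ^+ 2)%:E)%E.
    rewrite -ge0_integralD//; last 4 first.
    - by move=> z _; rewrite lee_fin sqr_ge0.
    - by apply/measurable_EFinP; exact: measurable_funX.
    - by move=> z _; rewrite lee_fin sqr_ge0.
    - by apply/measurable_EFinP; exact: measurable_funX.
    rewrite -ge0_integralD//.
    - by move=> z _; rewrite -EFinD lee_fin addr_ge0 ?sqr_ge0.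
    - by apply/measurable_EFinP; apply: measurable_funD; exact: measurable_funX.
    - by move=> z _; rewrite lee_fin sqr_ge0.
    - by apply/measurable_EFinP; exact: measurable_funX.
  have -> : (\int[P]_w (cross_moment_xx n w k l ^+ 2 +
      cross_moment_yy n w k l ^+ 2 + cross_moment_xy n w k l ^+ 2)%:E =
      \int[P]_w (cross_moment_xx n w k l ^+ 2)%:E +
      \int[P]_w (cross_moment_yy n w k l ^+ 2)%:E +
      \int[P]_w (cross_moment_xy n w k l ^+ 2)%:E)%E.
    rewrite -ge0_integralD//; last 4 first.
    - by move=> z _; rewrite lee_fin sqr_ge0.
    - by apply/measurable_EFinP; exact: measurable_funX.
    - by move=> z _; rewrite lee_fin sqr_ge0.
    - by apply/measurable_EFinP; exact: measurable_funX.
    rewrite -ge0_integralD//.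
    - by move=> z _; rewrite -EFinD lee_fin addr_ge0 ?sqr_ge0.
    - by apply/measurable_EFinP; apply: measurable_funD; exact: measurable_funX.
    - by move=> z _; rewrite lee_fin sqr_ge0.
    - by apply/measurable_EFinP; exact: measurable_funX.
  have dis (a b c x : \bar R) : (0 <= a -> 0 <= b -> 0 <= c ->
      x * (a + b + c) = x * a + x * b + x * c)%E.
    by move=> a0 b0 c0; rewrite !ge0_muleDr// adde_ge0.
  rewrite dis; try by apply: integral_ge0 => z _; rewrite lee_fin sqr_ge0.
  apply: leeD; first apply: leeD.
  - by apply: (step _ _ (mxx k l) _ e1) => z; have [] := coord4 k l z.
  - by apply: (step _ _ (myy k l) _ e2) => z; have [] := coord4 k l z.
  - have := step _ 0 (mxy k l) _ e3.
    have -> : (fun w => ((n%:R^-1 * \sum_(i < n) (Z i w).1 k * (Z i w).2 l - 0)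
        ^+ 2)%:E) = (fun w => (cross_moment_xy n w k l ^+ 2)%:E).
      by apply/funext => w; rewrite subr0.
    by apply => z; have [] := coord4 k l z.
have -> : (\int[P]_w (gram_deviation n N w)%:E = \sum_(k < N) \sum_(l < N)
    \int[P]_w (cross_moment_xx n w k l ^+ 2 +
    cross_moment_yy n w k l ^+ 2 + cross_moment_xy n w k l ^+ 2)%:E)%E.
  have mt k l : measurable_fun setT (fun w => (cross_moment_xx n w k l ^+ 2 +
    cross_moment_yy n w k l ^+ 2 + cross_moment_xy n w k l ^+ 2)%:E).
    have [d1 d2 d3] := mdev k l; apply/measurable_EFinP.
    by apply: measurable_funD; [apply: measurable_funD|]; exact: measurable_funX.
  under [LHS]eq_integral do rewrite /gram_deviation -sumEFin.
  rewrite ge0_integral_sum//; last 2 first.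
  - move=> k; under eq_fun do rewrite -sumEFin.
    by apply: emeasurable_sum => l.
  - move=> k w _; rewrite lee_fin sumr_ge0// => l _.
    exact: gram_deviation_term_ge0.
  apply: eq_bigr => k _; under eq_integral do rewrite -sumEFin.
  rewrite ge0_integral_sum// => l w _; rewrite lee_fin.
  exact: gram_deviation_term_ge0.
apply: (@le_trans _ _ (\sum_(k < N) \sum_(l < N)
    (n%:R^-1)%:E * \int[F]_z (s k l z)%:E)%E).
  by apply: lee_sum => k _; apply: lee_sum => l _.
have s0 k l z : 0 <= s k l z by rewrite !addr_ge0 ?sqr_ge0.
have ms k l : measurable_fun setT (fun z => (s k l z)%:E).
  apply/measurable_EFinP.
  by apply: measurable_funD; [apply: measurable_funD|]; exact: measurable_funX.
have -> : (\sum_(k < N) \sum_(l < N) (n%:R^-1)%:E * \int[F]_z (s k l z)%:E =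
    (n%:R^-1)%:E * \int[F]_z (\sum_(k < N) \sum_(l < N) s k l z)%:E)%E.
  have -> : (\int[F]_z (\sum_(k < N) \sum_(l < N) s k l z)%:E =
      \sum_(k < N) \sum_(l < N) \int[F]_z (s k l z)%:E)%E.
    under [LHS]eq_integral do rewrite -sumEFin.
    rewrite ge0_integral_sum//; last 2 first.
    - move=> k; under eq_fun do rewrite -sumEFin.
      by apply: emeasurable_sum => l.
    - by move=> k w _; rewrite lee_fin sumr_ge0.
    apply: eq_bigr => k _; under eq_integral do rewrite -sumEFin.
    by rewrite ge0_integral_sum// => l w _; rewrite lee_fin.
  rewrite ge0_sume_distrr; last first.
    by move=> k _; apply: sume_ge0 => l _; apply: integral_ge0 => z _; rewrite lee_fin.
  apply: eq_bigr => k _; rewrite ge0_sume_distrr// => l _.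
  by apply: integral_ge0 => z _; rewrite lee_fin.
rewrite mulrC EFinM lee_wpmul2l ?lee_fin ?invr_ge0//.
apply: le_trans fourth_moment_ge; apply: ge0_le_integral => //.
- by move=> z _; rewrite lee_fin sumr_ge0// => k _; rewrite sumr_ge0.
- under eq_fun do rewrite -sumEFin; apply: emeasurable_sum => k.
  by under eq_fun do rewrite -sumEFin; apply: emeasurable_sum.
- exact/measurable_EFinP.
move=> z _; rewrite lee_fin.
pose a := \sum_(k < N) z.1 k ^+ 2; pose b := \sum_(k < N) z.2 k ^+ 2.
have a0 : 0 <= a by apply: sumr_ge0 => k _; exact: sqr_ge0.
have b0 : 0 <= b by apply: sumr_ge0 => k _; exact: sqr_ge0.
have -> : \sum_(k < N) \sum_(l < N) s k l z = a * a + b * b + a * b.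
  rewrite /a /b !mulr_suml -!big_split/=; apply: eq_bigr => k _.
  rewrite !mulr_sumr -!big_split/=; apply: eq_bigr => l _.
  by rewrite /s !exprMn.
have ab := krein_norm_sqr_ge z N; rewrite -/a -/b in ab.
have -> : `|z| ^+ 4 = (`|z| ^+ 2) ^+ 2 by rewrite -exprM.
apply: (@le_trans _ _ ((a + b) ^+ 2)); first by nra.
by rewrite ler_sqr ?nnegrE ?addr_ge0// exprn_ge0.
Qed.

(** One event has to serve for all truncations. The events increase with [N], so the Markov bound,
    being uniform in [N], passes to their union by continuity from below. *)
Lemma gram_deviation_tail n (eps : R) : (0 < n)%N -> 0 < eps ->
  let B := \bigcup_N [set w | fourth_moment / n%:R / eps < gram_deviation n N w] in
  measurable B /\ (P B <= eps%:E)%E.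
Proof.
move=> n0 eps0 B.
have mB N : measurable [set w | fourth_moment / n%:R / eps < gram_deviation n N w].
  rewrite -[X in measurable X]setTI.
  apply: (measurable_fun_ltr (measurable_cst _)) => //.
  exact: gram_deviation_measurable.
have mBU : measurable B by exact: bigcupT_measurable.
split => //.
have := @nondecreasing_cvg_mu _ _ _ P _ mB mBU.
move=> /(_ _)/cvg_lim <-//; last first.
  move=> N M NM; apply/subsetPset => w /= h.
  by apply: (lt_le_trans h); exact: gram_deviation_nondecreasing.
apply: lime_le.
  apply: ereal_nondecreasing_is_cvgn => N M NM; apply: le_measure; rewrite ?mem_set//.
  by move=> w /= h; apply: (lt_le_trans h); exact: gram_deviation_nondecreasing.
apply: nearW => N /=; apply: markov_tail => //.
- by rewrite divr_gt0 ?fourth_moment_gt0// ltr0n.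
- exact: gram_deviation_measurable.
- by move=> w; exact: gram_deviation_ge0.
- exact: gram_deviation_expectation.
Qed.

Lemma fourth_moment_tail n (eps : R) : (0 < n)%N -> 0 < eps ->
  let B := [set w | fourth_moment / eps < n%:R^-1 * \sum_(i < n) `|Z i w| ^+ 4] in
  measurable B /\ (P B <= eps%:E)%E.
Proof.
move=> n0 eps0 B.
have mZ (i : nat) : measurable_fun setT (fun w => `|Z i w| ^+ 4).
  exact: (measurableT_comp mnorm4).
have mf : measurable_fun setT (fun w => n%:R^-1 * \sum_(i < n) `|Z i w| ^+ 4).
  by apply: measurable_funM => //; exact: measurable_sum.
split.
  by rewrite -[X in measurable X]setTI; exact: (measurable_fun_ltr (measurable_cst _)).
apply: markov_tail => //; first exact: fourth_moment_gt0.
  by move=> w; rewrite mulr_ge0// sumr_ge0// => i _; rewrite exprn_ge0.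
have -> : (\int[P]_w (n%:R^-1 * \sum_(i < n) `|Z i w| ^+ 4)%:E =
    (n%:R^-1)%:E * \sum_(i < n) \int[P]_w (`|Z i w| ^+ 4)%:E)%E.
  rewrite -(@ge0_integral_sum _ _ _ P _ measurableT 'I_n
    (fun i w => (`|Z i w| ^+ 4)%:E)); last first.
  - by move=> i w _; rewrite lee_fin exprn_ge0.
  - by move=> i; exact/measurable_EFinP.
  have mS : measurable_fun setT (fun w => \sum_(i < n) (`|Z i w| ^+ 4)%:E)%E.
    by apply: emeasurable_sum => i; exact/measurable_EFinP.
  rewrite -(ge0_integralZl P measurableT mS) ?lee_fin ?invr_ge0//; last first.
    by move=> w _; apply: sume_ge0 => i _; rewrite lee_fin exprn_ge0.
  by apply: eq_integral => w _; rewrite sumEFin -EFinM.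
apply: (@le_trans _ _ ((n%:R^-1)%:E * \sum_(i < n) fourth_moment%:E)%E).
  rewrite lee_wpmul2l ?lee_fin ?invr_ge0//; apply: lee_sum => i _.
  rewrite (iid_ge0_integral ZF i (f := fun z => (`|z| ^+ 4)%:E)).
  - exact: fourth_moment_ge.
  - exact/measurable_EFinP.
  - by move=> z; rewrite lee_fin exprn_ge0.
rewrite sumEFin sumr_const card_ord -EFinM lee_fin -(mulr_natl fourth_moment).
by rewrite mulrA mulVf ?mul1r// pnatr_eq0 -lt0n.
Qed.

End moment_tails.

(** * Exponential moments of the noise matrix *)

Import HBNNSimple.

(* The hypothesis says that [f] is a version of the conditional probability of
   [B] on [E] given [h]; testing it on the level sets of simple functions of [h]
   suffices. *)
Lemma integral_conditional_probability {R : realType} {d : measure_display}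
    {T : measurableType d} (P : probability T R) (E B : set T) (h f : T -> R) :
  measurable E -> measurable B -> measurable_fun setT h ->
  measurable_fun setT f -> (forall w, 0 <= h w) -> (forall w, E w -> 0 <= f w) ->
  (forall S : set R, measurable S ->
     P (E `&` h @^-1` S `&` B) = \int[P]_(w in E `&` h @^-1` S) (f w)%:E)%E ->
  (\int[P]_(w in E `&` B) (h w)%:E = \int[P]_(w in E) (h w * f w)%:E)%E.
Proof.
move=> mE mB mh mf h0 f0 hP.
have mEB : measurable (E `&` B) by exact: measurableI.
have mpre S : measurable S -> measurable (h @^-1` S).
  by move=> mS; rewrite -[X in measurable X]setTI; exact: mh.
(* The approximation by simple functions needs a nonnegative function on all of [R]; [pos] agrees
   with the identity on the values of [h]. *)
pose pos (r : R) := (Num.max r 0)%:E.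
have mpos : measurable_fun setT pos.
  by apply/measurable_EFinP; apply: measurable_maxr => //.
pose phi k := nnsfun_approx measurableT mpos k.
have simple (g : {nnsfun R >-> R}) : (\int[P]_(w in E `&` B) (g (h w))%:E =
    \int[P]_(w in E) (g (h w) * f w)%:E)%E.
  have gE w : g (h w) = \sum_(y \in range g) y * \1_(g @^-1` [set y]) (h w).
    exact: fimfunE.
  have mind y D : measurable_fun D (fun w => \1_(g @^-1` [set y]) (h w) : R).
    apply: (measurable_funS measurableT (@subsetT _ _)).
    by apply: measurableT_comp mh; exact: measurable_indic.
  have y0 y r : 0 <= y * \1_(g @^-1` [set y]) r :> R.
    rewrite indicE; have [/set_mem/= <-|_] := boolP (r \in g @^-1` [set y]).
      by rewrite mulr1.
    by rewrite mulr0.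
  transitivity (\sum_(y \in range g)
      \int[P]_(w in E `&` B) (y * \1_(g @^-1` [set y]) (h w))%:E)%E.
    rewrite -ge0_integral_fsum//.
    - by apply: eq_integral => w _; rewrite gE -fsumEFin.
    - by move=> y; apply/measurable_EFinP; exact: measurable_funM.
    - by move=> y w _; rewrite lee_fin.
  transitivity (\sum_(y \in range g)
      \int[P]_(w in E) (y * \1_(g @^-1` [set y]) (h w) * f w)%:E)%E; last first.
    rewrite -ge0_integral_fsum//.
    - apply: eq_integral => w _; rewrite gE fsumEFin//; congr (_%:E).
      rewrite !fsbig_finite//= mulr_suml.
      by [].
    - move=> y; apply/measurable_EFinP; apply: measurable_funM.
        exact: measurable_funM.
      exact: measurable_funS mf.
    - by move=> y w Ew; rewrite lee_fin mulr_ge0// f0.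
  apply: eq_fsbigr => y /set_mem -[r _ ry].
  have yge0 : 0 <= y by rewrite -ry.
  pose S := g @^-1` [set y].
  have mS : measurable S by rewrite -[X in measurable X]setTI; exact: measurable_funP.
  under eq_integral do rewrite EFinM.
  rewrite ge0_integralZl//; [|exact/measurable_EFinP].
  under [RHS]eq_integral do rewrite -mulrA EFinM.
  rewrite ge0_integralZl//; last 2 first.
  - apply/measurable_EFinP; apply: measurable_funM => //.
    exact: measurable_funS mf.
  - by move=> w Ew; rewrite lee_fin mulr_ge0// f0.
  congr (_ * _)%E.
  transitivity (P (h @^-1` S `&` (E `&` B))).
    by rewrite -(@integral_indic _ _ _ P _ mEB (h @^-1` S) (mpre _ mS)).
  rewrite setIA (setIC _ E) hP// integral_mkcondr.
  apply: eq_integral => w _; rewrite /patch indicE.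
  have -> : (w \in h @^-1` S) = (h w \in S) by [].
  by case: ifPn; rewrite ?mul1r ?mul0r.
have phi_cvg w : (phi k (h w))%:E @[k --> \oo] --> (h w)%:E.
  have -> : (h w)%:E = pos (h w) by rewrite /pos max_l.
  by apply: cvg_nnsfun_approx => // r _; rewrite lee_fin le_max lexx orbT.
have phi_nd r k l : (k <= l)%N -> phi k r <= phi l r.
  by move=> kl; exact/lefP/nd_nnsfun_approx.
transitivity (limn (fun k => \int[P]_(w in E `&` B) (phi k (h w))%:E))%E.
  rewrite -monotone_convergence//.
  - by apply: eq_integral => w _; apply/esym/cvg_lim.
  - move=> k; apply/measurable_EFinP.
    apply: (measurable_funS measurableT (@subsetT _ _)).
    by apply: measurableT_comp mh; exact: measurable_funP.
  - by move=> k w _; rewrite lee_fin.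
  - by move=> w _ k l kl; rewrite lee_fin; exact: phi_nd.
under eq_fun do rewrite simple.
rewrite -monotone_convergence//.
- apply: eq_integral => w _; apply/cvg_lim => //.
  rewrite EFinM; under eq_fun do rewrite EFinM.
  by apply: cvgeZr; [|exact: phi_cvg].
- move=> k; apply/measurable_EFinP.
  apply: (measurable_funS measurableT (@subsetT _ _)).
  apply: measurable_funM => //.
  by apply: measurableT_comp mh; exact: measurable_funP.
- by move=> k w Ew; rewrite lee_fin mulr_ge0// f0.
- move=> w Ew k l kl; rewrite lee_fin ler_wpM2r//; first exact: f0.
  exact: phi_nd.
Qed.

(** For [x > 1 / 2] one has [x <= 2 * x^2]. Otherwise [expR x * (1 - x) <= 1], while [(1 + x + 2 *
    x^2) * (1 - x) = 1 + x^2 * (1 - 2 * x)] is at least 1. The linear term is kept apart because it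
    cancels in the mean of a centered variable. *)
Lemma expR_le_addx (R : realType) (x : R) : expR x <= x + expR (2 * x ^+ 2).
Proof.
have e1 := expR_ge1Dx (2 * x ^+ 2).
have [x2|x2] := leP x (1 / 2); last first.
  have : expR x <= expR (2 * x ^+ 2) by rewrite ler_expR; nra.
  lra.
suff : expR x <= 1 + x + 2 * x ^+ 2 by lra.
have := expR_ge1Dx (- x); have := expRN x; have := expR_gt0 x.
move: (expR x) => t t0 -> h.
have : t * (1 - x) <= 1 by rewrite -(ler_pdivlMl _ _ t0) mulr1.
have : 1 <= (1 + x + 2 * x ^+ 2) * (1 - x) by nra.
move=> h1 h2; rewrite -(@ler_pM2r _ (1 - x)); lra.
Qed.

(** A sub-Gaussian bound: [expR_le_addx] at both values, whose linear terms average to zero and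
    whose deviations from [q] are at most 1 in absolute value. *)
Lemma bernoulli_mgf (R : realType) (q c : R) : 0 <= q <= 1 ->
  \sum_(b : bool) expR (c * (b%:R - q)) * bernoulli_pmf q b <= expR (2 * c ^+ 2).
Proof.
case/andP=> q0 q1; rewrite big_bool/= /bernoulli_pmf/=.
have h t : t ^+ 2 <= 1 -> expR (c * t) <= c * t + expR (2 * c ^+ 2).
  move=> t1; apply: (le_trans (expR_le_addx _)); rewrite lerD2l ler_expR.
  by rewrite exprMn ler_pM2l// ler_piMr// sqr_ge0.
have h1 : expR (c * (1 - q)) <= c * (1 - q) + expR (2 * c ^+ 2).
  by apply: h; nra.
have h2 : expR (c * (0 - q)) <= c * (0 - q) + expR (2 * c ^+ 2).
  by apply: h; nra.
move: h1 h2; move: (expR (c * (1 - q))) (expR (c * (0 - q))) (expR (2 * c ^+ 2)).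
move=> u v e h1 h2; nra.
Qed.

Lemma prod_ordered_pairs (R : comPzRingType) n (f : nat -> nat -> R) :
  \prod_(j < n) \prod_(i < j) f i j =
  \prod_(p : 'I_n * 'I_n | (p.1 < p.2)%N) f p.1 p.2.
Proof.
rewrite -(pair_big_dep xpredT (fun i j : 'I_n => (i < j)%N)
  (fun i j => f i j))/=.
rewrite (exchange_big_dep xpredT)//=; apply: eq_bigr => j _.
by rewrite (big_ord_widen _ (f ^~ j) (ltnW (ltn_ord j))).
Qed.

Section edges.
Context {R : realType} {d : measure_display} {Omega : measurableType d}
  {P : probability Omega R} {Z : nat -> {RV P >-> krein R}}
  {A : nat -> nat -> {RV P >-> bool}}.

(* The sample space with the sigma-field of the [Z i], so that being measurable
   for that sigma-field is an instance of [measurable_fun]. *)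
Let Omega' := g_sigma_algebraType
  (\bigcup_i preimage_set_system setT (Z i) measurable).

Let Z_measurable i : measurable_fun setT (Z i : Omega' -> krein R).
Proof.
by move=> _ B mB; apply: sub_sigma_algebra; exists i => //; exists B.
Qed.

(** An almost sure event outside which the values of [bernoulli_pmf] need not be probabilities; the
    exponential moments are integrated over it. *)
Definition valid_parameters n : set Omega := [set w | forall i j,
  (i < j < n)%N -> 0 <= krein_inner (Z i w) (Z j w) <= 1].

Lemma pairwise_measurable d' (T : measurableType d') n (B : nat -> nat -> set T) :
  (forall i j, measurable (B i j)) ->
  measurable [set w | forall i j, (i < j < n)%N -> B i j w].
Proof.
move=> mB.
have -> : [set w | forall i j, (i < j < n)%N -> B i j w] =
    \bigcap_i \bigcap_j (if (i < j < n)%N then B i j else setT).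
  apply/seteqP; split => w /=.
    by move=> h i _ j _; case: ifP => // /h.
  by move=> h i j ij; have := h i I j I; rewrite ij.
apply: bigcapT_measurable => i; apply: bigcapT_measurable => j.
by case: ifP.
Qed.

(** Stated for an arbitrary measurable space because it is applied twice, to the given sigma-field
    on [Omega] and to the one generated by the [Z i]. *)
Let valid_measurable_gen d' (T : measurableType d') (z : nat -> T -> krein R) n :
  (forall i, measurable_fun setT (z i)) ->
  measurable [set w | forall i j,
    (i < j < n)%N -> 0 <= krein_inner (z i w) (z j w) <= 1].
Proof.
move=> mz; apply: (@pairwise_measurable _ _ n (fun i j =>
  [set w | 0 <= krein_inner (z i w) (z j w) <= 1])) => i j.
have -> : [set w | 0 <= krein_inner (z i w) (z j w) <= 1] =
    (fun w => krein_inner (z i w) (z j w)) @^-1` `[0, 1].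
  by apply/seteqP; split => w /=; rewrite in_itv.
rewrite -[X in measurable X]setTI.
by apply: (krein_inner_measurable (mz i) (mz j)) => //; exact: measurable_itv.
Qed.

Lemma valid_parameters_measurable n : measurable (valid_parameters n).
Proof. by apply: valid_measurable_gen => i; exact: measurable_funP. Qed.

Lemma valid_parameters_prob (F : probability (krein R) R) n :
  graph_root_distribution F -> iid_from F Z ->
  (P (~` valid_parameters n) = 0)%E.
Proof.
move=> grd ZF.
have mv := valid_parameters_measurable n.
apply/(negligibleP P (measurableC mv)).
pose B i j : set Omega := if (i < j < n)%N then
  [set w | ~ (0 <= krein_inner (Z i w) (Z j w) <= 1)] else set0.
have sub : ~` valid_parameters n `<=` \bigcup_i \bigcup_j B i j.
  move=> w /=; rewrite -existsNE => -[i]; rewrite -existsNE => -[j].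
  rewrite not_implyE => -[ij h]; exists i => //; exists j => //.
  by rewrite /B ij.
apply: (negligibleS sub); apply: negligible_bigcup => i.
apply: negligible_bigcup => j; rewrite /B; case: ifPn => [/andP[ij _]|_]; last first.
  exact: negligible_set0.
pose G := [set z : krein R * krein R | 0 <= krein_inner z.1 z.2 <= 1].
have mG : measurable G.
  have -> : G = (fun z => krein_inner z.1 z.2) @^-1` `[0, 1].
    by apply/seteqP; split => w /=; rewrite in_itv.
  rewrite -[X in measurable X]setTI.
  by apply: krein_inner_measurable => //; exact: measurable_itv.
have nij : i != j by rewrite neq_ltn ij.
have mp : measurable [set w | G (Z i w, Z j w)].
  rewrite -[X in measurable X]setTI.
  have mZZ : measurable_fun setT (fun w => (Z i w, Z j w)).
    by apply: measurable_fun_pair; exact: measurable_funP.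
  exact: mZZ.
exists (~` [set w | G (Z i w, Z j w)]); split => //.
  exact: measurableC.
transitivity (1 - P [set w | G (Z i w, Z j w)])%E.
  exact: probability_setC.
by rewrite (iid_pair_law ZF nij)// [X in (_ - X)%E]grd subee.
Qed.

Let ordered n : pred ('I_n * 'I_n) := fun p => (p.1 < p.2)%N.

(** Edge configurations are finite functions, so that they can be summed over, whereas
    [conditionally_bernoulli] takes functions on [nat]; [false] is the default outside the range. *)
Let anat n (a : {ffun 'I_n * 'I_n -> bool}) (i j : nat) : bool :=
  oapp (fun i' => oapp (fun j' => a (i', j')) false (insub j)) false (insub i).

Let anatE n (a : {ffun 'I_n * 'I_n -> bool}) (p : 'I_n * 'I_n) :
  anat a p.1 p.2 = a p.
Proof. by rewrite /anat !valK; case: p. Qed.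

Definition edge_exponent n (c : 'I_n * 'I_n -> R) w : R :=
  \sum_(p : 'I_n * 'I_n | (p.1 < p.2)%N)
    c p * ((A p.1 p.2 w)%:R - krein_inner (Z p.1 w) (Z p.2 w)).

Lemma edge_exponent_measurable n (c : 'I_n * 'I_n -> R) :
  measurable_fun setT (edge_exponent c).
Proof.
rewrite /edge_exponent; under eq_fun do rewrite big_mkcond/=.
apply: measurable_sum => p; case: (_ < _)%N; last exact: measurable_cst.
apply: measurable_funM; first exact: measurable_cst.
apply: measurable_funB; last by apply: krein_inner_measurable; exact: measurable_funP.
apply: (measurableT_comp (f := fun b : bool => (b%:R : R))) => //.
Qed.

(** Split according to the edge configuration [a]. On each piece the exponential is a function of
    the [Z i] alone, so the indicator of the piece may be replaced by the product of Bernoulli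
    masses. The sum over [a] then factorizes into a product over pairs, and [bernoulli_mgf] bounds
    each factor. *)
Lemma edge_mgf (CB : conditionally_bernoulli Z A) n (c : 'I_n * 'I_n -> R) :
  (\int[P]_(w in valid_parameters n) (expR (edge_exponent c w))%:E <=
   (expR (2 * \sum_(p : 'I_n * 'I_n | (p.1 < p.2)%N) c p ^+ 2))%:E)%E.
Proof.
pose V := valid_parameters n.
have mV : measurable V by exact: valid_parameters_measurable.
pose K (p : 'I_n * 'I_n) w := krein_inner (Z p.1 w) (Z p.2 w).
have KV p w : V w -> ordered p -> 0 <= K p w <= 1.
  by move=> Vw op; apply: Vw; rewrite (op : (p.1 < p.2)%N) ltn_ord.
pose h (a : {ffun 'I_n * 'I_n -> bool}) w :=
  expR (\sum_(p | ordered p) c p * ((a p)%:R - K p w)).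
pose f (a : {ffun 'I_n * 'I_n -> bool}) w :=
  \prod_(p | ordered p) bernoulli_pmf (K p w) (a p).
pose B (a : {ffun 'I_n * 'I_n -> bool}) : set Omega :=
  [set w | forall i j, (i < j < n)%N -> A i j w = anat a i j].
have mB a : measurable (B a).
  apply: (@pairwise_measurable _ _ n (fun i j => [set w | A i j w = anat a i j])).
  move=> i j; rewrite -[X in measurable X]setTI.
  have mA : measurable_fun setT (A i j) by exact: measurable_funP.
  exact: (mA measurableT [set anat a i j]).
(* The sigma-field is left general: membership of the level sets of [h a] in the sigma-field of the
   [Z i] is an instance. *)
have hgen d' (T : measurableType d') (z : nat -> T -> krein R)
      (a : {ffun 'I_n * 'I_n -> bool}) :
    (forall i, measurable_fun setT (z i)) -> measurable_fun setT
      (fun w => expR (\sum_(p | ordered p)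
        c p * ((a p)%:R - krein_inner (z p.1 w) (z p.2 w)))).
  move=> mz; suff : measurable_fun setT (fun w => \sum_(p | ordered p)
      c p * ((a p)%:R - krein_inner (z p.1 w) (z p.2 w))).
    exact: (measurableT_comp (@measurable_expR R)).
  under eq_fun do rewrite big_mkcond/=.
  apply: measurable_sum => p; case: (ordered p); last exact: measurable_cst.
  apply: measurable_funM; first exact: measurable_cst.
  by apply: measurable_funB; [exact: measurable_cst|exact: krein_inner_measurable].
have mK p : measurable_fun setT (K p).
  by apply: krein_inner_measurable; exact: measurable_funP.
have mh a : measurable_fun setT (h a).
  by apply: (hgen _ _ (fun i => Z i)) => i; exact: measurable_funP.
have mf a : measurable_fun setT (f a).
  rewrite /f; under eq_fun do rewrite big_mkcond/=.
  apply: measurable_prod => p _; case: (ordered p); last exact: measurable_cst.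
  exact: (measurableT_comp (@measurable_bernoulli_pmf R setT (a p)) (mK p)).
have f0 a w : V w -> 0 <= f a w.
  by move=> Vw; apply: prodr_ge0 => p op; exact/bernoulli_pmf_ge0/KV.
have h0 a w : 0 <= h a w by exact: expR_ge0.
have key a : (\int[P]_(w in V `&` B a) (h a w)%:E =
    \int[P]_(w in V) (h a w * f a w)%:E)%E.
  apply: integral_conditional_probability => // [w Vw|S mS]; first exact: f0.
  have gE : generated_events Z (V `&` h a @^-1` S).
    rewrite /generated_events -/(@measurable _ Omega').
    apply: (@measurableI _ Omega').
      exact: (@valid_measurable_gen _ Omega').
    have := @hgen _ Omega' (fun i => Z i) a Z_measurable measurableT S mS.
    by rewrite setTI.
  rewrite (CB n (anat a) _ gE); apply: eq_integral => w _; congr _%:E.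
  rewrite (prod_ordered_pairs n (fun i j =>
    bernoulli_pmf (krein_inner (Z i w) (Z j w)) (anat a i j))).
  by apply: eq_bigr => p _; rewrite anatE.
(* These configurations are [false] off the ordered pairs, so every edge pattern is listed once and
   the sum over them distributes into a product over ordered pairs. *)
pose s := enum (pfamily false (@ordered n) (fun=> xpredT)).
have mi a : measurable_fun V (fun w => (h a w * \1_(B a) w)%:E).
  apply/measurable_EFinP; apply: (measurable_funS measurableT (@subsetT _ _)).
  by apply: measurable_funM => //; exact: measurable_indic.
have i0 a w : 0 <= h a w * \1_(B a) w by rewrite mulr_ge0// indicE.
(* The term of the configuration that actually occurs equals the exponential, and the other terms
   are nonnegative. *)
apply: (@le_trans _ _ (\int[P]_(w in V)
    (\sum_(a <- s) (h a w * \1_(B a) w)%:E)))%E.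
  apply: ge0_le_integral => //.
  - apply/measurable_EFinP; apply: (measurable_funS measurableT (@subsetT _ _)).
    exact: (measurableT_comp (@measurable_expR R) (edge_exponent_measurable c)).
  - exact: emeasurable_sum.
  move=> w Vw; rewrite sumEFin lee_fin big_enum/=.
  pose aw : {ffun 'I_n * 'I_n -> bool} :=
    [ffun p => if ordered p then A p.1 p.2 w else false].
  have awfam : aw \in pfamily false (@ordered n) (fun=> xpredT).
    apply/pfamilyP; split => //; apply/finfun.supportP => p.
    by rewrite ffunE; case: ifP => // op /negP[]; exact: op.
  have awB : B aw w.
    move=> i j /andP[ij jn]; have i_n := ltn_trans ij jn.
    rewrite -[i]/(nat_of_ord (Ordinal i_n)) -[j]/(nat_of_ord (Ordinal jn)).
    by rewrite (anatE aw (Ordinal i_n, Ordinal jn)) ffunE /ordered/= ij.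
  rewrite (bigD1 aw)//= indicE mem_set// mulr1 ler_wpDr//.
    by apply: sumr_ge0 => a _; exact: i0.
  rewrite /h /edge_exponent le_eqVlt; apply/orP; left; apply/eqP; congr expR.
  by apply: eq_bigr => p op; rewrite ffunE ifT.
rewrite ge0_integral_sum//; last by move=> a w _; rewrite lee_fin i0.
have mhf a : measurable_fun V (fun w => (h a w * f a w)%:E).
  apply/measurable_EFinP; apply: (measurable_funS measurableT (@subsetT _ _)).
  exact: measurable_funM.
have -> : (\sum_(a <- s) \int[P]_(w in V) (h a w * \1_(B a) w)%:E =
    \int[P]_(w in V) (\sum_(a <- s) (h a w * f a w)%:E))%E.
  rewrite ge0_integral_sum//; last first.
    by move=> a w Vw; rewrite lee_fin mulr_ge0// f0.
  apply: eq_bigr => a _; rewrite -key integral_mkcondr.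
  apply: eq_integral => w _; rewrite /patch indicE.
  by case: ifPn; rewrite ?mulr1 ?mulr0.
apply: (@le_trans _ _ (\int[P]_(w in V)
    (expR (2 * \sum_(p : 'I_n * 'I_n | ordered p) c p ^+ 2))%:E))%E.
  apply: ge0_le_integral => //.
  - by move=> w Vw; rewrite sumEFin lee_fin sumr_ge0// => a _; rewrite mulr_ge0// f0.
  - exact: emeasurable_sum.
  move=> w Vw; rewrite sumEFin lee_fin big_enum/=.
  have -> : \sum_(a in pfamily false (@ordered n) (fun=> xpredT)) h a w * f a w =
      \prod_(p | ordered p) \sum_(b : bool)
        expR (c p * (b%:R - K p w)) * bernoulli_pmf (K p w) b.
    rewrite (big_distr_big_dep false); apply: eq_bigr => a _.
    by rewrite /h /f expR_sum -big_split.
  rewrite mulr_sumr expR_sum; apply: ler_prod => p op; apply/andP; split.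
    apply: sumr_ge0 => b _; rewrite mulr_ge0 ?expR_ge0//.
    exact/bernoulli_pmf_ge0/KV.
  by apply: bernoulli_mgf; exact: KV.
rewrite integral_cst// -[leRHS]mule1 lee_wpmul2l ?lee_fin ?expR_ge0//.
exact: probability_le1.
Qed.

End edges.

(** * Operator norm of the noise matrix *)

Lemma half_geometric_le2 (R : realType) N : \sum_(k < N) (1 / 2 : R) ^+ k <= 2.
Proof.
suff -> : \sum_(k < N) (1 / 2 : R) ^+ k = 2 - 2 * (1 / 2) ^+ N.
  by rewrite gerBl mulr_ge0// exprn_ge0// divr_ge0.
elim: N => [|N IH]; first by rewrite big_ord0 expr0; ring.
by rewrite big_ord_recr/= IH exprS; field.
Qed.

(* Weight a grid vector by [2 ^ (16 n - sum_i k_i)], which is at least [1] on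
   the ball and factorizes over the coordinates. *)
Lemma grid_ball_card (R : realType) n :
  \sum_(m : {ffun 'I_n -> bool * 'I_(4 * n).+1} |
     (\sum_i (m i).2 ^ 2 <= 16 * n)%N) 1 <= (2 : R) ^+ (18 * n).
Proof.
apply: (@le_trans _ _ (\sum_(m : {ffun 'I_n -> bool * 'I_(4 * n).+1})
    (2 : R) ^+ (16 * n) * \prod_i (1 / 2) ^+ (m i).2)).
  rewrite big_mkcond/=; apply: ler_sum => m _; case: ifPn => [mn|_]; last first.
    apply: mulr_ge0; first exact: exprn_ge0.
    by apply: prodr_ge0 => i _; apply: exprn_ge0; rewrite divr_ge0.
  have le : (\sum_i (m i).2 <= 16 * n)%N.
    apply: leq_trans mn; apply: leq_sum => i _.
    by rewrite -{1}(expn1 (m i).2); case: (nat_of_ord _) => // k; rewrite leq_pexp2l.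
  rewrite -(big_morph _ (exprD _) (expr0 _)) div1r exprVn.
  rewrite ler_pdivlMr ?exprn_gt0// mul1r.
  by apply: ler_weXn2l => //; rewrite ler1n.
rewrite -mulr_sumr -(bigA_distr_bigA (fun (i : 'I_n)
  (q : bool * 'I_(4 * n).+1) => (1 / 2 : R) ^+ q.2))/=.
rewrite prodr_const card_ord.
have -> : (2 : R) ^+ (18 * n) = 2 ^+ (16 * n) * 4 ^+ n.
  have -> : (4 : R) = 2 ^+ 2 by rewrite expr2 -natrM.
  by rewrite -exprM -exprD; congr (_ ^+ _); lia.
rewrite ler_pM2l ?exprn_gt0//; apply: lerXn2r; rewrite ?nnegrE//.
  by apply: sumr_ge0 => q _; rewrite exprn_ge0// divr_ge0.
(* Each coordinate contributes two signs times a geometric series of sum at most 2, whence the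
   factor 4. *)
rewrite -(pair_bigA _ (fun (b : bool) (k : 'I_(4 * n).+1) => (1 / 2 : R) ^+ k))/=.
rewrite big_bool/=.
have := half_geometric_le2 R (4 * n).+1; lra.
Qed.

(** Only the entries above the diagonal of the noise are conditionally independent, so those below
    are folded onto them. *)
Lemma dot_off_diagonal (R : realType) n (E : 'M[R]_n) (u v : 'cV[R]_n) :
  E^T = E -> (forall i, E i i = 0) ->
  dot u (E *m v) = \sum_(p : 'I_n * 'I_n | (p.1 < p.2)%N)
    (u p.1 0 * v p.2 0 + u p.2 0 * v p.1 0) * E p.1 p.2.
Proof.
move=> Es E0.
have -> : dot u (E *m v) = \sum_(p : 'I_n * 'I_n) u p.1 0 * v p.2 0 * E p.1 p.2.
  rewrite -(pair_bigA _ (fun i j => u i 0 * v j 0 * E i j))/=.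
  apply: eq_bigr => i _; rewrite mxE mulr_sumr; apply: eq_bigr => j _.
  by ring.
rewrite (bigID (fun p : 'I_n * 'I_n => (p.1 < p.2)%N))/=.
rewrite [X in _ + X](bigID (fun p : 'I_n * 'I_n => (p.2 < p.1)%N))/=.
rewrite [X in _ + (_ + X)]big1 ?addr0; last first.
  move=> [i j] /=; rewrite -!leqNgt => /andP[ji ij].
  have -> : i = j by apply/val_inj/eqP; rewrite eqn_leq ij.
  by rewrite E0 mulr0.
pose sw (p : 'I_n * 'I_n) := (p.2, p.1).
have swK : involutive sw by case.
rewrite [X in _ + X](reindex_inj (inv_inj swK))/=.
have -> : \sum_(p : 'I_n * 'I_n | ~~ (p.2 < p.1)%N && (p.1 < p.2)%N)
      u p.2 0 * v p.1 0 * E p.2 p.1 =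
    \sum_(p : 'I_n * 'I_n | (p.1 < p.2)%N) u p.2 0 * v p.1 0 * E p.1 p.2.
  apply: eq_big => [p|p _]; last by rewrite -{1}Es mxE.
  by rewrite -leqNgt; case: ltnP => h; rewrite ?andbF// andbT ltnW.
rewrite -big_split/=; apply: eq_bigr => p _; ring.
Qed.

(** The outer factor 2 is the loss of the grid argument; [2085 / 8] is rounded up to 261. *)
Lemma opnorm_constant (R : realType) (t : R) : 0 < t ->
  0 <= 2 * (2085 / 16 * t) <= 261 * t.
Proof. by move=> t0; apply/andP; split; lra. Qed.

Section operator_norm.
Context {R : realType} {F : probability (krein R) R} {d : measure_display}
  {Omega : measurableType d} {P : probability Omega R}
  {Z : nat -> {RV P >-> krein R}} {A : nat -> nat -> {RV P >-> bool}}.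
Context (grd : graph_root_distribution F) (ZF : iid_from F Z)
  (ZA : random_graph Z A).

(** The diagonal is set to zero to keep only centered edge variables; the diagonal of the Gram
    matrix is accounted for separately. *)
Definition centered_adjacency n w : 'M[R]_n := \matrix_(i, j)
  if i == j then 0 else (A i j w)%:R - krein_inner (Z i w) (Z j w).

Lemma krein_innerC (z z' : krein R) : krein_inner z z' = krein_inner z' z.
Proof. by rewrite /krein_inner !(ell2_innerC z.1) !(ell2_innerC z.2). Qed.

Lemma centered_adjacency_sym n w :
  (centered_adjacency n w)^T = centered_adjacency n w.
Proof.
apply/matrixP => i j; rewrite !mxE eq_sym; case: ifP => // _.
by case: ZA => _ -> _; rewrite krein_innerC.
Qed.

(** The union bound is carried out in integrated form: the sum of the exponentials over all pairs of
    short grid vectors has a bounded integral, and one application of Markov's inequality controls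
    all pairs at once. *)
Lemma centered_adjacency_opnorm_tail n : (0 < n)%N ->
  exists N : set Omega, [/\ measurable N, (P N <= (expR (- n%:R))%:E)%E &
    forall w, ~ N w -> forall v,
      dot (centered_adjacency n w *m v) (centered_adjacency n w *m v) <=
      (261 * Num.sqrt n%:R) ^+ 2 * dot v v].
Proof.
move=> n0; have [CB _ _] := ZA.
pose V := valid_parameters (Z := Z) n.
have mV : measurable V by exact: valid_parameters_measurable.
pose M := {ffun 'I_n -> bool * 'I_(4 * n).+1}.
pose small (m : M) := (\sum_i (m i).2 ^ 2 <= 16 * n)%N.
(* Unscaled, the sum of squared coefficients is of order [n^2] and the desired bound on the bilinear
   form of order [n^(3/2)]. The factor [n^(-1/2)] brings both to order [n], the order of the
   logarithm of the number of grid vectors. *)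
pose s : R := (Num.sqrt n%:R)^-1.
have n_gt0 : 0 < n%:R :> R by rewrite ltr0n.
have s_gt0 : 0 < s by rewrite invr_gt0 sqrtr_gt0.
have s2 : s ^+ 2 = n%:R^-1 by rewrite exprVn sqr_sqrtr// ltW.
pose c (q : M * M) (p : 'I_n * 'I_n) : R :=
  s * (@grid_coord R n q.1 p.1 * @grid_coord R n q.2 p.2 +
       @grid_coord R n q.1 p.2 * @grid_coord R n q.2 p.1).
have cE q w : edge_exponent (Z := Z) (A := A) (c q) w =
    s * dot (@grid_vec R n q.1) (centered_adjacency n w *m @grid_vec R n q.2).
  rewrite dot_off_diagonal; last 2 first.
  - exact: centered_adjacency_sym.
  - by move=> i; rewrite mxE eqxx.
  rewrite mulr_sumr; apply: eq_bigr => p p12; rewrite !mxE /c -mulrA.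
  have -> : (p.1 == p.2) = false by apply: contraTF p12 => /eqP ->; rewrite ltnn.
  by [].
(* Here [c q p ^ 2] is at most [2 * s^2] times the two squared products, each of which sums to at
   most [(16 * n)^2]; this is [1024 * n], doubled by the factor 2 in [edge_mgf]. *)
have c2 q : small q.1 -> small q.2 ->
    2 * \sum_(p : 'I_n * 'I_n | (p.1 < p.2)%N) c q p ^+ 2 <= 2048 * n%:R.
  move=> q1 q2.
  pose a (m : M) := \sum_i @grid_coord R n m i ^+ 2.
  have aS m : small m -> a m <= 16 * n%:R.
    move=> sm; rewrite /a; under eq_bigr do rewrite grid_coord_sqr.
    by rewrite -natr_sum -natrM ler_nat.
  have a0 m : 0 <= a m by apply: sumr_ge0 => i _; exact: sqr_ge0.
  have aa : \sum_(p : 'I_n * 'I_n) @grid_coord R n q.1 p.1 ^+ 2 *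
      @grid_coord R n q.2 p.2 ^+ 2 = a q.1 * a q.2.
    rewrite /a mulr_suml -(pair_bigA _ (fun i j =>
      @grid_coord R n q.1 i ^+ 2 * @grid_coord R n q.2 j ^+ 2))/=.
    by apply: eq_bigr => i _; rewrite mulr_sumr.
  have aa' : \sum_(p : 'I_n * 'I_n) @grid_coord R n q.1 p.2 ^+ 2 *
      @grid_coord R n q.2 p.1 ^+ 2 = a q.1 * a q.2.
    rewrite -(pair_bigA _ (fun i j =>
      @grid_coord R n q.1 j ^+ 2 * @grid_coord R n q.2 i ^+ 2))/=.
    rewrite exchange_big/= /a mulr_suml.
    by apply: eq_bigr => i _; rewrite mulr_sumr.
  have : \sum_(p : 'I_n * 'I_n | (p.1 < p.2)%N) c q p ^+ 2 <=
      \sum_(p : 'I_n * 'I_n) (2 * s ^+ 2) *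
       (@grid_coord R n q.1 p.1 ^+ 2 * @grid_coord R n q.2 p.2 ^+ 2 +
        @grid_coord R n q.1 p.2 ^+ 2 * @grid_coord R n q.2 p.1 ^+ 2).
    rewrite big_mkcond/=; apply: ler_sum => p _; rewrite /c exprMn (mulrC 2).
    have s20 : 0 <= s ^+ 2 := sqr_ge0 s.
    case: ifP => _; last first.
      apply: mulr_ge0; first exact: mulr_ge0.
      by apply: addr_ge0; apply: mulr_ge0; exact: sqr_ge0.
    rewrite -(mulrA (s ^+ 2) 2) ler_wpM2l// -!exprMn.
    move: (_ * _) (_ * _) => x y; have := sqr_ge0 (x - y); lra.
  rewrite -mulr_sumr big_split/= aa aa' s2 => h.
  have h1 : a q.1 * a q.2 <= (16 * n%:R) * (16 * n%:R) by apply: ler_pM; rewrite ?aS.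
  have h2 : 2 * n%:R^-1 * (a q.1 * a q.2 + a q.1 * a q.2) <= 2 * n%:R^-1 *
      (16 * n%:R * (16 * n%:R) + 16 * n%:R * (16 * n%:R)).
    by rewrite ler_pM2l ?mulr_gt0 ?invr_gt0// lerD.
  have e : 2 * n%:R^-1 * (16 * n%:R * (16 * n%:R) + 16 * n%:R * (16 * n%:R)) =
      1024 * n%:R :> R by field; rewrite gt_eqF.
  rewrite e in h2; have -> : 2048 * n%:R = 2 * (1024 * n%:R) :> R by ring.
  by rewrite ler_pM2l//; exact: le_trans h2.
(* The exponential moments at [s = n ^ (-1/2)] are at most [expR (2048 n)], and
   there are at most [expR (18 n) ^ 2] pairs of grid vectors. *)
pose g w (q : M * M) := expR (edge_exponent (Z := Z) (A := A) (c q) w).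
pose S w := \sum_(q : M * M | small q.1 && small q.2) g w q.
have mg q : measurable_fun setT (g ^~ q).
  exact: (measurableT_comp (@measurable_expR R) (edge_exponent_measurable (c q))).
have mS : measurable_fun setT S.
  rewrite /S; under eq_fun do rewrite big_mkcond/=.
  by apply: measurable_sum => q; case: (_ && _).
have g0 w q : 0 <= g w q by exact: expR_ge0.
have S0 w : 0 <= S w by apply: sumr_ge0.
pose f w := S w * \1_V w.
have mf : measurable_fun setT f.
  by apply: measurable_funM => //; exact: measurable_indic.
have f0 w : 0 <= f w by rewrite mulr_ge0// indicE.
have fint : (\int[P]_w (f w)%:E <= (expR (2084 * n%:R))%:E)%E.
  have -> : (\int[P]_w (f w)%:E = \int[P]_(w in V) (S w)%:E)%E.
    rewrite [RHS]integral_mkcond; apply: eq_integral => w _.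
    by rewrite /f /patch indicE; case: ifPn; rewrite ?mulr1 ?mulr0.
  pose r := enum [pred q : M * M | small q.1 && small q.2].
  have -> : (\int[P]_(w in V) (S w)%:E =
      \int[P]_(w in V) (\sum_(q <- r) (g w q)%:E))%E.
    by apply: eq_integral => w _; rewrite sumEFin big_enum.
  have mgV q : measurable_fun V (fun w => (g w q)%:E).
    by apply/measurable_EFinP; exact: (measurable_funS measurableT (@subsetT _ _)).
  rewrite ge0_integral_sum//; last by move=> q w _; rewrite lee_fin.
  apply: (@le_trans _ _ (\sum_(q <- r) (expR (2048 * n%:R))%:E))%E.
    rewrite !big_enum; apply: lee_sum => q /= /andP[q1 q2].
    apply: (le_trans (edge_mgf CB (c q))).
    by rewrite lee_fin ler_expR; exact: c2.
  rewrite sumEFin lee_fin big_enum/=.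
  under eq_bigr do rewrite -[expR _]mul1r; rewrite -mulr_suml.
  have -> : \sum_(q : M * M | small q.1 && small q.2) 1 =
      (\sum_(m : M | small m) 1) * (\sum_(m : M | small m) 1) :> R.
    rewrite mulr_suml -(pair_big small small (fun _ _ : M => 1)).
    by apply: eq_bigr => m _; rewrite mul1r.
  have card1 : \sum_(m : M | small m) 1 <= expR (18 * n%:R) :> R.
    apply: (le_trans (grid_ball_card R n)).
    have -> : expR (18 * n%:R) = expR 1 ^+ (18 * n) :> R.
      by rewrite -expRM_natl natrM mulr1.
    apply: lerXn2r; rewrite ?nnegrE ?expR_ge0//.
    by have := @expR_ge1Dx R 1.
  have card0 : 0 <= \sum_(m : M | small m) 1 :> R by apply: sumr_ge0.
  have -> : expR (2084 * n%:R) = expR (18 * n%:R) * expR (18 * n%:R) *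
      expR (2048 * n%:R) :> R.
    by rewrite -!expRD; congr expR; ring.
  by rewrite ler_pM2r ?expR_gt0// ler_pM.
(* Markov's inequality at probability [expR (- n)] raises the exponent from 2084 to 2085. *)
pose B := [set w | expR (2084 * n%:R) / expR (- n%:R) < f w].
have mB : measurable B.
  by rewrite -[X in measurable X]setTI; exact: (measurable_fun_ltr (measurable_cst _)).
exists (~` V `|` B); split.
- by apply: measurableU => //; exact: measurableC.
- apply: (le_trans (measureU2 _ _ _)) => //; first exact: measurableC.
  rewrite -[leRHS]add0e; apply: leeD.
    rewrite le_eqVlt; apply/orP; left; apply/eqP.
    exact: (valid_parameters_prob n grd ZF).
  exact: (@markov_tail R d Omega P f (expR (2084 * n%:R)) (expR (- n%:R))
    (expR_gt0 _) (expR_gt0 _) mf f0 fint).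
move=> w /not_orP[/contrapT Vw nB] v.
have SB : S w <= expR (2085 * n%:R).
  move: nB => /negP; rewrite -leNgt /f indicE mem_set// mulr1 => h.
  apply: (le_trans h); rewrite -expRN -expRD ler_expR opprK.
  by rewrite le_eqVlt; apply/orP; left; apply/eqP; ring.
(* Solves [b * (16 * n) = Num.sqrt n * (2085 * n)], the bound obtained after removing the scaling
   [s]. *)
pose b := 2085 / 16 * Num.sqrt n%:R : R.
have sq0 : 0 < Num.sqrt n%:R :> R by rewrite sqrtr_gt0.
have hgrid (m m' : M) : small m -> small m' ->
    dot (@grid_vec R n m) (centered_adjacency n w *m @grid_vec R n m') <=
    b * (16 * n%:R).
  move=> sm sm'.
  have : g w (m, m') <= expR (2085 * n%:R).
    apply: le_trans SB; rewrite /S (bigD1 (m, m'))/= ?sm//.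
    by rewrite lerDl sumr_ge0.
  rewrite /g ler_expR cE/= /s ler_pdivrMl// => h; apply: (le_trans h).
  by rewrite le_eqVlt; apply/orP; left; apply/eqP; rewrite /b; field.
apply: (le_trans (grid_operator_norm n0 hgrid v)); rewrite ler_wpM2r ?dot_ge0//.
have /andP[b0 b1] := opnorm_constant sq0.
by apply: lerXn2r; [exact: b0|exact: (le_trans b0 b1)|exact: b1].
Qed.

End operator_norm.

(** * Wasserstein distance of empirical measures *)

Lemma frobenius_norm_sqr (R : realType) m n (M : 'M[R]_(m, n)) :
  frobenius_norm M ^+ 2 = \sum_(i < m) \sum_(j < n) M i j ^+ 2.
Proof.
by rewrite sqr_sqrtr//; apply: sumr_ge0 => i _; apply: sumr_ge0 => j _; exact: sqr_ge0.
Qed.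

Lemma pad_seqB (R : realType) p (u v : 'rV[R]_p) k :
  pad_seq (u - v) k = pad_seq u k - pad_seq v k.
Proof. by rewrite /pad_seq; case: insubP => [j|] /=; rewrite ?mxE ?subr0. Qed.

Lemma sum_pad_seq_sqr (R : realType) p (v : 'rV[R]_p) N : (p <= N)%N ->
  \sum_(k < N) pad_seq v k ^+ 2 = \sum_(j < p) v 0 j ^+ 2.
Proof.
move=> pN; rewrite (bigID (fun k : 'I_N => k < p)%N)/= [X in _ + X]big1 ?addr0.
  rewrite -(big_ord_widen _ (fun k => pad_seq v k ^+ 2) pN).
  by apply: eq_bigr => j _; rewrite /pad_seq valK.
by move=> k kp; rewrite /pad_seq insubN// expr0n.
Qed.

Lemma krein_pad_dist (R : realType) n p1 p2 (M M' : 'M[R]_(n, p1 + p2)) i :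
  `|krein_pad (row i M) - krein_pad (row i M')| ^+ 2 <=
  \sum_j (M - M') i j ^+ 2.
Proof.
apply: (cvgn_le (N0 := maxn p1 p2) (@krein_norm_sqr_cvg _ _)) => N.
rewrite geq_max => /andP[p1N p2N].
rewrite big_split/= big_split_ord/=.
apply: lerD.
  rewrite le_eqVlt; apply/orP; left; apply/eqP.
  transitivity (\sum_(k < N) pad_seq (lsubmx (row i M) - lsubmx (row i M')) k ^+ 2).
    by apply: eq_bigr => k _; rewrite pad_seqB.
  by rewrite sum_pad_seq_sqr//; apply: eq_bigr => j _; rewrite !mxE.
rewrite le_eqVlt; apply/orP; left; apply/eqP.
transitivity (\sum_(k < N) pad_seq (rsubmx (row i M) - rsubmx (row i M')) k ^+ 2).
  by apply: eq_bigr => k _; rewrite pad_seqB.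
by rewrite sum_pad_seq_sqr//; apply: eq_bigr => j _; rewrite !mxE.
Qed.

Lemma mean_le_sqrt (R : realType) n (f : 'I_n -> R) : (0 < n)%N ->
  n%:R^-1 * \sum_i f i <= Num.sqrt (n%:R^-1 * \sum_i f i ^+ 2).
Proof.
move=> n0; have nR : 0 < n%:R :> R by rewrite ltr0n.
apply: (le_trans (ler_norm _)); rewrite -sqrtr_sqr ler_wsqrtr// exprMn.
have := sum_cauchy_schwarz (index_enum 'I_n) xpredT f (fun=> 1).
under [in leLHS]eq_bigr do rewrite mulr1.
rewrite [X in _ * X](eq_bigr (fun=> 1)); last by move=> i _; rewrite expr1n.
rewrite sumr_const card_ord => h.
apply: (@le_trans _ _ (n%:R^-1 ^+ 2 * ((\sum_i f i ^+ 2) * n%:R))).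
  by rewrite ler_wpM2l// sqr_ge0.
by rewrite le_eqVlt; apply/orP; left; apply/eqP; field; rewrite gt_eqF.
Qed.

Section wasserstein_empirical.
Context {R : realType} {n p1 p2 : nat} (M M' : 'M[R]_(n, p1 + p2)).
Context (n0 : (0 < n)%N).

Let rows k : krein R * krein R := oapp
  (fun i => (krein_pad (row i M), krein_pad (row i M'))) point (insub k).

Let nu : {measure set (krein R * krein R)%type -> \bar R} :=
  mscale ((n%:R^-1 : R)%:nng)%R (msum (fun k => dirac (rows k)) n).

Let nuE B : nu B = ((n%:R^-1)%:E * \sum_(i < n)
  \d_(krein_pad (row i M), krein_pad (row i M')) B)%E.
Proof.
rewrite /nu /mscale/= /msum; congr (_ * _)%E.
by apply: eq_bigr => i _; rewrite /rows valK.
Qed.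

Let nu_setT : nu setT = 1%E.
Proof.
rewrite nuE; under eq_bigr do rewrite diracT.
rewrite sumEFin big_const_ord iter_addr_0 -EFinM mulVf// pnatr_eq0.
by rewrite -lt0n.
Qed.

Let nuP : probability (krein R * krein R)%type R :=
  HB.pack (Measure.sort nu) (Measure.class nu)
    (Measure_isProbability.Build _ _ _ nu nu_setT).

(** The coupling [nuP] matches the rows of equal index; the mean of the row distances is then at
    most the root of the mean of their squares. *)
Lemma wasserstein_empirical_le :
  (wasserstein (empirical_measure M) (empirical_measure M') <=
   (Num.sqrt (n%:R^-1 * frobenius_norm (M - M') ^+ 2))%:E)%E.
Proof.
apply: (@le_trans _ _ (\int[nuP]_z (`|z.1 - z.2|%R)%:E)%E).
  apply: ereal_inf_lbound; exists nuP => //= B mB.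
  by split; rewrite nuE.
have mdist : measurable_fun setT (fun z : krein R * krein R => (`|z.1 - z.2|)%:E).
  by apply/measurable_EFinP; exact: krein_dist_measurable.
have -> : (\int[nuP]_z (`|z.1 - z.2|%R)%:E = (n%:R^-1)%:E *
    \sum_(i < n) (`|krein_pad (row i M) - krein_pad (row i M')|)%:E)%E.
  rewrite -[LHS]/(\int[nu]_z (`|z.1 - z.2|%R)%:E)%E.
  rewrite ge0_integral_mscale//= ge0_integral_measure_sum//.
  congr (_ * _)%E; apply: eq_bigr => i _.
  by rewrite integral_dirac// diracT mul1e /rows valK.
rewrite sumEFin -EFinM lee_fin; apply: (le_trans (mean_le_sqrt _ n0)).
rewrite ler_wsqrtr// ler_wpM2l ?invr_ge0// frobenius_norm_sqr.
by apply: ler_sum => i _; exact: krein_pad_dist.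
Qed.

Lemma wasserstein_ge0 (F1 F2 : {measure set (krein R) -> \bar R}) :
  (0 <= wasserstein F1 F2)%E.
Proof.
by apply: le_ereal_inf_tmp => _ [m _ <-]; apply: integral_ge0 => z _; rewrite lee_fin.
Qed.

End wasserstein_empirical.

(** * Error of the embedding *)

(** The deterministic core for one sign, to be used for [G + E] with [x, y] and for its negative
    with [y, x]. The three smallness conditions ensure, in this order, that the norms of the [x j]
    are close to [lam j], that each residual is small against the gap, and that the Courant-Fischer
    bound is accurate to a quarter of the gap. *)
Lemma embedding_half (R : realType) n (G E : 'M[R]_n) (x y : nat -> 'cV[R]_n)
    (lam : nat -> R) (S t e g l : R) p m m' mu a nu b :
  spectral_split (G + E) m m' mu a nu b ->
  (forall i i', \sum_(k < N) (x k i 0 * x k i' 0 - y k i 0 * y k i' 0)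
     @[N --> \oo] --> G i i') ->
  (forall N, \sum_(k < N) \sum_(k' < N)
     (dot (x k) (x k') - lam k *+ (k == k' :> nat)) ^+ 2 <= S) ->
  (forall N, \sum_(k < N) \sum_(k' < N) dot (y k) (x k') ^+ 2 <= S) ->
  (forall N, \sum_(k < N) dot (x k) (x k) <= t) ->
  (forall N, \sum_(k < N) dot (y k) (y k) <= t) ->
  0 <= e -> (forall v, dot (E *m v) (E *m v) <= e ^+ 2 * dot v v) ->
  0 < g -> 0 < l -> (forall j, 0 <= lam j) ->
  (forall i j, (i <= j)%N -> lam j <= lam i) ->
  (forall j, (j < p)%N -> g <= lam j - lam j.+1) ->
  (forall j, (j < p)%N -> l <= lam j) ->
  S <= (l / 2) ^+ 2 -> 8 * (t * S) + 2 * (e ^+ 2 * t) <= g ^+ 2 * l / 32 ->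
  Num.sqrt S + e <= g / 4 ->
  let err j :=
    Num.sqrt (mu j) *: ((-1) ^+ (dot (a j) (x j) < 0)%R *: a j) - x j in
  (forall j, (j < p)%N -> (j < m)%N) /\ \sum_(j < p) dot (err j) (err j) <=
  28 * (8 * (t * S) + 2 * (e ^+ 2 * t)) / g ^+ 2 +
  4 * (8 * (t * S) + 2 * (e ^+ 2 * t)) / l ^+ 2 + 4 * S / l.
Proof.
move=> TS GE Sxx Syx tx ty e0 Eop g0 l0 lam0 lam_noninc lam_gap lam_ge cS cR cg.
cbv zeta; set Rs := 8 * (t * S) + 2 * (e ^+ 2 * t) in cR *.
pose res j := dot ((G + E) *m x j - lam j *: x j) ((G + E) *m x j - lam j *: x j).
have res0 j : 0 <= res j by exact: dot_ge0.
have resS : \sum_(j < p) res j <= Rs.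
  exact: (gram_residual_sum GE Sxx Syx tx ty Eop).
have res_le j : (j < p)%N -> res j <= g ^+ 2 * l / 32.
  move=> jp; apply: le_trans cR; apply: le_trans resS.
  by rewrite (bigD1 (Ordinal jp))//= lerDl sumr_ge0.
have diagS : \sum_(j < p) (dot (x j) (x j) - lam j) ^+ 2 <= S.
  apply: le_trans (Sxx p); apply: ler_sum => j _.
  rewrite (bigD1 j)//= eqxx mulr1n lerDl sumr_ge0// => k _; exact: sqr_ge0.
have x_norm j : (j < p)%N -> `|dot (x j) (x j) - lam j| <= lam j / 2.
  move=> jp; apply: (@le_trans _ _ (l / 2)); last first.
    by rewrite ler_pM2r ?invr_gt0// lam_ge.
  rewrite -(ler_pXn2r (ltn0Sn 1)) ?nnegrE ?divr_ge0 ?(ltW l0)//.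
  rewrite real_normK ?num_real//; apply: le_trans cS; apply: le_trans diagS.
  rewrite (bigD1 (Ordinal jp))//= lerDl sumr_ge0// => k _; exact: sqr_ge0.
have upper j : (j < p)%N ->
    forall v, (forall i, (i <= j)%N -> dot (x i) v = 0) ->
    dot v ((G + E) *m v) <= (lam j.+1 + (Num.sqrt S + e)) * dot v v.
  move=> jp v vx.
  exact: (gram_upper GE Sxx e0 Eop lam0 lam_noninc vx).
split.
  move=> j jp; have [] := eigenvalue_localization TS g0 l0 lam0 lam_gap lam_ge
    x_norm res_le cg upper jp; by [].
apply: (@le_trans _ _ (\sum_(j < p) (28 * res j / g ^+ 2 + 4 * res j / l ^+ 2 +
    4 * (dot (x j) (x j) - lam j) ^+ 2 / l))).
  apply: ler_sum => j _.
  exact: (embedding_column_error TS g0 l0 lam0 lam_gap lam_ge x_norm res_le cg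
    upper (ltn_ord j)).
rewrite !big_split/= -!mulr_suml -!mulr_sumr.
have ig : 0 < (g ^+ 2)^-1 by rewrite invr_gt0 exprn_gt0.
have il : 0 < (l ^+ 2)^-1 by rewrite invr_gt0 exprn_gt0.
have ill : 0 < l^-1 by rewrite invr_gt0.
apply: lerD; first apply: lerD.
- by rewrite ler_pM2r// ler_pM2l.
- by rewrite ler_pM2r// ler_pM2l.
- by rewrite ler_pM2r// ler_pM2l.
Qed.

Section embedding_error.
Context {R : realType} {lam gam : nat -> R}
  {d : measure_display} {Omega : measurableType d} {P : probability Omega R}
  {Z : nat -> {RV P >-> krein R}} {A : nat -> nat -> {RV P >-> bool}}.
Context (ZA : random_graph Z A).

Definition scaled_column (part : krein R -> ell2 R) n w k : 'cV[R]_n :=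
  \col_i ((Num.sqrt n%:R)^-1 * part (Z i w) k).

(** The sign that makes the inner product with the hidden column nonnegative, hence the closer of
    the two choices; a zero inner product leaves the eigenvector as it is. *)
Definition embedding_sign n w
    (D : signed_eigendecomposition (adjacency_matrix A n w)) p
    (j : 'I_(p + p)) : bool :=
  match fintype.split j with
  | inl k => dot (vecpos D k) (scaled_column fst n w k) < 0
  | inr k => dot (vecneg D k) (scaled_column snd n w k) < 0
  end.

(** The noise is [n^(-1)] times centered edges minus a diagonal matrix, with squared operator norms
    at most [kappa^2 * n] and [n * q] before scaling; this explains [e]. The trace bound [t] comes
    from [|z|^2 <= 1 + |z|^4]. *)
Lemma embedding_error n w
    (D : signed_eigendecomposition (adjacency_matrix A n w)) p
    (S q kappa g l : R) : (0 < n)%N ->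
  (forall N, gram_deviation (lam := lam) (gam := gam) (Z := Z) n N w <= S) ->
  n%:R^-1 * \sum_(i < n) `|Z i w| ^+ 4 <= q ->
  (forall v, dot (centered_adjacency (Z := Z) (A := A) n w *m v)
                 (centered_adjacency (Z := Z) (A := A) n w *m v) <=
     (kappa * Num.sqrt n%:R) ^+ 2 * dot v v) ->
  0 < g -> 0 < l -> (forall j, 0 <= lam j) -> (forall j, 0 <= gam j) ->
  (forall i j, (i <= j)%N -> lam j <= lam i) ->
  (forall i j, (i <= j)%N -> gam j <= gam i) ->
  (forall j, (j < p)%N -> g <= lam j - lam j.+1) ->
  (forall j, (j < p)%N -> g <= gam j - gam j.+1) ->
  (forall j, (j < p)%N -> l <= lam j) -> (forall j, (j < p)%N -> l <= gam j) ->
  let t := 1 + q in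
  let e := Num.sqrt ((2 * kappa ^+ 2 + 2 * q) / n%:R) in
  let rs := 8 * (t * S) + 2 * (e ^+ 2 * t) in
  S <= (l / 2) ^+ 2 -> rs <= g ^+ 2 * l / 32 -> Num.sqrt S + e <= g / 4 ->
  n%:R^-1 * frobenius_norm (spectral_embedding D (@embedding_sign n w D p) -
     truncated_data n p p (fun i => Z i w)) ^+ 2 <=
  2 * (28 * rs / g ^+ 2 + 4 * rs / l ^+ 2 + 4 * S / l).
Proof.
move=> n0 HS Hq Hk g0 l0 lam0 gam0 lamd gamd lamg gamg laml gaml t e rs cS cR cg.
pose x := scaled_column fst n w; pose y := scaled_column snd n w.
have nR : 0 < n%:R :> R by rewrite ltr0n.
have sn0 : 0 < Num.sqrt n%:R :> R by rewrite sqrtr_gt0.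
have sn2 : (Num.sqrt n%:R)^-1 * (Num.sqrt n%:R)^-1 = n%:R^-1 :> R.
  by rewrite -invfM -expr2 sqr_sqrtr// ltW.
pose G : 'M[R]_n := \matrix_(i, j) (n%:R^-1 * krein_inner (Z i w) (Z j w)).
pose E : 'M[R]_n := n%:R^-1 *: adjacency_matrix A n w - G.
have TE : n%:R^-1 *: adjacency_matrix A n w = G + E by rewrite /E addrC subrK.
have dotxy (f f' : krein R -> ell2 R) k k' :
    dot (scaled_column f n w k) (scaled_column f' n w k') =
    n%:R^-1 * \sum_(i < n) f (Z i w) k * f' (Z i w) k'.
  rewrite /dot mulr_sumr; apply: eq_bigr => i _; rewrite !mxE -sn2; ring.
have GE i j : \sum_(k < N) (x k i 0 * x k j 0 - y k i 0 * y k j 0)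
     @[N --> \oo] --> G i j.
  rewrite mxE.
  have -> : (fun N => \sum_(k < N) (x k i 0 * x k j 0 - y k i 0 * y k j 0)) =
      (fun N => n%:R^-1 * \sum_(k < N) ((Z i w).1 k * (Z j w).1 k -
         (Z i w).2 k * (Z j w).2 k)).
    apply/funext => N; rewrite mulr_sumr; apply: eq_bigr => k _.
    by rewrite !mxE -sn2; ring.
  by apply: cvgMl_tmp; exact: krein_inner_cvg.
have GE' i j : \sum_(k < N) (y k i 0 * y k j 0 - x k i 0 * x k j 0)
     @[N --> \oo] --> (- G) i j.
  rewrite mxE.
  have -> : (fun N => \sum_(k < N) (y k i 0 * y k j 0 - x k i 0 * x k j 0)) =
      (fun N => - \sum_(k < N) (x k i 0 * x k j 0 - y k i 0 * y k j 0)).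
    by apply/funext => N; rewrite -sumrN; apply: eq_bigr => k _; rewrite opprB.
  by apply: cvgN; exact: GE.
have split3 N : [/\ \sum_(k < N) \sum_(k' < N)
      (dot (x k) (x k') - lam k *+ (k == k' :> nat)) ^+ 2 <= S,
    \sum_(k < N) \sum_(k' < N)
      (dot (y k) (y k') - gam k *+ (k == k' :> nat)) ^+ 2 <= S &
    \sum_(k < N) \sum_(k' < N) dot (x k) (y k') ^+ 2 <= S].
  split; apply: le_trans (HS N); apply: ler_sum => k _; apply: ler_sum => k' _;
    rewrite dotxy; set u := _ ^+ 2;
    have u1 := sqr_ge0 (cross_moment_xx (lam := lam) (Z := Z) n w k k');
    have u2 := sqr_ge0 (cross_moment_yy (gam := gam) (Z := Z) n w k k');
    have u3 := sqr_ge0 (cross_moment_xy (Z := Z) n w k k').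
  - rewrite -[u]/(cross_moment_xx (lam := lam) (Z := Z) n w k k' ^+ 2).
    by rewrite -addrA lerDl addr_ge0.
  - rewrite -[u]/(cross_moment_yy (gam := gam) (Z := Z) n w k k' ^+ 2).
    by rewrite addrAC lerDr addr_ge0.
  - by rewrite -[u]/(cross_moment_xy (Z := Z) n w k k' ^+ 2) lerDr addr_ge0.
have norm_sum (f : krein R -> ell2 R) :
    (forall z N, \sum_(k < N) f z k ^+ 2 <= `|z| ^+ 2) -> forall N,
    \sum_(k < N) dot (scaled_column f n w k) (scaled_column f n w k) <= t.
  move=> fz N; under eq_bigr do rewrite dotxy.
  rewrite -mulr_sumr exchange_big/=.
  apply: (@le_trans _ _ (n%:R^-1 * \sum_(i < n) (1 + `|Z i w| ^+ 4))).
    rewrite ler_pM2l ?invr_gt0//; apply: ler_sum => i _.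
    under eq_bigr do rewrite -expr2.
    apply: (le_trans (fz _ _)).
    have := norm_le_sqrD1 (`|Z i w| ^+ 2).
    by rewrite -exprM ger0_norm ?exprn_ge0.
  rewrite big_split/= mulrDr sumr_const card_ord mulVf ?gt_eqF//.
  by rewrite lerD2l.
have tx : forall N, \sum_(k < N) dot (x k) (x k) <= t.
  apply: norm_sum => z N; apply: le_trans (krein_norm_sqr_ge z N).
  by rewrite lerDl sumr_ge0// => k _; exact: sqr_ge0.
have ty : forall N, \sum_(k < N) dot (y k) (y k) <= t.
  apply: norm_sum => z N; apply: le_trans (krein_norm_sqr_ge z N).
  by rewrite lerDr sumr_ge0// => k _; exact: sqr_ge0.
have q0 : 0 <= q.
  apply: le_trans Hq; apply: mulr_ge0; first by rewrite invr_ge0.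
  by apply: sumr_ge0 => i _; exact: exprn_ge0.
have e0 : 0 <= e by exact: sqrtr_ge0.
have k20 : 0 <= 2 * kappa ^+ 2 by rewrite mulr_ge0// sqr_ge0.
have e2 : e ^+ 2 = (2 * kappa ^+ 2 + 2 * q) / n%:R.
  by rewrite sqr_sqrtr// divr_ge0// addr_ge0// mulr_ge0.
(* As [A] has zero diagonal, the diagonal of [E] is that of [- G]. The operator norm of this part is
   a maximum over [i], which the sum of the fourth powers dominates. *)
pose Dg : 'M[R]_n := \matrix_(i, j)
  (if i == j then krein_inner (Z i w) (Z i w) else 0).
pose Ec := centered_adjacency (Z := Z) (A := A) n w.
have EE : E = n%:R^-1 *: (Ec - Dg).
  apply/matrixP => i j; rewrite !mxE; case: eqVneq => [<-|ij].
    by case: ZA => _ _ ->; rewrite mulr0n; ring.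
  by ring.
have Dgop v : dot (Dg *m v) (Dg *m v) <= n%:R * q * dot v v.
  rewrite !dotE2 mulr_sumr; apply: ler_sum => i _.
  have -> : (Dg *m v) i 0 = krein_inner (Z i w) (Z i w) * v i 0.
    rewrite mxE (bigD1 i)//= mxE eqxx big1 ?addr0// => j ji.
    by rewrite mxE eq_sym (negbTE ji) mul0r.
  rewrite exprMn ler_wpM2r ?sqr_ge0//.
  apply: (@le_trans _ _ (`|Z i w| ^+ 4)).
    have -> : `|Z i w| ^+ 4 = (`|Z i w| ^+ 2) ^+ 2 by rewrite -exprM.
    rewrite -[leLHS]real_normK ?num_real//; apply: lerXn2r; rewrite ?nnegrE//.
    exact: krein_inner_diag_le.
  move: Hq; rewrite ler_pdivrMl// => Hq'; apply: le_trans Hq'.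
  by rewrite (bigD1 i)//= lerDl; apply: sumr_ge0 => j _; exact: exprn_ge0.
have Eop v : dot (E *m v) (E *m v) <= e ^+ 2 * dot v v.
  rewrite EE -scalemxAl dotZl dotZr mulmxBl.
  have h1 : dot (Ec *m v - Dg *m v) (Ec *m v - Dg *m v) <=
      (2 * kappa ^+ 2 + 2 * q) * n%:R * dot v v.
    apply: (le_trans (dot_sqrD_le _ _)); rewrite dotNl dotNr opprK.
    have -> : (2 * kappa ^+ 2 + 2 * q) * n%:R * dot v v =
       2 * ((kappa ^+ 2 * n%:R) * dot v v) + 2 * (n%:R * q * dot v v) by ring.
    apply: lerD; rewrite ler_pM2l//.
    have -> : kappa ^+ 2 * n%:R = (kappa * Num.sqrt n%:R) ^+ 2.
      by rewrite exprMn sqr_sqrtr// ltW.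
    exact: Hk.
  have -> : e ^+ 2 * dot v v =
      n%:R^-1 * (n%:R^-1 * ((2 * kappa ^+ 2 + 2 * q) * n%:R * dot v v)).
    by rewrite e2; field; rewrite gt_eqF.
  by rewrite !ler_pM2l ?invr_gt0.
have EopN v : dot (- E *m v) (- E *m v) <= e ^+ 2 * dot v v.
  by rewrite mulNmx dotNl dotNr opprK.
have nV : 0 <= n%:R^-1 :> R by rewrite invr_ge0.
have [TS TS'] := eigendecomposition_split D nV.
rewrite TE in TS; rewrite TE opprD in TS'.
have Sxx N : \sum_(k < N) \sum_(k' < N)
    (dot (x k) (x k') - lam k *+ (k == k' :> nat)) ^+ 2 <= S.
  by have [] := split3 N.
have Syy N : \sum_(k < N) \sum_(k' < N)
    (dot (y k) (y k') - gam k *+ (k == k' :> nat)) ^+ 2 <= S.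
  by have [] := split3 N.
have Sxy N : \sum_(k < N) \sum_(k' < N) dot (x k) (y k') ^+ 2 <= S.
  by have [] := split3 N.
have Syx N : \sum_(k < N) \sum_(k' < N) dot (y k) (x k') ^+ 2 <= S.
  rewrite exchange_big/=; apply: le_trans (Sxy N).
  by apply: ler_sum => k _; apply: ler_sum => k' _; rewrite dotC.
have [px hx] := embedding_half TS GE Sxx Syx tx ty e0 Eop g0 l0 lam0 lamd lamg laml
  cS cR cg.
have [py hy] := embedding_half TS' GE' Syy Sxy ty tx e0 EopN g0 l0 gam0 gamd gamg gaml
  cS cR cg.
rewrite frobenius_norm_sqr.
(* One summand for the positive half, one for the negative half. *)
have -> : forall u : R, 2 * u = u + u by move=> u; ring.
apply: le_trans (lerD hx hy).
rewrite exchange_big/= big_split_ord/= mulrDr.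
have sq (r : R) : 0 <= r -> Num.sqrt (n%:R^-1 * r) = (Num.sqrt n%:R)^-1 * Num.sqrt r.
  by move=> r0; rewrite sqrtrM ?invr_ge0 ?ltW// sqrtrV ?ltW.
(* The factor [1 / n] of the squared error is distributed over the eigenvalue and the hidden column,
   which turns [A] into [A / n] and the data into the scaled columns. *)
have cell (sg : bool) (m v z : R) : 0 <= m ->
    n%:R^-1 * (Num.sqrt m * ((-1) ^+ sg * v) - z) ^+ 2 =
    (Num.sqrt (n%:R^-1 * m) * ((-1) ^+ sg * v) - (Num.sqrt n%:R)^-1 * z) ^+ 2.
  by move=> m0; rewrite sq// -sn2; ring.
have splitl (j : 'I_p) : fintype.split (lshift p j) = inl j := unsplitK (inl j).
have splitr (j : 'I_p) : fintype.split (rshift p j) = inr j := unsplitK (inr j).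
rewrite le_eqVlt; apply/orP; left; apply/eqP; congr (_ + _);
  rewrite mulr_sumr; apply: eq_bigr => j _;
  rewrite mulr_sumr; apply: eq_bigr => i _; rewrite -expr2.
  rewrite mxE [X in _ + X]mxE /spectral_embedding /truncated_data !row_mxEl.
  rewrite !mxE /embedding_sign splitl cell//.
  exact/evpos_ge0/px.
rewrite mxE [X in _ + X]mxE /spectral_embedding /truncated_data !row_mxEr.
rewrite !mxE /embedding_sign splitr cell//.
exact/ltW/evneg_gt0/py.
Qed.

End embedding_error.

(** Here [K / N], [C / N] and [C'^2 / N] stand for the moment deviation, the residual sum and the
    squared accuracy of the Courant-Fischer bound, and the factor multiplying [P] collects what the
    three smallness conditions require of [N / P]. The decisive one compares the residual sum with
    [g^2 * l], which is exactly of order [1 / P]: this is where the exponent [2 * beta + alpha]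
    originates. In the final bound 28 and 4 add up to 32. *)
Lemma rate_constants (R : realType) (c K C C' g l P W N : R) :
  0 < c -> 0 <= K -> 0 <= C -> 0 <= C' -> 0 < g -> 0 < l -> 0 < P -> 0 <= W ->
  0 < N ->
  g ^+ 2 * l = c ^+ 3 / P -> c ^+ 2 / P <= g ^+ 2 -> c ^+ 2 / P <= l ^+ 2 ->
  (g ^+ 2)^-1 <= W / c ^+ 2 -> (l ^+ 2)^-1 <= W / c ^+ 2 -> l^-1 <= W / c ->
  P * (1 + 4 * K / c ^+ 2 + 32 * C / c ^+ 3 + 16 * C' ^+ 2 / c ^+ 2) <= N ->
  [/\ K / N <= (l / 2) ^+ 2, C / N <= g ^+ 2 * l / 32,
      C' ^+ 2 / N <= (g / 4) ^+ 2 &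
      2 * (28 * (C / N) / g ^+ 2 + 4 * (C / N) / l ^+ 2 + 4 * (K / N) / l) <=
      2 * (32 * C / c ^+ 2 + 4 * K / c) * (W / N)].
Proof.
move=> c0 K0 C0 C'0 g0 l0 P0 W0 N0 gl gP lP gW lW l1W PN.
have c2 : 0 < c ^+ 2 by rewrite exprn_gt0.
have c3 : 0 < c ^+ 3 by rewrite exprn_gt0.
have k1 : 0 <= 4 * K / c ^+ 2 by rewrite divr_ge0 ?mulr_ge0// ltW.
have k2 : 0 <= 32 * C / c ^+ 3 by rewrite divr_ge0 ?mulr_ge0// ltW.
have k3 : 0 <= 16 * C' ^+ 2 / c ^+ 2.
  by rewrite divr_ge0 ?mulr_ge0 ?sqr_ge0// ltW.
have lift a b : 0 < b -> 0 <= a -> P * (a / b) <= N -> a / N <= b / P.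
  move=> b0 a0 h; rewrite ler_pdivrMr// mulrAC ler_pdivlMr//.
  by move: h; rewrite mulrA ler_pdivrMr// mulrC (mulrC N).
have sub x : x <= 1 + 4 * K / c ^+ 2 + 32 * C / c ^+ 3 + 16 * C' ^+ 2 / c ^+ 2 ->
    P * x <= N.
  by move=> h; apply: le_trans PN; rewrite ler_pM2l.
have h1 : K / N <= c ^+ 2 / P / 4.
  have := lift (4 * K) (c ^+ 2) c2; rewrite mulr_ge0// => /(_ isT) h.
  suff : 4 * K / N <= c ^+ 2 / P by lra.
  by apply: h; apply: sub; lra.
have h2 : C / N <= c ^+ 3 / P / 32.
  have := lift (32 * C) (c ^+ 3) c3; rewrite mulr_ge0// => /(_ isT) h.
  suff : 32 * C / N <= c ^+ 3 / P by lra.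
  by apply: h; apply: sub; lra.
have h3 : C' ^+ 2 / N <= c ^+ 2 / P / 16.
  have := lift (16 * C' ^+ 2) (c ^+ 2) c2; rewrite mulr_ge0 ?sqr_ge0// => /(_ isT) h.
  suff : 16 * C' ^+ 2 / N <= c ^+ 2 / P by lra.
  by apply: h; apply: sub; lra.
split.
- by apply: (le_trans h1); rewrite exprMn exprVn; lra.
- by rewrite gl.
- by apply: (le_trans h3); rewrite exprMn exprVn; lra.
have CN : 0 <= C / N by rewrite divr_ge0// ltW.
have KN : 0 <= K / N by rewrite divr_ge0// ltW.
have a1 : C / N / g ^+ 2 <= C / N * (W / c ^+ 2) by rewrite ler_wpM2l.
have a2 : C / N / l ^+ 2 <= C / N * (W / c ^+ 2) by rewrite ler_wpM2l.
have a3 : K / N / l <= K / N * (W / c) by rewrite ler_wpM2l.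
have -> : 2 * (32 * C / c ^+ 2 + 4 * K / c) * (W / N) =
  2 * (28 * (C / N * (W / c ^+ 2)) + 4 * (C / N * (W / c ^+ 2)) +
       4 * (K / N * (W / c))) by field; rewrite !gt_eqF.
lra.
Qed.

(** As [x >= 1], everything reduces to comparing exponents: [2 * beta] and [2 * alpha] are at most
    [2 * beta + alpha], and [2 * beta], [2 * alpha] and [alpha] are at most [2 * beta + 1]. *)
Lemma power_rates (R : realType) (c alpha beta x : R) :
  0 < c -> 1 < alpha -> alpha <= beta -> 1 <= x ->
  let g := c * x `^ (- beta) in let l := c * x `^ (- alpha) in
  let P := x `^ (2 * beta + alpha) in let W := x `^ (2 * beta + 1) in
  [/\ g ^+ 2 * l = c ^+ 3 / P, c ^+ 2 / P <= g ^+ 2, c ^+ 2 / P <= l ^+ 2 &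
   [/\ (g ^+ 2)^-1 <= W / c ^+ 2, (l ^+ 2)^-1 <= W / c ^+ 2 & l^-1 <= W / c]].
Proof.
move=> c0 a1 ab x1 g l P W.
have x0 : 0 < x by apply: lt_le_trans x1.
have xn : x != 0 by rewrite gt_eqF.
have c2 : 0 < c ^+ 2 by rewrite exprn_gt0.
have sqE (r : R) : (x `^ r) ^+ 2 = x `^ (2 * r).
  by rewrite -powR_mulrn ?powR_ge0// -powRrM mulrC.
have gE : g ^+ 2 = c ^+ 2 / x `^ (2 * beta).
  by rewrite exprMn sqE mulrN powRN.
have lE : l ^+ 2 = c ^+ 2 / x `^ (2 * alpha).
  by rewrite exprMn sqE mulrN powRN.
have mono (r s : R) : r <= s -> x `^ r <= x `^ s by move=> rs; exact: ler_powR.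
have pos (r : R) : 0 < x `^ r by exact: powR_gt0.
have P0 : 0 < P by exact: pos.
have PE : P = x `^ (2 * beta) * x `^ alpha by rewrite /P powRD// xn implybT.
split.
- rewrite gE /l PE powRN.
  by field; rewrite !gt_eqF.
- rewrite gE ler_pM2l// lef_pV2 ?posrE//; rewrite /P mono//; lra.
- rewrite lE ler_pM2l// lef_pV2 ?posrE//; rewrite /P mono//; lra.
split.
- by rewrite gE invf_div ler_pM2r ?invr_gt0//; rewrite /W mono//; lra.
- by rewrite lE invf_div ler_pM2r ?invr_gt0//; rewrite /W mono//; lra.
- rewrite /l powRN invf_div ler_pM2r ?invr_gt0//; rewrite /W mono//; lra.
Qed.

(** The ratio is eventually below [delta^(-1/s)]; raising this to the power [s] gives the bound. *)
Lemma eventually_power_le (R : realType) (s delta : R) (p : nat -> nat) :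
  0 < s -> 0 < delta ->
  (p n)%:R / n%:R `^ s^-1 @[n --> \oo] --> (0 : R) ->
  \forall n \near \oo, (p n)%:R `^ s * delta <= n%:R.
Proof.
move=> s0 d0 h.
have e0 : 0 < delta^-1 `^ s^-1 by rewrite powR_gt0// invr_gt0.
have h1 := cvgr_lt _ h _ e0.
near=> n.
have n0 : 0 < n%:R :> R by rewrite ltr0n; near: n; exact: nbhs_infty_gt.
have h2 : (p n)%:R / n%:R `^ s^-1 < delta^-1 `^ s^-1 by near: n; exact: h1.
rewrite ltr_pdivrMr ?powR_gt0// in h2.
have h3 : (p n)%:R `^ s <= (delta^-1 `^ s^-1 * n%:R `^ s^-1) `^ s.
  apply: ge0_ler_powR; rewrite ?nnegrE ?(ltW s0) ?(ltW h2)//.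
  by rewrite mulr_ge0// ?powR_ge0.
have e : (delta^-1 `^ s^-1 * n%:R `^ s^-1) `^ s = delta^-1 * n%:R.
  have dn : 0 <= delta^-1 * n%:R by rewrite mulr_ge0// invr_ge0 ltW.
  rewrite -powRM ?invr_ge0 ?(ltW d0) ?(ltW n0)//.
  by rewrite -powRrM mulVf ?gt_eqF// powRr1.
by move: h3; rewrite e ler_pdivlMl// mulrC.
Unshelve. all: by end_near. Qed.

(** The lower bounds at index [j] involve [j.+1], which is at most [p] for [j < p], and negative
    powers decrease. *)
Lemma decay_bounds (R : realType) (alpha beta c1 c2 : R) (lam : nat -> R) :
  0 < c1 -> 0 <= alpha -> 0 <= beta ->
  (forall j, c1 * j.+1%:R `^ (- alpha) <= lam j) ->
  (forall j, c1 * j.+1%:R `^ (- beta) <= lam j - lam j.+1) ->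
  [/\ forall j, 0 <= lam j, forall i j, (i <= j)%N -> lam j <= lam i &
   forall p j, (j < p)%N -> c1 * p%:R `^ (- beta) <= lam j - lam j.+1 /\
     c1 * p%:R `^ (- alpha) <= lam j].
Proof.
move=> c0 a0 b0 lamge lamgap; split.
- by move=> j; apply: le_trans (lamge j); rewrite mulr_ge0 ?powR_ge0// ltW.
- move=> i j /subnK <-; elim: (j - i)%N => [//|k IH].
  rewrite addSn; apply: le_trans IH; rewrite -subr_ge0.
  by apply: le_trans (lamgap _); rewrite mulr_ge0 ?powR_ge0// ltW.
move=> p j jp.
have mono (r : R) : 0 <= r -> p%:R `^ (- r) <= j.+1%:R `^ (- r).
  move=> r0; rewrite !powRN lef_pV2 ?posrE ?powR_gt0 ?ltr0n//; last first.
    exact: leq_ltn_trans jp.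
  by apply: ge0_ler_powR; rewrite ?nnegrE// ler_nat.
by split; [apply: le_trans (lamgap j)|apply: le_trans (lamge j)];
  rewrite ler_pM2l// mono.
Qed.

(** Makes the dependence on [N] explicit: with [S = K / N] and [e^2 = v / N], the residual bound is
    [C / N], and [Num.sqrt S + e] is [C'] divided by [Num.sqrt N]. *)
Lemma rate_conditions (R : realType) (q K kappa g N : R) :
  0 <= q -> 0 <= K -> 0 < N -> 0 < g ->
  let t := 1 + q in
  let v := 2 * kappa ^+ 2 + 2 * q in
  let C := 8 * (t * K) + 2 * (v * t) in
  let C' := Num.sqrt K + Num.sqrt v in
  let e := Num.sqrt (v / N) in
  [/\ 0 <= C, 0 <= C',
    8 * (t * (K / N)) + 2 * (e ^+ 2 * t) = C / N &
    C' ^+ 2 / N <= (g / 4) ^+ 2 -> Num.sqrt (K / N) + e <= g / 4].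
Proof.
move=> q0 K0 N0 g0 t v C C' e.
have t0 : 0 <= t by rewrite addr_ge0.
have v0 : 0 <= v by rewrite addr_ge0// mulr_ge0// sqr_ge0.
have NV : 0 <= N^-1 by rewrite invr_ge0 ltW.
split.
- by rewrite addr_ge0// mulr_ge0// mulr_ge0.
- by rewrite addr_ge0// sqrtr_ge0.
- by rewrite sqr_sqrtr ?mulr_ge0// /C; field; rewrite gt_eqF.
move=> h; rewrite /e !sqrtrM// sqrtrV ?(ltW N0)// -mulrDl.
rewrite -(ler_pXn2r (ltn0Sn 1)) ?nnegrE; last 2 first.
- by rewrite mulr_ge0 ?addr_ge0 ?sqrtr_ge0// invr_ge0 sqrtr_ge0.
- by rewrite divr_ge0// ltW.
by rewrite exprMn exprVn sqr_sqrtr// ltW.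
Qed.

Lemma frobenius_norm_col0 (R : realType) n k (M : 'M[R]_(n, k)) : k = 0%N ->
  frobenius_norm M ^+ 2 = 0.
Proof.
move=> k0; rewrite frobenius_norm_sqr big1// => i _.
by apply: big1 => j _; exfalso; have := ltn_ord j; rewrite {2}k0.
Qed.

Section rate.
Context {R : realType} {F : probability (krein R) R} {lam gam : nat -> R}
  {alpha beta : R} {d : measure_display} {Omega : measurableType d}
  {P : probability Omega R} {Z : nat -> {RV P >-> krein R}}
  {A : nat -> nat -> {RV P >-> bool}} {p : nat -> nat}.
Context (grd : graph_root_distribution F)
  (unc : uncorrelated_coordinates F lam gam)
  (dec : polynomial_decay alpha beta lam gam) (m4 : finite_fourth_moment F)
  (ZF : iid_from F Z) (ZA : random_graph Z A)
  (pn : (p n)%:R / n%:R `^ (2 * beta + alpha)^-1 @[n --> \oo] --> (0 : R))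
  (D : forall n w, signed_eigendecomposition (adjacency_matrix A n w)).

Let error n w : R := n%:R^-1 * frobenius_norm
  (spectral_embedding (D n w) (@embedding_sign _ _ _ _ Z A n w (D n w) (p n))
   - truncated_data n (p n) (p n) (fun i => Z i w)) ^+ 2.

Lemma embedding_error_tail (eps : R) : 0 < eps -> exists2 M : R, 0 <= M &
  \forall n \near \oo, (0 < n)%N /\ exists N : set Omega,
    [/\ measurable N, (P N <= eps%:E)%E &
      forall w, ~ N w ->
        error n w <= M * ((p n)%:R `^ (2 * beta + 1) / n%:R)].
Proof.
move=> eps0.
have [a1 [ab [c [c2 [c0 _ decay]]]]] := dec.
have a0 : 0 <= alpha by rewrite ltW// (lt_trans ltr01).
have b0 : 0 <= beta by exact: le_trans ab.
have [lam0 lamd lamb] : [/\ forall j, 0 <= lam j,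
    forall i j, (i <= j)%N -> lam j <= lam i &
    forall p j, (j < p)%N -> c * p%:R `^ (- beta) <= lam j - lam j.+1 /\
     c * p%:R `^ (- alpha) <= lam j].
  apply: decay_bounds => // j; have [h1 _ h2] := decay j.
    by move: h1; rewrite le_min => /andP[].
  by move: h2; rewrite le_min => /andP[].
have [gam0 gamd gamb] : [/\ forall j, 0 <= gam j,
    forall i j, (i <= j)%N -> gam j <= gam i &
    forall p j, (j < p)%N -> c * p%:R `^ (- beta) <= gam j - gam j.+1 /\
     c * p%:R `^ (- alpha) <= gam j].
  apply: decay_bounds => // j; have [h1 _ h2] := decay j.
    by move: h1; rewrite le_min => /andP[].
  by move: h2; rewrite le_min => /andP[].
have eps3 : 0 < eps / 3 by rewrite divr_gt0.
pose fm := fourth_moment (F := F).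
have fm0 : 0 < fm by exact: fourth_moment_gt0.
(* The same [q] bounds the average fourth power and, divided by [n], the moment deviation; each
   fails with probability at most [eps / 3]. *)
pose q := fm / (eps / 3); have q0 : 0 < q by rewrite divr_gt0.
(* From here on only the existence of a constant matters, so its value is hidden. *)
have [kappa Hk] : exists kappa : R, forall n, (0 < n)%N ->
  exists N : set Omega, [/\ measurable N, (P N <= (expR (- n%:R))%:E)%E &
    forall w, ~ N w -> forall v,
      dot (centered_adjacency (Z := Z) (A := A) n w *m v)
          (centered_adjacency (Z := Z) (A := A) n w *m v) <=
      (kappa * Num.sqrt n%:R) ^+ 2 * dot v v].
  by exists 261 => n n0; exact: (centered_adjacency_opnorm_tail grd ZF ZA).
pose t := 1 + q; pose v := 2 * kappa ^+ 2 + 2 * q.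
pose C := 8 * (t * q) + 2 * (v * t).
pose C' := Num.sqrt q + Num.sqrt v.
(* Instantiated at [N = g = 1] for the signs of [C] and [C'], which depend on neither. *)
have [C0 C'0 _ _] := @rate_conditions R q q kappa 1 1 (ltW q0) (ltW q0) ltr01 ltr01.
pose delta := 1 + 4 * q / c ^+ 2 + 32 * C / c ^+ 3 + 16 * C' ^+ 2 / c ^+ 2.
have delta0 : 0 < delta.
  rewrite /delta -!addrA ltr_wpDr// !addr_ge0// divr_ge0 ?exprn_ge0 ?(ltW c0)//;
  by rewrite mulr_ge0 ?exprn_ge0// ltW.
have s0 : 0 < 2 * beta + alpha.
  by rewrite ltr_wpDl ?mulr_ge0// (lt_trans ltr01).
have ev := eventually_power_le s0 delta0 pn.
pose M := 2 * (32 * C / c ^+ 2 + 4 * q / c).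
have M0 : 0 <= M.
  by rewrite mulr_ge0// addr_ge0// divr_ge0 ?exprn_ge0 ?(ltW c0)// mulr_ge0// ltW.
exists M => //; near=> n.
have n0 : (0 < n)%N by near: n; exact: nbhs_infty_gt.
have Pn : (p n)%:R `^ (2 * beta + alpha) * delta <= n%:R by near: n; exact: ev.
have nR : 0 < n%:R :> R by rewrite ltr0n.
split => //.
have [N3 [mN3 PN3 HN3]] := Hk n n0.
have [mN1 PN1] := gram_deviation_tail unc m4 ZF n0 eps3.
have [mN2 PN2] := fourth_moment_tail m4 ZF n0 eps3.
set N1 := (X in measurable X) in mN1 PN1.
set N2 := (X in measurable X) in mN2 PN2.
exists (N1 `|` N2 `|` N3); split.
- by apply: measurableU => //; exact: measurableU.
- have -> : eps = eps / 3 + eps / 3 + eps / 3 by field.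
  rewrite !EFinD; apply: (le_trans (measureU2 _ _ _)) => //.
    exact: measurableU.
  apply: leeD.
    by apply: (le_trans (measureU2 _ _ _)) => //; exact: leeD.
  apply: (le_trans PN3); rewrite lee_fin.
  (* The third event has probability at most [expR (- n)], which is below [eps / 3] once
     [n >= 3 / eps], by [expR n >= 1 + n]. *)
  have e1 : (eps / 3)^-1 <= expR n%:R.
    have h : (eps / 3)^-1 <= n%:R by near: n; exact: nbhs_infty_ger.
    apply: (le_trans h); apply: le_trans (expR_ge1Dx _).
    by rewrite lerDr.
  by rewrite expRN -[leRHS]invrK lef_pV2 ?posrE ?expR_gt0 ?invr_gt0.
move=> w /not_orP[/not_orP[nN1 nN2] nN3].
(* The comparison of exponents needs [p n >= 1]; with no columns the error is zero. *)
have [p0|pp] := posnP (p n).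
  rewrite /error frobenius_norm_col0 ?p0// mulr0.
  by rewrite mulr_ge0// divr_ge0 ?powR_ge0.
have p1 : 1 <= (p n)%:R :> R by rewrite ler1n.
have [gl gP lP [gW lW l1W]] := power_rates c0 a1 ab p1.
set g := c * _ `^ (- beta) in gl gP gW.
set l := c * _ `^ (- alpha) in gl lP lW l1W.
set Pw := _ `^ (2 * beta + alpha) in gl gP lP Pn.
set W := _ `^ (2 * beta + 1) in gW lW l1W *.
have pg (r : R) : 0 < (p n)%:R `^ r by rewrite powR_gt0// ltr0n.
have g_gt0 : 0 < g by rewrite mulr_gt0.
have l_gt0 : 0 < l by rewrite mulr_gt0.
have [k1 k2 k3 k4] := rate_constants c0 (ltW q0) C0 C'0 g_gt0 l_gt0 (pg _)
  (ltW (pg (2 * beta + 1))) nR gl gP lP gW lW l1W Pn.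
have [_ _ rsE sE] := @rate_conditions R q q kappa g n%:R (ltW q0) (ltW q0) nR g_gt0.
have S1 N : gram_deviation (lam := lam) (gam := gam) (Z := Z) n N w <= q / n%:R.
  rewrite leNgt; apply/negP => h; apply: nN1; exists N => //=.
  by rewrite mulrAC.
have Q1 : n%:R^-1 * \sum_(i < n) `|Z i w| ^+ 4 <= q.
  by rewrite leNgt; apply/negP.
have := @embedding_error _ _ _ _ _ _ _ _ ZA n w (D n w) (p n) _ q kappa g l n0 S1 Q1
  (HN3 _ nN3) g_gt0 l_gt0 lam0 gam0 lamd gamd
  (fun j jp => (lamb _ j jp).1) (fun j jp => (gamb _ j jp).1)
  (fun j jp => (lamb _ j jp).2) (fun j jp => (gamb _ j jp).2) k1.
rewrite /= rsE => /(_ k2 (sE k3)) h.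
exact: (le_trans h k4).
Unshelve. all: by end_near. Qed.

End rate.

Theorem theorem4p1 (R : realType) (F : probability (krein R) R)
    (lam gam : nat -> R) (alpha beta : R)
    (d : measure_display) (Omega : measurableType d) (P : probability Omega R)
    (Z : nat -> {RV P >-> krein R}) (A : nat -> nat -> {RV P >-> bool})
    (p : nat -> nat) :
  graph_root_distribution F ->
  uncorrelated_coordinates F lam gam ->
  polynomial_decay alpha beta lam gam ->
  finite_fourth_moment F ->
  iid_from F Z ->
  random_graph Z A ->
  (p n)%:R / n%:R `^ (2 * beta + alpha)^-1 @[n --> \oo] --> (0 : R) ->
  forall D : forall n w, signed_eigendecomposition (adjacency_matrix A n w),
  exists s : forall n, Omega -> 'I_(p n + p n) -> bool,
    let Zhat n w := spectral_embedding (D n w) (s n w) in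
    let Ztrunc n w := truncated_data n (p n) (p n) (fun i => Z i w) in
    bigO_P P
      (fun n w => (n%:R^-1 * frobenius_norm (Zhat n w - Ztrunc n w) ^+ 2)%:E)
      (fun n => n%:R `^ (- ((alpha - 1) / (2 * beta)))
                + (p n)%:R `^ (2 * beta + 1) * n%:R^-1) /\
    bigO_P P
      (fun n w => wasserstein (empirical_measure (Zhat n w))
                              (empirical_measure (Ztrunc n w)))
      (fun n => n%:R `^ (- ((alpha - 1) / (4 * beta)))
                + (p n)%:R `^ (beta + 2^-1) * n%:R `^ (- 2^-1)).
Proof.
move=> grd unc dec m4 ZF ZA pn D.
exists (fun n w => @embedding_sign _ _ _ _ Z A n w (D n w) (p n)).
move=> Zhat Ztrunc; split => eps eps0;
  have [M M0 tail] := embedding_error_tail grd unc dec m4 ZF ZA pn D eps0.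
  exists M; apply: filterS tail => n [n0 [N [mN PN HN]]].
  exists N; split => // w /= h; apply: contrapT => /HN e.
  move: h; apply/negP; rewrite -leNgt lee_fin.
  rewrite ger0_norm; last first.
    by apply: mulr_ge0; [rewrite invr_ge0|exact: sqr_ge0].
  apply: le_trans e _; rewrite ler_wpM2l// lerDr; exact: powR_ge0.
(* The distance is at most the root of the squared error, so the same exceptional event serves, with
   the root of the constant. *)
exists (Num.sqrt M); apply: filterS tail => n [n0 [N [mN PN HN]]].
exists N; split => // w /= h; apply: contrapT => /HN e.
move: h; apply/negP; rewrite -leNgt gee0_abs ?wasserstein_ge0//.
apply: (le_trans (wasserstein_empirical_le _ _ n0)); rewrite lee_fin.
apply: (le_trans (ler_wsqrtr e)).
(* The second summand of the rate is the square root of the rate of the squared error. *)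
have -> : (p n)%:R `^ (2 * beta + 1) / n%:R =
    ((p n)%:R `^ (beta + 2^-1) * n%:R `^ (- 2^-1)) ^+ 2.
  rewrite exprMn -!powR_mulrn ?powR_ge0// -!powRrM; congr (_ `^ _ * _).
    by field.
  by rewrite mulNr mulVf// powR_inv1.
rewrite sqrtrM// sqrtr_sqr ger0_norm ?mulr_ge0 ?powR_ge0//.
by rewrite ler_wpM2l ?sqrtr_ge0// lerDr powR_ge0.
Qed.
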